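(* Let $1\le q,q_1^*,r_1^*<\infty$, $1\le\zeta\le r_1^*$, and let $\omega\in A_\zeta(\mathbb H^n)$ with finite critical index $r_\omega$ for the reverse Hölder condition. Let $\Omega\in L^{q'}(S_{Q-1})$, $b\in CMO^{r_1^*}_\omega(\mathbb H^n)$, and suppose $$\frac1q>\Big(\frac1{q_1^*}+\frac1{r_1^*}\Big)\zeta\,\frac{r_\omega}{r_\omega-1}.$$ Let $\delta\in(1,r_\omega)$ and $\lambda\in(-\frac1{q_1^*},0)$. If $$\mathcal C_9=\int_0^1\frac{\Phi(t)}{t^{1+Q\lambda(\delta-1)/\delta}}(2+\Psi(t))\,dt+\int_1^\infty\frac{\Phi(t)}{t^{1+Q\zeta\lambda}}(2+\Psi(t))\,dt<\infty,\qquad\Psi(t)=t^{-Q}\chi_{(0,1]}(t)+t^{Q}\chi_{(1,\infty)}(t),$$ then $\mathcal H^b_{\Phi,\Omega}$ is bounded from $\dot B^{q_1^*,\lambda}_\omega(\mathbb H^n)$ to $\dot B^{q,\lambda}_\omega(\mathbb H^n)$.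
   Context: Heisenberg group. $\mathbb H^n$ is $\mathbb R^{2n}\times\mathbb R$ with Lebesgue measure ($|E|$ is the measure of $E$) and group law $x\cdot y=\big(x_1+y_1,\dots,x_{2n}+y_{2n},\,x_{2n+1}+y_{2n+1}+2\sum_{j=1}^n(y_jx_{n+j}-x_jy_{n+j})\big)$; the identity is $0$ and $x^{-1}=-x$. Dilations: $\delta_rx=(rx_1,\dots,rx_{2n},r^2x_{2n+1})$, $r>0$. $Q=2n+2$. Norm: $|x|_h=\big((\sum_{i=1}^{2n}x_i^2)^2+x_{2n+1}^2\big)^{1/4}$; distance $d(x,y)=|y^{-1}\cdot x|_h$; balls $B(x,r)=\{y:d(x,y)<r\}$. $S_{Q-1}=\{x:|x|_h=1\}$ carries the measure $dy'$ for which $\int_{\mathbb H^n}f(x)dx=\int_0^\infty\int_{S_{Q-1}}f(\delta_ry')r^{Q-1}dy'dr$. $B_R=\{x\in\mathbb H^n:|x|_h\le R\}$. Operator. $\Phi:\mathbb H^n\to[0,\infty)$ is a radial measurable function (so $\Phi(x)$ depends only on $|x|_h$, and one writes $\Phi(t)$ for its value when $|x|_h=t$); $\Omega:S_{Q-1}\to\mathbb C$ is measurable with $\Omega(y)\ne0$ for almost every $y$; $b$ is locally integrable on $\mathbb H^n$. The commutator of the rough Hausdorff operator is $$\mathcal H^b_{\Phi,\Omega}(f)(x)=\int_0^\infty\int_{S_{Q-1}}\frac{\Phi(t)}{t}\Omega(y')\big(b(x)-b(\delta_{t^{-1}|x|_h}y')\big)f(\delta_{t^{-1}|x|_h}y')\,dy'dt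 .$$ Weights. A weight is a non-negative measurable function on $\mathbb H^n$; $\omega(K)=\int_K\omega(x)dx$. For $1<p<\infty$, $\omega\in A_p(\mathbb H^n)$ if there is $C$ with $\big(\frac1{|B|}\int_B\omega\big)\big(\frac1{|B|}\int_B\omega^{-1/(p-1)}\big)^{p-1}\le C$ for all balls $B$; $\omega\in A_1(\mathbb H^n)$ if $\frac1{|B|}\int_B\omega\le C\operatorname{ess\,inf}_{B}\omega$ for all balls $B$. For $r>1$, $\omega\in RH_r(\mathbb H^n)$ if there is $C$ with $\big(\frac1{|B|}\int_B\omega^r\big)^{1/r}\le\frac C{|B|}\int_B\omega$ for all balls $B$. The critical index is $r_\omega=\sup\{r>1:\omega\in RH_r(\mathbb H^n)\}$. Spaces. $L^q_{\omega,\mathrm{loc}}(X)$ (for $X=\mathbb H^n$ or $\mathbb H^n\setminus\{0\}$) is the set of measurable $f$ with $\int_K|f|^q\omega\,dx<\infty$ for every compact $K\subset X$. For $1\le q<\infty$, $-\frac1q<\lambda<0$, $\dot B^{q,\lambda}_\omega(\mathbb H^n)$ consists of $f\in L^q_{\omega,\mathrm{loc}}(\mathbb H^n\setminus\{0\})$ with $$\|f\|_{\dot B^{q,\lambda}_\omega(\mathbb H^n)}=\sup_{R>0}\Big(\frac1{\omega(B_R)^{1+\lambda q}}\int_{B_R}|f|^q\omega\,dx\Big)^{1/q}<\infty .$$ For $1\le q<\infty$, $CMO^q_\omega(\mathbb H^n)$ consists of $f\in L^q_{\omega,\mathrm{loc}}(\mathbb H^n)$ with $$\|f\|_{CMO^q_\omega(\mathbb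 H^n)}=\sup_{R>0}\Big(\frac1{\omega(B_R)}\int_{B_R}|f(x)-f_{B_R}|^q\omega(x)dx\Big)^{1/q}<\infty,\qquad f_{B_R}=\frac1{|B_R|}\int_{B_R}f(x)dx .$$ Conventions. $s'$ is the conjugate exponent of $s$ ($1'=\infty$). An operator $T$ is bounded from $X$ to $Y$ if for every $f\in X$ the integral defining $Tf(x)$ converges absolutely for a.e. $x$ and $\|Tf\|_Y\le C\|f\|_X$ with $C$ independent of $f$. *)

(* Defs.v *)
From HB Require Import structures.
From mathcomp Require Import all_boot all_order all_algebra.
From mathcomp Require Import all_classical all_reals all_analysis.
From mathcomp Require Import measurable_realfun ess_sup_inf complex.
Set Implicit Arguments.
Unset Strict Implicit.
Unset Printing Implicit Defensive.
Import Order.TTheory GRing.Theory Num.Theory.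
Import numFieldNormedType.Exports.
Local Open Scope classical_set_scope.
Local Open Scope ring_scope.

Lemma sigma_finite_product d1 d2 (T1 : measurableType d1)
    (T2 : measurableType d2) (R : realType)
    (m1 : {sigma_finite_measure set T1 -> \bar R})
    (m2 : {sigma_finite_measure set T2 -> \bar R}) :
  sigma_finite setT (m1 \x m2)%E.
Proof.
have /sigma_finiteP[F [TF ndF Foo]] := sigma_finiteT m1.
have /sigma_finiteP[G [TG ndG Goo]] := sigma_finiteT m2.
exists (fun n => F n `*` G n).
  rewrite -setXTT TF TG predeqE => -[x y]; split.
    move=> [/= [n _ Fnx] [k _ Gky]]; exists (maxn n k) => //; split.
    - by move: x Fnx; exact/subsetPset/ndF/leq_maxl.
    - by move: y Gky; exact/subsetPset/ndG/leq_maxr.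
  by move=> [n _ []/= ? ?]; split; exists n.
move=> k; have [? ?] := Foo k; have [? ?] := Goo k.
split; first exact: measurableX.
by rewrite product_measure1E// lte_mul_pinfty// ge0_fin_numE.
Qed.

(* The product sigma-algebra on R^m, and Lebesgue measure on it as the iterated
   product of the one-dimensional Lebesgue measure; the library has neither. *)
Definition rowvec_display : measure_display.
Proof. exact: default_measure_display. Qed.

Section measurable_rowvec.
Context {R : realType} (m : nat).

Definition rowvec_coord (i : 'I_m) (v : 'rV[R]_m) : R := v ord0 i.

Let rV_set0 : g_sigma_preimage rowvec_coord set0.
Proof. exact: sigma_algebra0. Qed.

Let rV_setC A : g_sigma_preimage rowvec_coord A ->
  g_sigma_preimage rowvec_coord (~` A).
Proof. exact: sigma_algebraC. Qed.

Let rV_bigcup (F : (set 'rV[R]_m)^nat) :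
  (forall i, g_sigma_preimage rowvec_coord (F i)) ->
  g_sigma_preimage rowvec_coord (\bigcup_i (F i)).
Proof. exact: sigma_algebra_bigcup. Qed.

HB.instance Definition _ := @isMeasurable.Build rowvec_display
  'rV[R]_m (g_sigma_preimage rowvec_coord) rV_set0 rV_setC rV_bigcup.

Lemma measurable_rowvec_coord (i : 'I_m) :
  measurable_fun [set: 'rV[R]_m] (rowvec_coord i).
Proof.
move=> _ Y mY; rewrite setTI; apply: sub_sigma_algebra => /=.
rewrite -bigcup_seq/=; exists i => /=; first by rewrite mem_index_enum.
by exists Y => //; rewrite setTI.
Qed.

Lemma measurable_fun_rowvec d (T : measurableType d) (f : T -> 'rV[R]_m) :
  (forall i, measurable_fun [set: T] (fun x => f x ord0 i)) ->
  measurable_fun [set: T] f.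
Proof.
move=> mf; have h : g_sigma_preimage (fun i => rowvec_coord i \o f) `<=` measurable.
  apply: smallest_sub; first exact: sigma_algebra_measurable.
  move=> A; rewrite -bigcup_seq => -[i _ [B mB <-]].
  exact: mf.
move: h; rewrite g_sigma_preimage_comp => h _ A mA.
by apply: h; exists A.
Qed.

End measurable_rowvec.

Definition rowvec_cons {R : realType} m (p : measurableTypeR R * 'rV[R]_m) :
  'rV[R]_m.+1 := row_mx (const_mx p.1 : 'rV[R]_1) p.2.

Lemma measurable_rowvec_cons {R : realType} m :
  measurable_fun [set: measurableTypeR R * 'rV[R]_m] (@rowvec_cons R m).
Proof.
apply: measurable_fun_rowvec => i.
case: (@split_ordP 1 m i) => j ij.
  have -> : (fun x : measurableTypeR R * 'rV[R]_m => rowvec_cons x ord0 i) = fst.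
    apply/funext => x; rewrite /rowvec_cons ij.
    by rewrite (row_mxEl (const_mx x.1 : 'rV[R]_1)) mxE.
  exact: measurable_fst.
have -> : (fun x : measurableTypeR R * 'rV[R]_m => rowvec_cons x ord0 i) =
    rowvec_coord j \o snd.
  apply/funext => x; rewrite /rowvec_cons ij.
  by rewrite (row_mxEr (const_mx x.1 : 'rV[R]_1)).
exact: measurableT_comp (measurable_rowvec_coord j) measurable_snd.
Qed.

Section rowvec_measure_step.
Context {R : realType} (m : nat).
Variable mu : {sigma_finite_measure set 'rV[R]_m -> \bar R}.

Definition rowvec_measureS : set 'rV[R]_m.+1 -> \bar R :=
  pushforward (lebesgue_measure \x mu)%E (@rowvec_cons R m).

Let rowvec_measureS0 : rowvec_measureS set0 = 0%E.
Proof. by rewrite /rowvec_measureS /pushforward preimage_set0 measure0. Qed.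

Let rowvec_measureS_ge0 A : (0 <= rowvec_measureS A)%E.
Proof. by rewrite /rowvec_measureS /pushforward measure_ge0. Qed.

Let rowvec_measureS_sigma_additive : semi_sigma_additive rowvec_measureS.
Proof.
exact: (@measure_semi_sigma_additive _ _ _
  (measure_function_pushforward__canonical__measure_function_Measure
     (lebesgue_measure \x mu)%E (@measurable_rowvec_cons R m))).
Qed.

HB.instance Definition _ := isMeasure.Build _ _ _ rowvec_measureS
  rowvec_measureS0 rowvec_measureS_ge0 rowvec_measureS_sigma_additive.

Let rowvec_measureS_sigma_finite : sigma_finite setT rowvec_measureS.
Proof.
have [F TF mF] := sigma_finite_product (@lebesgue_measure R) mu.
pose tl (v : 'rV[R]_m.+1) : measurableTypeR R * 'rV[R]_m :=
  (v ord0 ord0, rsubmx (v : 'rV[R]_(1 + m))).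
have mtl : measurable_fun setT tl.
  apply/measurable_fun_pairP; split; first exact: measurable_rowvec_coord.
  apply: measurable_fun_rowvec => i.
  rewrite (_ : (fun _ => _) = rowvec_coord (rshift 1 i)).
    exact: measurable_rowvec_coord.
  by apply/funext => v; rewrite /= mxE.
have tlK x : tl (rowvec_cons x) = x.
  case: x => x v; rewrite /tl /rowvec_cons; congr (_, _); last exact: row_mxKr.
  have -> : ord0 = lshift m ord0 :> 'I_(1 + m) by apply/val_inj.
  by rewrite (row_mxEl (const_mx x : 'rV[R]_1)) mxE.
exists (fun k => tl @^-1` F k).
  by rewrite -preimage_bigcup -TF preimage_setT.
move=> k; have [mFk Fk] := mF k; split.
  by rewrite -[X in measurable X]setTI; exact: mtl.
rewrite /rowvec_measureS /pushforward.
rewrite (_ : _ @^-1` _ = F k)//.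
by apply/seteqP; split => x /=; rewrite tlK.
Qed.

HB.instance Definition _ := Measure_isSigmaFinite.Build _ _ _ rowvec_measureS
  rowvec_measureS_sigma_finite.

End rowvec_measure_step.

Fixpoint rowvec_lebesgue {R : realType} (m : nat) :
    {sigma_finite_measure set 'rV[R]_m -> \bar R} :=
  if m is k.+1 then rowvec_measureS (rowvec_lebesgue k)
  else @dirac _ 'rV[R]_0 0 R.

(* [measurableTypeR R] is [R] with its Borel sigma-algebra. *)
Definition heisenberg (R : realType) (n : nat) : Type :=
  ('rV[R]_(n + n) * measurableTypeR R)%type.

Definition heis_measure {R : realType} {n : nat} :
    set (heisenberg R n) -> \bar R :=
  (rowvec_lebesgue (n + n) \x lebesgue_measure)%E.

HB.instance Definition _ (R : realType) (n : nat) :=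
  Measure.on (@heis_measure R n).

HB.instance Definition _ (R : realType) (n : nat) :=
  Measure_isSigmaFinite.Build _ _ _ (@heis_measure R n)
    (sigma_finite_product (rowvec_lebesgue (n + n)) lebesgue_measure).

Section heisenberg_geometry.
Context {R : realType} {n : nat}.
Implicit Types x y : heisenberg R n.

Definition heis_mul x y : heisenberg R n :=
  (x.1 + y.1,
   (x.2 : R) + (y.2 : R) +
   2 * \sum_(j < n) (y.1 ord0 (lshift n j) * x.1 ord0 (rshift n j) -
                     x.1 ord0 (lshift n j) * y.1 ord0 (rshift n j))).

Definition heis_inv x : heisenberg R n := (- x.1, - (x.2 : R)).

Definition heis_dil (r : R) x : heisenberg R n := (r *: x.1, r ^+ 2 * (x.2 : R)).

Definition heis_norm x : R :=
  ((\sum_(i < n + n) x.1 ord0 i ^+ 2) ^+ 2 + (x.2 : R) ^+ 2) `^ 4^-1.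

Definition heis_dist x y : R := heis_norm (heis_mul (heis_inv y) x).

Definition heis_ball x (r : R) : set (heisenberg R n) :=
  [set y | heis_dist x y < r].

Definition heis_cball0 (r : R) : set (heisenberg R n) :=
  [set x | heis_norm x <= r].

Definition heis_sphere : set (heisenberg R n) := [set x | heis_norm x = 1].

(* the homogeneous dimension Q *)
Definition heis_Q : nat := (2 * n + 2)%N.

(* The measure dy' on the unit sphere, as a measure on the whole group which is
   carried by the sphere; the polar decomposition determines it. *)
Definition is_sphere_measure
    (sigma : {measure set (heisenberg R n) -> \bar R}) : Prop :=
  sigma (~` heis_sphere) = 0%E /\
  forall f : heisenberg R n -> \bar R, measurable_fun [set: heisenberg R n] f ->
    (forall x, 0 <= f x)%E ->
    (\int[heis_measure]_x f x =
     \int[lebesgue_measure]_(r in `]0%R, +oo[)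
       \int[sigma]_(y in heis_sphere) (f (heis_dil r y) * (r ^+ heis_Q.-1)%:E))%E.

End heisenberg_geometry.
Arguments heis_Q : clear implicits.

(* Measurability with respect to the completion of [mu]; the sigma-algebras of
   the library are Borel, so this is Lebesgue measurability when [mu] is
   [heis_measure]. The integral [\int[mu]_x f x] of the library is defined for
   all [f], as a difference of suprema over simple functions, and for such [f]
   it is the integral with respect to the completed measure. *)
Definition completed_measurable_fun d (T : measurableType d) (R : realType)
    (mu : {measure set T -> \bar R}) (f : T -> R) : Prop :=
  forall Y : set R, measurable Y -> completed_algebra_gen mu (f @^-1` Y).

Definition cmeasurable_fun d (T : measurableType d) (R : realType)
    (mu : {measure set T -> \bar R}) (f : T -> R[i]) : Prop :=
  completed_measurable_fun mu (fun x => complex.Re (f x)) /\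
  completed_measurable_fun mu (fun x => complex.Im (f x)).

(* Meaningful only when [f] is absolutely integrable on [D]. *)
Definition cintegral d (T : measurableType d) (R : realType)
    (mu : {measure set T -> \bar R}) (D : set T) (f : T -> R[i]) : R[i] :=
  Complex (\int[mu]_(x in D) complex.Re (f x)) (\int[mu]_(x in D) complex.Im (f x)).

Section weights.
Context {R : realType} {n : nat}.
Local Notation H := (heisenberg R n).
Local Notation mu := (@heis_measure R n).
Local Open Scope ereal_scope.
Implicit Types (w : H -> R) (B K : set H) (p r : R).

Definition is_weight w : Prop :=
  completed_measurable_fun mu w /\ (forall x, 0 <= w x)%R.

Definition wmeasure w K : \bar R := \int[mu]_(x in K) (w x)%:E.

Definition average B (g : H -> \bar R) : \bar R := (\int[mu]_(x in B) g x) / mu B.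

(* The essential infimum over [B] only: [+oo] is the neutral value outside. *)
Definition ess_inf_on B (g : H -> \bar R) : \bar R :=
  ess_inf mu (patch (fun=> +oo) B g).

(* The inverse [((w x)%:E)^-1] is that of the extended reals: it is [+oo] where
   [w] vanishes. *)
Definition muckenhoupt p w : Prop :=
  exists C : R, forall (x : H) (r : R), (0 < r)%R ->
    let B := heis_ball x r in
    if p == 1%R
    then average B (EFin \o w) <= C%:E * ess_inf_on B (EFin \o w)
    else average B (EFin \o w) *
         average B (fun y => ((w y)%:E)^-1 `^ (p - 1)^-1) `^ (p - 1) <= C%:E.

Definition reverse_hoelder r w : Prop :=
  exists C : R, forall (x : H) (s : R), (0 < s)%R ->
    let B := heis_ball x s in
    average B (fun y => (w y `^ r)%:E) `^ r^-1 <= C%:E * average B (EFin \o w).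

Definition critical_index w : \bar R :=
  ereal_sup [set r%:E | r in [set r : R | (1 < r)%R /\ reverse_hoelder r w]].

End weights.

Section spaces.
Context {R : realType} {n : nat}.
Local Notation H := (heisenberg R n).
Local Notation mu := (@heis_measure R n).
Local Open Scope ereal_scope.
Implicit Types (w : H -> R) (X : set H) (f : H -> R[i]) (q lam r : R).

Definition Lloc q w X f : Prop :=
  cmeasurable_fun mu f /\
  forall K, compact K -> K `<=` X ->
    \int[mu]_(x in K) (Normc.normc (f x) `^ q * w x)%:E < +oo.

Definition loc_integrable f : Prop := Lloc 1 (fun=> 1%R) setT f.

Definition morrey_norm q lam w f : \bar R :=
  ereal_sup
    [set ((\int[mu]_(x in heis_cball0 r) (Normc.normc (f x) `^ q * w x)%:E) /
          wmeasure w (heis_cball0 r) `^ (1 + lam * q)) `^ q^-1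
    | r in [set r : R | (0 < r)%R]].

Definition morrey q lam w f : Prop :=
  Lloc q w (~` [set (0, 0)%R : H]) f /\ morrey_norm q lam w f < +oo.

(* f_{B_r} *)
Definition cball0_mean f r : R[i] :=
  (((fine (mu (heis_cball0 r)))^-1)%:C%C * cintegral mu (heis_cball0 r) f)%R.

Definition cmo_norm q w f : \bar R :=
  ereal_sup
    [set ((\int[mu]_(x in heis_cball0 r)
             (Normc.normc (f x - cball0_mean f r)%R `^ q * w x)%:E) /
          wmeasure w (heis_cball0 r)) `^ q^-1
    | r in [set r : R | (0 < r)%R]].

Definition cmo q w f : Prop := Lloc q w setT f /\ cmo_norm q w f < +oo.

End spaces.

Section commutator.
Context {R : realType} {n : nat}.
Local Notation H := (heisenberg R n).
Variables (sigma : {measure set H -> \bar R}) (Phi : H -> R) (Omega b : H -> R[i]).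

Definition is_radial : Prop :=
  forall x y : H, heis_norm x = heis_norm y -> Phi x = Phi y.

(* Phi(t), for Phi radial and t > 0: the point (0, t^2) has norm t. *)
Definition radial_value (t : R) : R := Phi ((0, t ^+ 2) : H).

Definition hausdorff_integrand (f : H -> R[i]) (x : H) (t : R) (y : H) : R[i] :=
  let z := heis_dil (t^-1 * heis_norm x) y in
  (radial_value t / t)%:C%C * Omega y * (b x - b z) * f z.

Definition hausdorff_commutator (f : H -> R[i]) (x : H) : R[i] :=
  cintegral lebesgue_measure `]0, +oo[
    (fun t => cintegral sigma heis_sphere (hausdorff_integrand f x t)).

Definition hausdorff_converges (f : H -> R[i]) (x : H) : Prop :=
  (\int[lebesgue_measure]_(t in `]0%R, +oo[)
     \int[sigma]_(y in heis_sphere) (Normc.normc (hausdorff_integrand f x t y))%:E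
   < +oo)%E.

Definition hausdorff_bounded (X : (H -> R[i]) -> Prop)
    (normX : (H -> R[i]) -> \bar R) (Y : (H -> R[i]) -> Prop)
    (normY : (H -> R[i]) -> \bar R) : Prop :=
  exists C : R, forall f, X f ->
    [/\ \forall x \ae heis_measure, hausdorff_converges f x,
        Y (hausdorff_commutator f) &
        (normY (hausdorff_commutator f) <= C%:E * normX f)%E].

Definition Psi (t : R) : R :=
  t ^- heis_Q n * \1_(`]0, 1]%classic) t + t ^+ heis_Q n * \1_(`]1, +oo[%classic) t.

Definition C9 (zeta lam delta : R) : \bar R :=
  (\int[lebesgue_measure]_(t in `]0%R, 1%R])
     (radial_value t / t `^ (1 + (heis_Q n)%:R * lam * (delta - 1) / delta)
      * (2 + Psi t))%:E +
   \int[lebesgue_measure]_(t in `]1%R, +oo[)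
     (radial_value t / t `^ (1 + (heis_Q n)%:R * zeta * lam)
      * (2 + Psi t))%:E)%E.

End commutator.

(* Main.v *)
From HB Require Import structures.
Require Import Defs.
From mathcomp Require Import all_boot all_order all_algebra.
From mathcomp Require Import all_classical all_reals all_analysis.
From mathcomp Require Import measurable_realfun ess_sup_inf complex.
From mathcomp Require Import ring lra.
Set Implicit Arguments.
Unset Strict Implicit.
Unset Printing Implicit Defensive.
Import Order.TTheory GRing.Theory Num.Theory.
Import numFieldNormedType.Exports.
Local Open Scope classical_set_scope.
Local Open Scope ring_scope.

(** The commutator integrates, over [t > 0] and over the unit sphere, values at
    the dilated points [z = heis_dil (t^-1 * |x|) y]. For a fixed [t], when [x]
    runs over the ball [B r] and [y] over the sphere, [z] runs over
    [B (t^-1 * r)], and polar coordinates turn the integral over [x] and [y] of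
    a function of [z] into its integral over that ball, up to the mass of the
    sphere and the ratio of the volumes ([dilation_average_cball]). A fixed [t]
    is therefore governed by means over balls centred at the origin.

    Three facts on weights enter. The Muckenhoupt condition bounds unweighted
    means of order [p / zeta] by weighted means of order [p]
    ([muckenhoupt_powR_le]). The reverse Hölder inequality, valid for every
    exponent below the critical index, controls the powers of the weight
    ([reverse_hoelder_le]). Together they show that the mass of a ball decays
    and grows at definite rates when the ball is dilated, so that
    [W (t^-1 * r) ^ lam] is bounded by [growth_factor t * W r ^ lam]
    ([weight_mass_powR_dilation]). On the side of the symbol, [b x - b z] is
    split at the means of [b] over [B r] and [B (t^-1 * r)]: both oscillations
    are bounded by the CMO norm, and the means differ by at most a multiple of
    [Psi t] ([difference_dilation_le]).

    Hölder's inequality with exponents for [b x - b z], for [f z] and for the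
    weight combines these facts; the condition relating [q], [q1], [r1] and
    [zeta] says exactly that the exponent left to the weight is below the
    critical index ([mixed_hoelder]). The outcome is that the integrand at [t]
    has [L^q] size at most [dilation_gain t = growth_factor t * (2 + Psi t)]
    relative to the Morrey norm of [f] ([commutator_slice_le]).

    It remains to integrate over [t]. By hypothesis [phi t / t * dilation_gain t]
    has the finite integral [C9]. Hölder's inequality with respect to this
    density and to the [L^q'] function [Omega] bounds the [q]-th power of the
    commutator, pointwise, by the integral of [phi t / t * dilation_gain t ^ (1 - q)]
    times the [q]-th power of the integrand ([majorant_le]). Integrating in [x]
    first, the estimate at fixed [t] contributes [dilation_gain t ^ q], and the
    product is again the density of mass [C9] ([jensen_integral_le]). This gives
    the norm inequality and the absolute convergence almost everywhere.

    The data are only Lebesgue measurable, while Tonelli's theorem is applied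
    to Borel functions. They are replaced by Borel representatives, which is
    harmless because for almost every [x] the dilations send almost every
    [(t, y)] outside a given null set ([dilate_ae]); a radial function has a
    Borel representative that depends on the radius alone
    ([radial_borel_version]). *)

(** * Integration of arbitrary functions and Hölder bounds *)

Section arbitrary_integrands.
Context d (T : measurableType d) (R : realType).
Variable mu : {measure set T -> \bar R}.
Local Open Scope ereal_scope.
Implicit Types (f g : T -> \bar R) (D : set T).

Import HBNNSimple.

(** A simple function below [f], cut off on the exceptional null set, lies below
    [g] and keeps its integral. The integrands are arbitrary functions: this is
    what permits replacing Lebesgue measurable data by Borel representatives
    under the integral sign. *)
Lemma ge0_le_integral_ae f g :
  (forall x, 0 <= f x) -> (forall x, 0 <= g x) ->
  (\forall x \ae mu, f x <= g x) ->
  \int[mu]_x f x <= \int[mu]_x g x.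
Proof.
move=> f0 g0 [N [mN N0 fgN]].
rewrite !ge0_integralTE//; apply: ge_ereal_sup => _ [h hf <-].
have mCN : measurable (~` N) by exact: measurableC.
rewrite -integralT_nnsfun.
have -> : \int[mu]_x (h x)%:E = \int[mu]_x (proj_nnsfun h mCN x)%:E.
  apply: ge0_ae_eq_integral => //.
  - exact/measurable_EFinP.
  - exact/measurable_EFinP.
  - by move=> x _; rewrite lee_fin.
  - by move=> x _; rewrite lee_fin.
  - exists N; split => // x /= /not_implyP[_ hx]; apply: contrapT => Nx.
    by apply: hx => /=; rewrite mindicE mem_set// mulr1.
rewrite integralT_nnsfun; apply: ereal_sup_ubound => /=; exists (proj_nnsfun h mCN) => // x.
rewrite /= mindicE; case: (boolP (x \in ~` N)) => [|_]; last by rewrite mulr0.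
rewrite inE mulr1 => Nx; apply: (le_trans (hf x)).
by apply: contrapT => fgx; apply: Nx; exact: fgN.
Qed.

Lemma le_integral_ae f g D :
  (forall x, D x -> 0 <= f x) -> (forall x, D x -> 0 <= g x) ->
  (\forall x \ae mu, D x -> f x <= g x) ->
  \int[mu]_(x in D) f x <= \int[mu]_(x in D) g x.
Proof.
move=> f0 g0 fg; rewrite integral_mkcond [leRHS]integral_mkcond.
apply: ge0_le_integral_ae => [x|x|]; rewrite ?erestrict_ge0//.
by apply: filterS fg => x; rewrite /patch; case: ifP => //; rewrite inE => Dx; apply.
Qed.

Lemma eq_integral_ae f g D :
  (\forall x \ae mu, D x -> f x = g x) ->
  \int[mu]_(x in D) f x = \int[mu]_(x in D) g x.
Proof.
move=> fg; rewrite integralE [RHS]integralE; congr (_ - _); apply/eqP;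
  rewrite eq_le; apply/andP; split; apply: le_integral_ae => //;
  by apply: filterS fg => x /[apply]; rewrite ?funeposE ?funenegE => ->.
Qed.

End arbitrary_integrands.

Section completed_functions.
Context d (T : measurableType d) (R : realType).
Variable mu : {measure set T -> \bar R}.
Implicit Types (f g : T -> R) (N : set T).

(** The preimages of the rational half-lines are Borel up to null sets; as there
    are countably many of them, a single null set may be discarded for all. *)
Lemma completed_measurableP f : completed_measurable_fun mu f ->
  exists N, [/\ measurable N, mu N = 0%E & measurable_fun setT (patch (fun=> 0) (~` N) f)].
Proof.
move=> mf.
pose e n : rat := odflt 0 (unpickle n).
have cut n : exists AN : set T * set T,
    [/\ measurable AN.1, measurable AN.2, mu AN.2 = 0%E &
      f @^-1` `]-oo, ratr (e n)[ `\` AN.2 = AN.1 `\` AN.2].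
  have [A mA [N' [N [mN N0 N'N]] AN]] :=
    mf `]-oo, ratr (e n)[%classic (measurable_itv _).
  exists (A, N); split => //=; rewrite -AN setDUl.
  by rewrite (_ : N' `\` N = set0) ?setU0//; apply/seteqP; split => x //= [/N'N].
have [AN HAN] := choice cut.
pose N := \bigcup_n (AN n).2.
have mN : measurable N by apply: bigcupT_measurable => n; have [] := HAN n.
have N0 : mu N = 0%E.
  apply: measure_negligible => //; apply: negligible_bigcup => n.
  by have [_ ? ? _] := HAN n; exists (AN n).2; split.
exists N; split => //.
have cutN (n : nat) : measurable (f @^-1` `]-oo, ratr (e n)[ `\` N).
  have [mA mAN _ AE] := HAN n.
  have -> : f @^-1` `]-oo, ratr (e n)[ `\` N = (AN n).1 `\` N.
    have NN : (AN n).2 `<=` N by move=> x ?; exists n.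
    apply/seteqP; split => x [fx Nx]; split => //.
      have : ((AN n).1 `\` (AN n).2) x by rewrite -AE; split => // /NN.
      by case.
    have : (f @^-1` `]-oo, ratr (e n)[ `\` (AN n).2) x by rewrite AE; split => // /NN.
    by case.
  exact: measurableD.
apply: (measurability _ (RGenInftyO.measurableE R)) => //.
move=> _ [_ [x ->] <-]; rewrite setTI.
have -> : (patch (fun=> 0) (~` N) f) @^-1` `]-oo, x[ =
    \bigcup_(n in [set n | ratr (e n) <= x]) (f @^-1` `]-oo, ratr (e n)[ `\` N) `|`
    (if 0 < x then N else set0).
  apply/seteqP; split => t /=; rewrite /patch ?in_itv/=.
    case: ifPn => [/[!inE] Nt ftx|/negP/[!inE]/contrapT Nt ->]; last by right.
    left; have [r /[!in_itv]/= /andP[ftr rx]] := rat_in_itvoo ftx.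
    by exists (pickle r); rewrite /= /e pickleK/= ?(ltW rx)//.
  move=> [[n /= nx [ft Nt]]|]; rewrite ?in_itv/=.
    by move: ft; rewrite in_itv/= mem_set// => /lt_le_trans; apply.
  by case: ifPn => // x0 Nt; rewrite memNset//; apply.
apply: measurableU; last by case: ifP.
by apply: bigcup_measurable => n _; exact: cutN.
Qed.

Lemma completed_measurable_fun_ae f g : measurable_fun setT g ->
  (\forall x \ae mu, f x = g x) -> completed_measurable_fun mu f.
Proof.
move=> mg [N [mN N0 fgN]] Y mY.
exists (g @^-1` Y `\` N).
  apply: measurableD => //; rewrite -[X in measurable X]setTI; exact: mg.
exists (f @^-1` Y `&` N).
  by exists N; split => // x [].
apply/seteqP; split => x /=.
  move=> [[gY Nx]|[]//].
  have fg : f x = g x by apply: contrapT => fg; apply: Nx; exact: fgN.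
  by rewrite fg.
move=> fY; have [Nx|Nx] := pselect (N x); [by right|left; split => //].
have fg : f x = g x by apply: contrapT => fg; apply: Nx; exact: fgN.
by rewrite -fg.
Qed.

End completed_functions.

Section hoelder_bounds.
Context d (T : measurableType d) (R : realType).
Variable mu : {measure set T -> \bar R}.
Implicit Types (F G K : T -> R) (A B C : R) (D : set T).

Lemma measurable_powR_fun D F p : measurable_fun D F ->
  measurable_fun D (fun x => F x `^ p).
Proof. exact: (@measurableT_comp _ _ _ _ _ _ (@powR R ^~ p)). Qed.

(** The exponents [th] and [eta] are the reciprocals of the conjugate exponents
    of [hoelder]. *)
Let hoelder_gt0 F G th eta A B :
  measurable_fun setT F -> measurable_fun setT G ->
  (forall x, 0 <= F x) -> (forall x, 0 <= G x) ->
  0 < th -> 0 < eta -> th + eta = 1 ->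
  (\int[mu]_x (F x)%:E <= A%:E)%E -> (\int[mu]_x (G x)%:E <= B%:E)%E ->
  (\int[mu]_x (F x `^ th * G x `^ eta)%:E <= (A `^ th * B `^ eta)%:E)%E.
Proof.
move=> mF mG F0 G0 th0 eta0 the FA GB.
have mf := measurable_powR_fun th mF; have mg := measurable_powR_fun eta mG.
have pq : (th^-1)^-1 + (eta^-1)^-1 = 1 by rewrite !invrK.
have := hoelder mu mf mg _ _ pq; rewrite !invr_gt0 => /(_ th0 eta0).
rewrite Lnorm1 => hfg.
have {hfg}hfg := le_trans (le_integral_ae (D := setT) _ _ _) hfg.
have LE (H : T -> R) k C : (forall x, 0 <= H x) -> 0 < k ->
    (\int[mu]_x (H x)%:E <= C%:E)%E ->
    (Lnorm mu (k^-1)%:E (EFin \o (fun x => H x `^ k)%R) <= (C `^ k)%:E)%E.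
  move=> H0 k0 HC; rewrite unlock invrK -[leRHS]poweR_EFin; apply: gt0_ler_poweR.
  - exact: ltW.
  - rewrite in_itv/= leey andbT; apply: integral_ge0 => x _. by rewrite lee_fin powR_ge0.
  - rewrite in_itv/= leey andbT; apply: le_trans HC.
    by apply: integral_ge0 => x _; rewrite lee_fin.
  apply: le_trans HC; rewrite le_eqVlt; apply/orP; left; apply/eqP.
  apply: eq_integral => x _ /=; rewrite ger0_norm ?powR_ge0// -powRrM mulfV ?gt_eqF//.
  by rewrite powRr1.
rewrite EFinM; apply: (le_trans (hfg _ _ _ _)) => //.
- by move=> x _; rewrite lee_fin mulr_ge0// powR_ge0.
- by apply/aeW => x _ /=; rewrite lee_fin ler_norm.
- by apply: lee_pmul; [exact: Lnorm_ge0|exact: Lnorm_ge0|exact: LE|exact: LE].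
Qed.

(** [A] and [B] are upper bounds rather than integrals, so that the inequality
    composes with earlier estimates, and the exponents may vanish, so that the
    limiting case [r1 = zeta] of the theorem is covered. *)
Lemma hoelder_le F G th eta A B D : measurable D ->
  measurable_fun setT F -> measurable_fun setT G ->
  (forall x, 0 <= F x) -> (forall x, 0 <= G x) ->
  0 <= th -> 0 <= eta -> th + eta = 1 ->
  (\int[mu]_(x in D) (F x)%:E <= A%:E)%E ->
  (\int[mu]_(x in D) (G x)%:E <= B%:E)%E ->
  (\int[mu]_(x in D) (F x `^ th * G x `^ eta)%:E <= (A `^ th * B `^ eta)%:E)%E.
Proof.
move=> mD mF mG F0 G0 th0 eta0 the FA GB.
have A0 : 0 <= A.
  by rewrite -lee_fin; apply: le_trans FA; apply: integral_ge0 => x _; rewrite lee_fin.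
have B0 : 0 <= B.
  by rewrite -lee_fin; apply: le_trans GB; apply: integral_ge0 => x _; rewrite lee_fin.
have [t0|tn0] := eqVneq th 0.
  have e1 : eta = 1 by rewrite -the t0 add0r.
  rewrite t0 e1; under eq_integral do rewrite powRr0 mul1r (powRr1 (G0 _)).
  by rewrite powRr0 mul1r powRr1.
have [e0|en0] := eqVneq eta 0.
  have t1 : th = 1 by rewrite -the e0 addr0.
  rewrite e0 t1; under eq_integral do rewrite powRr0 mulr1 (powRr1 (F0 _)).
  by rewrite powRr0 mulr1 powRr1.
have tp : 0 < th by rewrite lt_neqAle eq_sym tn0.
have ep : 0 < eta by rewrite lt_neqAle eq_sym en0.
pose F' x := F x * \1_D x; pose G' x := G x * \1_D x.
have ind (x : T) : \1_D x = 0 :> R \/ \1_D x = 1 :> R.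
  by rewrite indicE; case: (x \in D); [right|left].
have intD (H : T -> R) : (\int[mu]_(x in D) (H x)%:E = \int[mu]_x (H x * \1_D x)%:E)%E.
  rewrite integral_mkcond; apply: eq_integral => x _; rewrite patchE indicE.
  by case: ifP => _; rewrite ?mulr1 ?mulr0.
have mI : measurable_fun setT (\1_D : T -> R) by exact: measurable_indic.
have := @hoelder_gt0 F' G' th eta A B _ _ _ _ tp ep the.
rewrite /F' /G' -!intD => H.
rewrite intD; under eq_integral => x _.
  have -> : F x `^ th * G x `^ eta * \1_D x = F' x `^ th * G' x `^ eta.
    rewrite /F' /G'; case: (ind x) => ->; rewrite ?mulr1// !mulr0 powR0 ?gt_eqF//.
    by rewrite mul0r.
  over.
by apply: H => //; [exact: measurable_funM|exact: measurable_funM|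
  move=> x; rewrite mulr_ge0//; case: (ind x) => ->..].
Qed.

(** The two last factors form a weighted geometric mean, whose integral is
    bounded by the inequality for two factors. *)
Lemma hoelder3_le F G K th eta ka A B C D : measurable D ->
  measurable_fun setT F -> measurable_fun setT G -> measurable_fun setT K ->
  (forall x, 0 <= F x) -> (forall x, 0 <= G x) -> (forall x, 0 <= K x) ->
  0 <= th -> 0 < eta -> 0 <= ka -> th + eta + ka = 1 ->
  (\int[mu]_(x in D) (F x)%:E <= A%:E)%E ->
  (\int[mu]_(x in D) (G x)%:E <= B%:E)%E ->
  (\int[mu]_(x in D) (K x)%:E <= C%:E)%E ->
  (\int[mu]_(x in D) (F x `^ th * G x `^ eta * K x `^ ka)%:E <=
    (A `^ th * B `^ eta * C `^ ka)%:E)%E.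
Proof.
move=> mD mF mG mK F0 G0 K0 th0 eta0 ka0 sum1 FA GB KC.
have ek : 0 < eta + ka by rewrite ltr_wpDr.
have GK : (\int[mu]_(x in D) (G x `^ (eta / (eta + ka)) * K x `^ (ka / (eta + ka)))%:E
    <= (B `^ (eta / (eta + ka)) * C `^ (ka / (eta + ka)))%:E)%E.
  apply: hoelder_le => //.
  - by rewrite divr_ge0 ?ltW.
  - by rewrite divr_ge0 // ltW.
  - by rewrite -mulrDl mulfV ?gt_eqF.
have := @hoelder_le F (fun x => G x `^ (eta / (eta + ka)) * K x `^ (ka / (eta + ka)))
  th (eta + ka) A _ D mD mF _ F0 _ th0 (ltW ek) _ FA GK.
have powE x y : 0 <= x -> 0 <= y ->
    (x `^ (eta / (eta + ka)) * y `^ (ka / (eta + ka))) `^ (eta + ka) =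
    x `^ eta * y `^ ka.
  by move=> x0 y0; rewrite powRM ?powR_ge0// -!powRrM !divfK ?gt_eqF.
under eq_integral do rewrite (powE _ _ (G0 _) (K0 _)) mulrA.
rewrite powE ?mulrA; first apply.
- by apply: measurable_funM; exact: measurable_powR_fun.
- by move=> x; rewrite mulr_ge0 ?powR_ge0.
- by rewrite addrA.
- by rewrite -lee_fin; apply: le_trans GB; apply: integral_ge0 => x _; rewrite lee_fin.
- by rewrite -lee_fin; apply: le_trans KC; apply: integral_ge0 => x _; rewrite lee_fin.
Qed.

End hoelder_bounds.

(** * Polar coordinates on the Heisenberg group *)

(** By uniqueness, Lebesgue measure is [c] times its image under multiplication
    by [c]. *)
Lemma ge0_integral_scale (R : realType) (c : R) (h : R -> \bar R) : 0 < c ->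
  measurable_fun [set: R] h -> (forall r, 0 <= h r)%E ->
  (\int[lebesgue_measure]_(r in `]0%R, +oo[) h (c * r)%R =
   c^-1%:E * \int[lebesgue_measure]_(r in `]0%R, +oo[) h r)%E.
Proof.
move=> c0 mh h0.
have c10 : 0 <= c^-1 by rewrite invr_ge0 ltW.
have mc : measurable_fun [set: measurableTypeR R] ( *%R c : _ -> measurableTypeR R).
  exact: measurable_funM.
pose nu : {measure set (measurableTypeR R) -> \bar R} :=
  measure_function_pushforward__canonical__measure_function_Measure lebesgue_measure mc.
have scaleE A : measurable A -> (lebesgue_measure A = c%:E * nu A)%E.
  pose cnu : {measure set (measurableTypeR R) -> \bar R} := mscale (NngNum (ltW c0)) nu.
  apply: (@lebesgue_measure_unique _ cnu) => _ [[a b]] _ <-.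
  transitivity (c%:E * lebesgue_measure (`](a / c)%R, (b / c)%R]%classic : set R))%E; last first.
    congr (_ * lebesgue_measure _)%E.
    by apply/seteqP; split => x /=; rewrite /= !in_itv/= ltr_pdivrMr// ler_pdivlMr// (mulrC c).
  rewrite !lebesgue_measure_itv/= !lte_fin ltr_pM2r ?invr_gt0//.
  case: ifPn => _; last by rewrite mule0.
  by rewrite -!EFinB -EFinM -mulrBl mulrC divfK// gt_eqF.
pose leb' : {measure set (measurableTypeR R) -> \bar R} :=
  mscale (NngNum c10) (@lebesgue_measure R).
have -> : (\int[lebesgue_measure]_(r in `]0%R, +oo[) h (c * r)%R =
    \int[nu]_(r in `]0%R, +oo[) h r)%E.
  rewrite ge0_integral_pushforward//; last exact: measurable_funTS.
  congr integral; apply/seteqP; split => x /=; rewrite !in_itv/= !andbT pmulr_rgt0//.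
have -> : (\int[nu]_(r in `]0%R, +oo[) h r =
    \int[leb']_(r in `]0%R, +oo[) h r)%E.
  apply: eq_measure_integral => A mA _.
  transitivity (c^-1%:E * lebesgue_measure A)%E => //.
  by rewrite (scaleE A mA) muleA -EFinM mulVf ?gt_eqF// mul1e.
rewrite ge0_integral_mscale//; exact: measurable_funTS.
Qed.

Section heis_basics.
Context {R : realType} {n : nat}.
Local Notation H := (heisenberg R n).
Implicit Types (x y : H) (r : R).

(** The fourth power of the norm, which is polynomial in the coordinates. *)
Definition heis_gauge4 x : R := (\sum_(i < n + n) x.1 ord0 i ^+ 2) ^+ 2 + (x.2 : R) ^+ 2.

Lemma heis_gauge4_ge0 x : 0 <= heis_gauge4 x.
Proof. by rewrite addr_ge0 ?sqr_ge0. Qed.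

Lemma heis_normE x : heis_norm x = heis_gauge4 x `^ 4^-1. Proof. by []. Qed.

Lemma heis_norm_ge0 x : 0 <= heis_norm x. Proof. exact: powR_ge0. Qed.

Lemma heis_norm4 x : heis_norm x ^+ 4 = heis_gauge4 x.
Proof.
by rewrite -powR_mulrn ?heis_norm_ge0// heis_normE -powRrM mulVf// powRr1// heis_gauge4_ge0.
Qed.

Lemma heis_norm_le x r : 0 <= r -> (heis_norm x <= r) = (heis_gauge4 x <= r ^+ 4).
Proof. by move=> r0; rewrite -heis_norm4 ler_pXn2r// nnegrE heis_norm_ge0. Qed.

Lemma heis_norm_dil r x : 0 <= r -> heis_norm (heis_dil r x) = r * heis_norm x.
Proof.
move=> r0; apply/eqP; rewrite -(@eqrXn2 _ 4%N) ?mulr_ge0 ?heis_norm_ge0//.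
rewrite exprMn !heis_norm4 /heis_gauge4 /=.
under eq_bigr do rewrite mxE exprMn.
rewrite -mulr_sumr; apply/eqP; ring.
Qed.

Lemma heis_dist0 x : heis_dist (0, 0 : R) x = heis_norm x.
Proof.
rewrite /heis_dist !heis_normE; congr (_ `^ _); rewrite /heis_gauge4 /=.
rewrite [X in 2 * X]big1; last by move=> j _; rewrite !mxE !mul0r mulr0 subr0.
rewrite mulr0 !addr0 sqrrN; congr (_ ^+ 2 + _).
by apply: eq_bigr => i _; rewrite !mxE sqrrN.
Qed.

Lemma measurable_heis_coord (i : 'I_(n + n)) : measurable_fun [set: H] (fun x => x.1 ord0 i).
Proof. exact: (measurableT_comp (measurable_rowvec_coord i) measurable_fst). Qed.

Lemma measurable_gauge4 : measurable_fun [set: H] heis_gauge4.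
Proof.
apply: measurable_funD; apply: measurable_funX.
  by apply: measurable_sum => i; apply: measurable_funX; exact: measurable_heis_coord.
exact: measurable_snd.
Qed.

Lemma measurable_heis_norm : measurable_fun [set: H] (@heis_norm R n).
Proof. exact: measurable_powR_fun measurable_gauge4. Qed.

Lemma measurable_heis_dil :
  measurable_fun [set: measurableTypeR R * H] (fun z => heis_dil z.1 z.2 : H).
Proof.
apply/measurable_fun_pairP; split => /=.
  apply: measurable_fun_rowvec => i.
  rewrite (_ : (fun _ => _) = fun z : measurableTypeR R * H => z.1 * (z.2.1 ord0 i)).
    apply: measurable_funM; first exact: measurable_fst.
    exact: (measurableT_comp (measurable_heis_coord i) (@measurable_snd _ _ (measurableTypeR R) H)).
  by apply/funext => z /=; rewrite mxE.
apply: measurable_funM.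
  by apply: measurable_funX; exact: measurable_fst.
exact: (measurableT_comp (@measurable_snd _ _ 'rV[R]_(n + n) (measurableTypeR R)) (@measurable_snd _ _ (measurableTypeR R) H)).
Qed.

End heis_basics.

Lemma lebesgue_itv11 (R : realType) :
  (lebesgue_measure (`[(-1)%R, 1%R]%classic : set R) < +oo)%E.
Proof. by rewrite lebesgue_measure_itv/=; case: ifP; rewrite // -EFinB ltry. Qed.

Lemma lebesgue_itv01 (R : realType) :
  lebesgue_measure (`]0%R, 1%R]%classic : set R) = 1%E.
Proof. by rewrite lebesgue_measure_itv/= lte_fin ltr01 -EFinB subr0. Qed.

Lemma lebesgue_setT_gt0 (R : realType) :
  (0 < lebesgue_measure ([set: R] : set R))%E.
Proof. by rewrite -set_itvNyy lebesgue_measure_itv/= addye// ltey. Qed.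

(** A box that contains the unit ball of [heis_norm] in its horizontal
    coordinates and whose measure is computed as a product. *)
Definition unit_box (R : realType) m : set 'rV[R]_m := [set v | forall i, `|v ord0 i| <= 1].

Lemma measurable_unit_box (R : realType) m : measurable (@unit_box R m).
Proof.
rewrite (_ : @unit_box R m =
    \bigcap_(i in [set: 'I_m]) ((@rowvec_coord R m i) @^-1` `[(-1), 1]%classic)).
  apply: fin_bigcap_measurable => // i _; rewrite -[X in measurable X]setTI.
  exact: measurable_rowvec_coord.
apply/seteqP; split => v /= h i; first by move=> _; rewrite /= in_itv/= -ler_norml; exact: h.
by have := h i I; rewrite /= in_itv/= -ler_norml.
Qed.

Lemma rowvec_lebesgue_unit_box (R : realType) m :
  (rowvec_lebesgue m (@unit_box R m) < +oo)%E.
Proof.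
elim: m => [|m IH] /=.
  by rewrite (le_lt_trans (probability_le1 _ _))// ?ltry//; exact: measurable_unit_box.
rewrite /rowvec_measureS /pushforward.
rewrite (_ : _ @^-1` _ = (`[(-1), 1]%classic : set R) `*` @unit_box R m); last first.
  rewrite /unit_box /rowvec_cons; apply/seteqP; split => -[a v] /=.
    move=> h; split => [|i].
      have := h (lshift m ord0 : 'I_(1 + m)); rewrite (row_mxEl (const_mx a : 'rV[R]_1)) mxE.
      by rewrite in_itv/= -ler_norml.
    by have := h (rshift 1 i : 'I_(1 + m)); rewrite (row_mxEr (const_mx a : 'rV[R]_1)).
  move=> [+ hv] i; rewrite in_itv/= -ler_norml => ha.
  case: (@split_ordP 1 m i) => j ->.
    by rewrite (row_mxEl (const_mx a : 'rV[R]_1)) mxE.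
  by rewrite (row_mxEr (const_mx a : 'rV[R]_1)).
rewrite product_measure1E//; last exact: measurable_unit_box.
rewrite lte_mul_pinfty// ge0_fin_numE//; exact: lebesgue_itv11.
Qed.

Lemma rowvec_lebesgue_gt0 (R : realType) m : (0 < rowvec_lebesgue m [set: 'rV[R]_m])%E.
Proof.
elim: m => [|m IH] /=; first by rewrite diracE mem_set// lte01.
rewrite /rowvec_measureS /pushforward preimage_setT -setXTT product_measure1E//.
by rewrite mule_gt0//; exact: lebesgue_setT_gt0.
Qed.

Section heis_measure_facts.
Context {R : realType} {n : nat}.
Local Notation H := (heisenberg R n).
Local Notation mu := (@heis_measure R n).
Implicit Types (x y : H) (r : R).

Lemma measurable_heis_cball0 r : measurable (@heis_cball0 R n r).
Proof.
rewrite -[X in measurable X]setTI.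
rewrite (_ : _ r = @heis_norm R n @^-1` `]-oo, r]%classic).
  by apply: measurable_heis_norm => //; exact: measurable_itv.
by apply/seteqP; split => x /=; rewrite in_itv.
Qed.

Lemma measurable_heis_sphere : measurable (@heis_sphere R n).
Proof.
rewrite -[X in measurable X]setTI.
rewrite (_ : heis_sphere = @heis_norm R n @^-1` [set 1]).
  by apply: measurable_heis_norm => //; exact: measurable_set1.
by apply/seteqP; split => x.
Qed.

Lemma heis_measure_cball1_lty : (mu (heis_cball0 1) < +oo)%E.
Proof.
have sub : @heis_cball0 R n 1 `<=` @unit_box R (n + n) `*` (`[(-1), 1]%classic : set R).
  move=> -[v a]; rewrite /heis_cball0 /= heis_norm_le// expr1n /heis_gauge4 /= => h.
  have s1 : \sum_(i < n + n) v ord0 i ^+ 2 <= 1.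
    rewrite -(@ler_pXn2r _ 2%N) ?nnegrE ?sumr_ge0 ?expr1n//; last by move=> *; exact: sqr_ge0.
    by apply: le_trans h; rewrite lerDl sqr_ge0.
  split => [i|] /=.
    rewrite -(@ler_pXn2r _ 2%N) ?nnegrE// expr1n real_normK ?num_real//.
    apply: le_trans s1; rewrite (bigD1 i)//= lerDl sumr_ge0// => *; exact: sqr_ge0.
  rewrite in_itv/= -ler_norml -(@ler_pXn2r _ 2%N) ?nnegrE// expr1n real_normK ?num_real//.
  by apply: le_trans h; rewrite lerDr sqr_ge0.
apply: (@le_lt_trans _ _ (mu (@unit_box R (n + n) `*` (`[(-1), 1]%classic : set R)))).
  apply: le_measure => //; rewrite inE; first exact: measurable_heis_cball0.
  by apply: measurableX => //; exact: measurable_unit_box.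
rewrite /heis_measure product_measure1E//; last exact: measurable_unit_box.
rewrite lte_mul_pinfty//; first by rewrite ge0_fin_numE// rowvec_lebesgue_unit_box.
exact: lebesgue_itv11.
Qed.

Lemma heis_measure_gt0 : (0 < mu [set: H])%E.
Proof.
rewrite /heis_measure -setXTT product_measure1E// mule_gt0//.
  exact: rowvec_lebesgue_gt0.
exact: lebesgue_setT_gt0.
Qed.

Variable sigma : {measure set H -> \bar R}.
Hypothesis sigma_sphere : is_sphere_measure sigma.

Lemma sphere_integralE (f : H -> \bar R) :
  (\int[sigma]_(y in heis_sphere) f y = \int[sigma]_y f y)%E.
Proof.
rewrite integral_mkcond; apply: eq_integral_ae.
exists (~` heis_sphere); split.
- by apply: measurableC; exact: measurable_heis_sphere.
- by case: sigma_sphere.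
- by move=> y /= ny Sy; apply: ny => _; rewrite patchE mem_set.
Qed.

Lemma polar_integral (f : H -> \bar R) : measurable_fun setT f -> (forall x, 0 <= f x)%E ->
  (\int[mu]_x f x = \int[lebesgue_measure]_(r in `]0%R, +oo[)
       \int[sigma]_y (f (heis_dil r y) * (r ^+ (heis_Q n).-1)%:E))%E.
Proof.
move=> mf f0; case: sigma_sphere => _ /(_ f mf f0) ->.
by apply: eq_integral => r _; rewrite sphere_integralE.
Qed.

Lemma sphere_ae_norm : \forall y \ae sigma, heis_norm y = 1.
Proof.
exists (~` heis_sphere); split => //; last by case: sigma_sphere.
by apply: measurableC; exact: measurable_heis_sphere.
Qed.

(** A null sphere would make the whole group null by the polar decomposition. *)
Lemma sphere_measure_gt0 : (0 < sigma setT)%E.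
Proof.
rewrite lt0e measure_ge0 andbT; apply/eqP => s0.
have : mu [set: H] = 0%E; last by apply/eqP; rewrite gt_eqF// heis_measure_gt0.
rewrite -[LHS]mul1e -integral_cst// polar_integral//.
under eq_integral => r _.
  rewrite (eq_integral_ae (g := cst 0%E)) ?integral0.
    over.
  by exists setT; split.
by rewrite integral0.
Qed.

(** A sphere of infinite mass would give the unit ball infinite volume by the
    polar decomposition. *)
Lemma sphere_measure_lty : (sigma setT < +oo)%E.
Proof.
rewrite ltNge leye_eq; apply/negP => /eqP soo.
have := heis_measure_cball1_lty; rewrite ltNge => /negP; apply; rewrite leye_eq; apply/eqP.
have mB := measurable_heis_cball0 1.
rewrite -(setIT (heis_cball0 1)) -integral_indic// polar_integral//; last first.
  exact/measurable_EFinP/measurable_indic.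
apply/eqP; rewrite -leye_eq.
have -> : (+oo = \int[lebesgue_measure]_(r in `]0%R, 1%R]) cst +oo r :> \bar R)%E.
  by rewrite integral_cst//= lebesgue_itv01 mule1.
rewrite (_ : `]0%R, 1%R]%classic = `]0%R, +oo[%classic `&` `]-oo, 1%R]%classic); last first.
  by apply/seteqP; split => x /=; rewrite !in_itv/= andbT; [move/andP|move=> [-> ->]].
rewrite integral_mkcondr; apply: le_integral_ae => [r _|r|].
- by rewrite patchE; case: ifP => // _; rewrite leey.
- rewrite /= in_itv/= andbT => r0; apply: integral_ge0 => y _.
  by rewrite mule_ge0// lee_fin exprn_ge0// ltW.
apply/aeW => r /=; rewrite in_itv/= andbT => r0.
rewrite patchE; case: ifPn => [|_]; last first.
  by apply: integral_ge0 => y _; rewrite mule_ge0// lee_fin exprn_ge0// ltW.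
rewrite inE/= in_itv/= => r1.
rewrite (eq_integral_ae (g := cst (r ^+ (heis_Q n).-1)%:E)).
  by rewrite integral_cst// soo mulry gtr0_sg ?exprn_gt0// mul1e.
apply: filterS sphere_ae_norm => y y1 _.
have By : heis_cball0 1 (heis_dil r y).
  by rewrite /heis_cball0/= heis_norm_dil ?(ltW r0)// y1 mulr1.
by rewrite indicE mem_set// mul1e.
Qed.

End heis_measure_facts.

Section dilation_average.
Context {R : realType} {n : nat}.
Local Notation H := (heisenberg R n).
Local Notation mu := (@heis_measure R n).
Local Notation Q := (heis_Q n).
Variable sigma : {finite_measure set H -> \bar R}.
Hypothesis sigma_sphere : is_sphere_measure sigma.
Local Open Scope ereal_scope.

Lemma measurable_sphere_integral (G : H -> \bar R) :
  measurable_fun setT G -> (forall x, 0 <= G x) ->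
  measurable_fun [set: measurableTypeR R] (fun r => \int[sigma]_y G (heis_dil r y)).
Proof.
move=> mG G0.
apply: (@measurable_fun_fubini_tonelli_F _ _ (measurableTypeR R) H R sigma
  (fun z => G (heis_dil z.1 z.2))) => // .
exact: measurableT_comp mG measurable_heis_dil.
Qed.

(** The inner integral depends on [x] only through its norm [s]; in polar
    coordinates the outer sphere therefore contributes the factor [sigma setT],
    and the substitution [s -> c * s] the factor [c ^ (- Q)]. *)
Lemma dilation_average (c : R) (G : H -> \bar R) : (0 < c)%R ->
  measurable_fun setT G -> (forall x, 0 <= G x) ->
  \int[mu]_x \int[sigma]_y G (heis_dil (c * heis_norm x) y) =
  sigma setT * (c^-1 ^+ Q)%:E * \int[mu]_x G x.
Proof.
move=> c0 mG G0.
pose h (r : R) := \int[sigma]_y G (heis_dil r y).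
have h0 r : 0 <= h r by exact: integral_ge0.
have mh : measurable_fun [set: R] h by exact: measurable_sphere_integral.
pose k (r : R) := h r * (`|r| ^+ Q.-1)%:E.
have k0 r : 0 <= k r by rewrite mule_ge0// lee_fin exprn_ge0.
have mk : measurable_fun [set: R] k.
  apply: emeasurable_funM => //; apply/measurable_EFinP/measurable_funX.
  exact: normr_measurable.
have s_fin : sigma setT \is a fin_num by exact: fin_num_measure.
have -> : \int[mu]_x G x = \int[lebesgue_measure]_(r in `]0%R, +oo[) k r.
  rewrite (polar_integral sigma_sphere)//; apply: eq_integral => r.
  rewrite inE/= in_itv/= andbT => r0.
  rewrite ge0_integralZr//; last by rewrite lee_fin exprn_ge0// ltW.
    by rewrite /k gtr0_norm.
  exact: (measurableT_comp mG (measurableT_comp measurable_heis_dil (pair1_measurable _))).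
rewrite (polar_integral sigma_sphere)//; last 2 first.
- apply: (measurableT_comp mh); apply: measurable_funM => //.
  exact: measurable_heis_norm.
- by move=> x; exact: integral_ge0.
have QE : Q = Q.-1.+1 by rewrite /heis_Q addn2.
transitivity (\int[lebesgue_measure]_(r in `]0%R, +oo[)
    ((sigma setT * (c^-1 ^+ Q.-1)%:E) * k (c * r)%R)).
  apply: eq_integral => r; rewrite inE/= in_itv/= andbT => r0.
  rewrite (eq_integral_ae (g := cst (h (c * r)%R * (r ^+ Q.-1)%:E))); last first.
    apply: filterS (sphere_ae_norm sigma_sphere) => y y1 _ /=.
    by rewrite heis_norm_dil ?ltW// y1 mulr1.
  rewrite integral_cst// /k normrM !gtr0_norm// exprMn EFinM.
  rewrite [RHS](AC (2*(1*2)) ((2*4)*(3*5*1)))/=.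
  by rewrite -EFinM -exprMn mulVf ?gt_eqF// expr1n mul1e.
rewrite ge0_integralZl; first last.
- by rewrite mule_ge0// lee_fin exprn_ge0// invr_ge0 ltW.
- by move=> r _.
- apply/measurable_funTS; apply: (measurableT_comp mk); exact: measurable_funM.
- exact: measurable_itv.
rewrite (ge0_integral_scale c0 mk k0) muleA; congr (_ * _).
by rewrite [in RHS]QE exprSr EFinM muleA.
Qed.

Lemma sphere_measure_fineK : sigma setT = (fine (sigma setT))%:E.
Proof. by rewrite fineK// fin_num_measure. Qed.

Lemma fine_sphere_measure_gt0 : (0 < fine (sigma setT))%R.
Proof. by rewrite fine_gt0// sphere_measure_gt0//= sphere_measure_lty. Qed.

(** This is [dilation_average] for the indicator of the unit ball. *)
Lemma heis_cball0_scale r : (0 < r)%R ->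
  mu (heis_cball0 r) = (r ^+ Q)%:E * mu (heis_cball0 1).
Proof.
move=> r0; have r10 : (0 < r^-1)%R by rewrite invr_gt0.
have mB s : measurable (@heis_cball0 R n s) by exact: measurable_heis_cball0.
pose I1 (x : H) : \bar R := (\1_(heis_cball0 1) x)%:E.
have mI : measurable_fun [set: H] I1.
  exact/measurable_EFinP/measurable_indic.
have I0 (x : H) : 0 <= I1 x by rewrite lee_fin.
have := dilation_average r10 mI I0; rewrite invrK.
have -> : \int[mu]_x I1 x = mu (heis_cball0 1).
  by rewrite integral_indic ?setIT//; exact: mB.
have -> : \int[mu]_x \int[sigma]_y I1 (heis_dil (r^-1 * heis_norm x) y)
    = sigma setT * mu (heis_cball0 r).
  transitivity (\int[mu]_x (sigma setT * (\1_(heis_cball0 r) x)%:E)).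
    apply: eq_integral => x _.
    rewrite (eq_integral_ae (g := cst (\1_(heis_cball0 r) x)%:E)).
      by rewrite integral_cst// muleC.
    apply: filterS (sphere_ae_norm sigma_sphere) => y y1 _ /=.
    rewrite /I1 !indicE (_ : (_ \in _) = (x \in heis_cball0 r))//.
    apply/idP/idP; rewrite !inE /heis_cball0/= heis_norm_dil ?mulr_ge0 ?(ltW r10) ?heis_norm_ge0//;
      by rewrite y1 mulr1 mulrC ler_pdivrMr// mul1r.
  rewrite ge0_integralZl ?integral_indic ?setIT//.
  exact/measurable_EFinP/measurable_indic.
rewrite sphere_measure_fineK => H0.
have s0 := fine_sphere_measure_gt0.
have H1 : (fine (sigma setT))%:E * mu (heis_cball0 r) =
    (fine (sigma setT))%:E * ((r ^+ Q)%:E * mu (heis_cball0 1)).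
  by rewrite muleA.
have s1 : ((fine (sigma setT))^-1 * fine (sigma setT) = 1)%R by rewrite mulVf ?gt_eqF.
rewrite -[LHS]mul1e -s1 EFinM -muleA H1 muleA -EFinM s1 mul1e//.
Qed.

Definition heis_vol : R := fine (mu (@heis_cball0 R n 1)).

Lemma heis_cball0_measure r : (0 < r)%R -> mu (heis_cball0 r) = (heis_vol * r ^+ Q)%:E.
Proof.
move=> r0; rewrite heis_cball0_scale// mulrC EFinM; congr (_ * _).
by rewrite /heis_vol fineK// ge0_fin_numE// heis_measure_cball1_lty.
Qed.

(** If the unit ball were null, so would be all its dilates, which exhaust the
    group. *)
Lemma heis_vol_gt0 : (0 < heis_vol)%R.
Proof.
rewrite /heis_vol fine_gt0// heis_measure_cball1_lty andbT lt0e measure_ge0 andbT.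
apply/eqP => B10.
have Bk0 k : mu (@heis_cball0 R n k.+1%:R) = 0 by rewrite heis_cball0_scale// B10 mule0.
have := @heis_measure_gt0 R n; rewrite ltNge => /negP; apply.
have mB s : measurable (@heis_cball0 R n s) by exact: measurable_heis_cball0.
have sub : mu [set: H] <= \sum_(k <oo) mu (@heis_cball0 R n k.+1%:R).
  apply: (@measure_sigma_subadditive _ _ _ mu setT (fun k => @heis_cball0 R n k.+1%:R)); [by move=> k; exact: mB|exact: measurableT|].
  move=> x _; exists (Num.truncn (heis_norm x)) => //.
  by rewrite /heis_cball0/= ltW// truncnS_gt.
apply: (le_trans sub); rewrite eseries0; first exact: lexx.
by move=> k _ _; exact: Bk0.
Qed.

(** In polar coordinates a sphere is a single radius. *)
Lemma heis_norm_ae_neq r : \forall x \ae mu, heis_norm x != r.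
Proof.
have mS : measurable [set x : H | heis_norm x = r].
  rewrite -[X in measurable X]setTI (_ : [set x | _] = @heis_norm R n @^-1` [set r])//.
  by apply: measurable_heis_norm => //; exact: measurable_set1.
exists [set x | heis_norm x = r]; split => //.
  rewrite -(setIT [set x | _]) -integral_indic//.
  rewrite (polar_integral sigma_sphere)//; last first.
    exact/measurable_EFinP/measurable_indic.
  rewrite (eq_integral_ae (g := cst 0)) ?integral0//.
  exists [set r]; split => //; first exact: lebesgue_measure_set1.
  move=> s /= /not_implyP[]; rewrite in_itv/= andbT => s0.
  apply: contra_notP => sr.
  rewrite (eq_integral_ae (g := cst 0)) ?integral0//.
  apply: filterS (sphere_ae_norm sigma_sphere) => y y1 _ /=.
  rewrite indicE memNset ?mul0e//=.
  by rewrite heis_norm_dil ?ltW// y1 mulr1.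
by move=> x /= /negP/negbNE/eqP.
Qed.

(** Weights are tested on open balls while the norms use closed ones; the sphere
    between them is null. *)
Lemma integral_heis_ball0 (f : H -> \bar R) r :
  \int[mu]_(x in heis_ball (0%R, 0%R : R) r) f x = \int[mu]_(x in heis_cball0 r) f x.
Proof.
rewrite integral_mkcond [RHS]integral_mkcond; apply: eq_integral_ae.
apply: filterS (heis_norm_ae_neq r) => x xr _; rewrite !patchE.
rewrite (_ : (x \in heis_ball _ r) = (x \in heis_cball0 r))//.
apply/idP/idP; rewrite !inE /heis_ball /heis_cball0/= heis_dist0; first exact: ltW.
by rewrite lt_neqAle xr.
Qed.

Lemma heis_ball0_measure r : mu (heis_ball (0%R, 0%R : R) r) = mu (heis_cball0 r).
Proof.
have mb : measurable (@heis_ball R n (0%R, 0%R : R) r).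
  rewrite -[X in measurable X]setTI.
  rewrite (_ : heis_ball _ r = @heis_norm R n @^-1` `]-oo, r[%classic).
    by apply: measurable_heis_norm => //; exact: measurable_itv.
  by apply/seteqP; split => x; rewrite /heis_ball /= in_itv/= heis_dist0.
have mB := @measurable_heis_cball0 R n r.
have cstE D : measurable D -> mu D = \int[mu]_(x in D) cst 1 x.
  by move=> mD; rewrite integral_cst// mul1e.
rewrite (cstE _ mb) (cstE _ mB); exact: integral_heis_ball0.
Qed.

End dilation_average.

(** * Muckenhoupt weights on centred balls *)

Section muckenhoupt_weights.
Context {R : realType} {n : nat}.
Local Notation H := (heisenberg R n).
Local Notation mu := (@heis_measure R n).
Local Notation Q := (heis_Q n).
Local Notation B := (@heis_cball0 R n).
Variable sigma : {finite_measure set H -> \bar R}.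
Hypothesis sigma_sphere : is_sphere_measure sigma.

Definition cball_vol (r : R) : R := heis_vol (n := n) (R := R) * r ^+ Q.
Local Notation m := cball_vol.

Lemma cball_vol_gt0 r : 0 < r -> 0 < m r.
Proof. by move=> r0; rewrite mulr_gt0 ?exprn_gt0//; exact: (heis_vol_gt0 sigma_sphere). Qed.

Lemma cball_volE r : 0 < r -> mu (B r) = (m r)%:E.
Proof. exact: (heis_cball0_measure sigma_sphere). Qed.

Lemma integral_cball_one r : 0 < r -> (\int[mu]_(x in B r) (1%R)%:E = (m r)%:E)%E.
Proof.
move=> r0; rewrite -cball_volE// -[RHS]mul1e.
exact: (integral_cst mu (measurable_heis_cball0 r) 1%E).
Qed.

Lemma average_ball0 (g : H -> \bar R) r : 0 < r ->
  average (heis_ball (0, 0 : R) r) g = ((\int[mu]_(x in B r) g x) * ((m r)^-1)%:E)%E.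
Proof.
move=> r0; rewrite /average (integral_heis_ball0 sigma_sphere) (heis_ball0_measure sigma_sphere).
by rewrite cball_volE// inver gt_eqF ?cball_vol_gt0.
Qed.

Variable w : H -> R.
Hypothesis mw : measurable_fun setT w.
Hypothesis w0 : forall x, 0 <= w x.

Let I r := (\int[mu]_(x in B r) (w x)%:E)%E.

Lemma exists_in_cball r (P : H -> Prop) : 0 < r ->
  (\forall x \ae mu, P x) -> exists2 x, B r x & P x.
Proof.
move=> r0 [N [mN N0 PN]]; apply: contrapT => noP.
have BN : B r `<=` N.
  by move=> x Bx; apply: PN => /= Px; apply: noP; exists x.
have : (mu (B r) <= mu N)%E.
  apply: le_measure; rewrite ?inE//; exact: measurable_heis_cball0.
by rewrite N0 cball_volE// lee_fin leNgt cball_vol_gt0.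
Qed.

Lemma cball0_subset r s : r <= s -> B r `<=` B s.
Proof. by move=> rs x /le_trans; apply. Qed.

Lemma weight_integral0_ae r : I r = 0%E -> \forall x \ae mu, B r x -> w x = 0.
Proof.
move=> I0.
have mE : measurable_fun (B r) (EFin \o w) by exact/measurable_funTS/measurable_EFinP.
have := (ae_eq_integral_abs mu (measurable_heis_cball0 r) mE).1.
rewrite (_ : integral _ _ _ = I r); last first.
  by apply: eq_integral => x _ /=; rewrite ger0_norm.
by move=> /(_ I0); apply: filterS => x /[apply] /= -[].
Qed.

Lemma ae_cballP (P : H -> Prop) :
  (forall k : nat, \forall x \ae mu, B k.+1%:R x -> P x) -> \forall x \ae mu, P x.
Proof.
move=> h; have : \forall x \ae mu, forall k : nat, B k.+1%:R x -> P x.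
  exact: ae_foralln.
apply: filterS => x /(_ (Num.truncn (heis_norm x))); apply.
by rewrite /heis_cball0/= ltW// truncnS_gt.
Qed.

(** A weight that vanishes almost everywhere satisfies every reverse Hölder
    inequality, so its critical index is infinite. The finiteness of the index
    thus excludes this degenerate weight, for which all normalized integrals are
    meaningless. *)
Lemma critical_index_ae0 (rw : R) : critical_index w = rw%:E ->
  ~ (\forall x \ae mu, w x = 0).
Proof.
move=> cE w00.
have rh (r : R) : 1 < r -> reverse_hoelder r w.
  move=> r1; exists 0 => x s s0 /=.
  rewrite mul0e /average.
  rewrite (eq_integral_ae (g := cst 0%E)).
    by rewrite integral0 mul0e poweR0r// invr_neq0// gt_eqF// (lt_trans _ r1).
  by apply: filterS w00 => y -> _; rewrite powR0// gt_eqF// (lt_trans _ r1).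
(* an exponent that is admissible and larger than [rw] *)
have : ((Num.max rw 1 + 1)%:E <= rw%:E)%E.
  rewrite -cE; apply: ereal_sup_ubound; exists (Num.max rw 1 + 1) => //; split.
    by rewrite ltr_pwDr// le_max lexx orbT.
  by apply: rh; rewrite ltr_pwDr// le_max lexx orbT.
by rewrite lee_fin leNgt ltr_pwDr// le_max lexx.
Qed.

Lemma weight_integral_ge0 r : (0 <= I r)%E.
Proof. by apply: integral_ge0 => x _; rewrite lee_fin. Qed.

Lemma weight_integral_le r s : r <= s -> (I r <= I s)%E.
Proof.
move=> rs; apply: ge0_subset_integral; [exact: measurable_heis_cball0..| | |exact: cball0_subset].
  exact/measurable_funTS/measurable_EFinP.
by move=> x _; rewrite lee_fin.
Qed.

Let spread := forall r s, 0 < r -> r <= s -> I r = 0%E -> I s = 0%E.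

(** A weight with no mass on one ball would, by [spread], have none on the balls
    that exhaust the group. *)
Lemma weight_integral_gt0 : ~ (\forall x \ae mu, w x = 0) -> spread ->
  forall r, 0 < r -> (0 < I r)%E.
Proof.
move=> wn0 spr r r0; rewrite lt0e weight_integral_ge0 andbT.
apply/eqP => Ir0; apply: wn0; apply: ae_cballP => k.
apply: weight_integral0_ae; have [rk|kr] := leP r k.+1%:R; first exact: (spr r).
apply/eqP; rewrite eq_le weight_integral_ge0 andbT -Ir0.
exact: weight_integral_le (ltW kr).
Qed.

Lemma ess_inf_on_le r : \forall x \ae mu, B r x ->
  (ess_inf_on (heis_ball (0%R, 0%R : R) r) (EFin \o w) <= (w x)%:E)%E.
Proof.
have := ess_inf_le mu (patch (fun=> +oo%E) (heis_ball (0, 0 : R) r) (EFin \o w)).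
apply: filterS2 (heis_norm_ae_neq sigma_sphere r) => x xr + Bx.
by rewrite /patch mem_set// /heis_ball/= heis_dist0 lt_neqAle xr.
Qed.

(** The form in which the Muckenhoupt condition is used: on centred balls,
    weighted means of order [zeta] dominate unweighted means. *)
Definition weight_bounds (zeta : R) :=
  [/\ forall r, 0 < r -> (0 < I r < +oo)%E,
    \forall x \ae mu, 0 < w x &
    exists2 C, 0 <= C & forall r A (g : H -> R), 0 < r -> 0 <= A ->
      measurable_fun setT g -> (forall x, 0 <= g x) ->
      (\int[mu]_(x in B r) (g x `^ zeta * w x)%:E <= (A * fine (I r))%:E)%E ->
      (\int[mu]_(x in B r) (g x)%:E <= (C * m r * A `^ zeta^-1)%:E)%E].

(** The essential infimum [e r] of the weight on the ball is finite, and
    positive because the weight has positive mass; then [g <= g * w / e r]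
    almost everywhere on the ball. *)
Lemma muckenhoupt1_bounds : muckenhoupt 1 w ->
  ~ (\forall x \ae mu, w x = 0) -> weight_bounds 1.
Proof.
rewrite /muckenhoupt => -[C HC] wn0.
pose e r := ess_inf_on (heis_ball (0, 0 : R) r) (EFin \o w).
have {}HC r : 0 < r -> (I r * ((m r)^-1)%:E <= C%:E * e r)%E.
  by move=> r0; have := HC (0, 0 : R) r r0; rewrite eqxx average_ball0.
have e_ge0 r : (0 <= e r)%E.
  apply/ess_infP/aeW => x; rewrite /patch; case: ifP => _; last by rewrite leey.
  by rewrite lee_fin.
have e_fin r : 0 < r -> e r \is a fin_num.
  move=> r0; rewrite ge0_fin_numE//.
  have [x Bx h] := exists_in_cball r0 (ess_inf_on_le r).
  exact: le_lt_trans (h Bx) (ltry _).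
have m0 r : 0 < r -> 0 < (m r)^-1 by move=> r0; rewrite invr_gt0 cball_vol_gt0.
have I_lty r : 0 < r -> (I r < +oo)%E.
  move=> r0; rewrite ltNge leye_eq; apply/negP => /eqP Ioo.
  have := HC r r0; rewrite Ioo gt0_mulye ?lte_fin ?m0// leye_eq => /eqP.
  by rewrite -(fineK (e_fin r r0)).
have spr : spread.
  move=> r s r0 rs Ir0; have s0 := lt_le_trans r0 rs.
  have es0 : (e s <= 0)%E.
    have [x Bx [h1 h2]] := exists_in_cball r0 (filterI (ess_inf_on_le s) (weight_integral0_ae Ir0)).
    by have := h1 (cball0_subset rs Bx); rewrite h2.
  have es : e s = 0%E by apply/eqP; rewrite eq_le es0 e_ge0.
  apply/eqP; rewrite eq_le weight_integral_ge0 andbT leNgt; apply/negP => Is0.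
  have := HC s s0; rewrite es mule0 leNgt => /negP; apply.
  by rewrite mule_gt0// lte_fin m0.
have I_gt0 := weight_integral_gt0 wn0 spr.
have e_gt0 r : 0 < r -> (0 < e r)%E.
  move=> r0; rewrite lt0e e_ge0 andbT; apply/eqP => er0.
  have := HC r r0; rewrite er0 mule0 leNgt => /negP; apply.
  by rewrite mule_gt0 ?I_gt0 ?lte_fin ?m0.
have C0 : 0 < C.
  have := HC 1 ltr01; rewrite -(fineK (e_fin _ ltr01)) -EFinM => h.
  have : (0 < (C * fine (e 1))%:E)%E.
    by apply: lt_le_trans h; rewrite mule_gt0 ?I_gt0 ?lte_fin ?m0.
  by rewrite lte_fin pmulr_lgt0// fine_gt0// e_gt0//= -ge0_fin_numE ?e_fin.
split.
- by move=> r r0; rewrite I_gt0//= I_lty.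
- apply: ae_cballP => k; apply: filterS (ess_inf_on_le k.+1%:R) => x /[apply] h.
  by rewrite -lte_fin; apply: lt_le_trans h; exact: e_gt0.
exists C; first exact: ltW.
move=> r A g r0 A0 mg g0; rewrite invr1 powRr1//.
under eq_integral do rewrite (powRr1 (g0 _)).
move=> gw.
have er := fineK (e_fin r r0); have ep := e_gt0 r r0.
have mgE : measurable_fun (B r) (EFin \o g) by exact/measurable_funTS/measurable_EFinP.
rewrite -(@lee_pmul2l _ (e r)) ?e_fin//.
rewrite -[leLHS]ge0_integralZl; [|exact: measurable_heis_cball0|exact: mgE
  |by move=> x _; rewrite lee_fin|exact: e_ge0].
apply: (@le_trans _ _ (\int[mu]_(x in B r) (g x * w x)%:E)%E).
  apply: le_integral_ae.
  - by move=> x _; rewrite mule_ge0 ?lee_fin// ltW.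
  - by move=> x _; rewrite lee_fin mulr_ge0.
  apply: filterS (ess_inf_on_le r) => x /[apply] h.
  by rewrite EFinM muleC lee_wpmul2l ?lee_fin.
apply: (le_trans gw); rewrite -er -EFinM lee_fin.
have Ifin : (I r)%E = (fine (I r))%:E by rewrite fineK// ge0_fin_numE ?weight_integral_ge0 ?I_lty.
have := HC r r0; rewrite Ifin -er -!EFinM lee_fin ler_pdivrMr ?cball_vol_gt0// => h.
rewrite (_ : _ * (C * m r * A) = A * (C * fine (e r) * m r)); first exact: ler_wpM2l.
by ring.
Qed.

Section exponent_gt1.
Variable zeta : R.
Hypothesis zeta1 : 1 < zeta.

Let dual y : \bar R := (((w y)%:E)^-1 `^ (zeta - 1)^-1)%E.
Let J r := (\int[mu]_(x in B r) dual x)%E.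
(** Where [w] vanishes, [dual] is [+oo] and [rdual] is [0]: the latter is real
    and measurable, and the two agree where [w] is positive. *)
Let rdual y : R := w y `^ (- (zeta - 1)^-1).

Let zm0 : 0 < zeta - 1. Proof. by rewrite subr_gt0. Qed.

Let dualE y : 0 < w y -> dual y = (rdual y)%:E.
Proof.
move=> wy; rewrite /dual /rdual inver gt_eqF// poweR_EFin.
by rewrite -(powR_inv1 (ltW wy)) -powRrM mulN1r.
Qed.

Let dual0 y : w y = 0 -> dual y = +oo%E.
Proof. by move=> wy; rewrite /dual inver wy eqxx poweRyr// invr_neq0// gt_eqF. Qed.

Let dual_ge0 y : (0 <= dual y)%E. Proof. exact: poweR_ge0. Qed.

Let rdual_le y : ((rdual y)%:E <= dual y)%E.
Proof.
have := w0 y; rewrite le_eqVlt => /predU1P[/esym wy|wy]; last by rewrite dualE.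
by rewrite dual0// leey.
Qed.

Let mrdual : measurable_fun setT rdual. Proof. exact: measurable_powR_fun. Qed.

Let J_ge0 r : (0 <= J r)%E. Proof. exact: integral_ge0. Qed.

(** The dual weight is [+oo] on the zeros of [w]. *)
Let J_lty_pos r : (J r < +oo)%E -> \forall x \ae mu, B r x -> 0 < w x.
Proof.
move=> Jr; pose Z : set H := w @^-1` [set 0].
have mZ : measurable Z by rewrite -[X in measurable X]setTI; exact: mw.
have mBZ : measurable (B r `&` Z) by apply: measurableI => //; exact: measurable_heis_cball0.
exists (B r `&` Z); split => //; last first.
  move=> x /= /not_implyP[Bx wx]; split => //; apply/eqP; rewrite eq_le w0 andbT leNgt.
  exact/negP.
apply/eqP; rewrite eq_le measure_ge0 andbT leNgt; apply/negP => Z0.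
move: Jr; rewrite ltNge => /negP; apply.
have -> : (+oo = \int[mu]_(x in B r `&` Z) cst +oo x :> \bar R)%E.
  by rewrite integral_cst// gt0_mulye.
rewrite integral_mkcondr; apply: le_integral_ae => [x _|x _|].
- by rewrite patchE; case: ifP => // _; rewrite leey.
- exact: dual_ge0.
apply/aeW => x _; rewrite patchE; case: ifPn => [|_]; last exact: dual_ge0.
by rewrite inE => /dual0 ->.
Qed.

Let J_gt0 r : 0 < r -> (0 < J r)%E.
Proof.
move=> r0; rewrite lt0e J_ge0 andbT; apply/eqP => Jr0.
have pos : \forall x \ae mu, B r x -> 0 < w x by apply: J_lty_pos; rewrite Jr0 ltry.
have K0 : (\int[mu]_(x in B r) (rdual x)%:E = 0)%E.
  apply/eqP; rewrite eq_le; apply/andP; split; last first.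
    by apply: integral_ge0 => x _; rewrite lee_fin powR_ge0.
  rewrite -Jr0; apply: le_integral_ae => [x _|x _|]; rewrite ?lee_fin ?powR_ge0//.
  by apply/aeW => x _; exact: rdual_le.
have mE : measurable_fun (B r) (EFin \o rdual) by exact/measurable_funTS/measurable_EFinP.
have := (ae_eq_integral_abs mu (measurable_heis_cball0 r) mE).1.
rewrite (_ : integral _ _ _ = 0%E); last first.
  by rewrite -K0; apply: eq_integral => x _ /=; rewrite ger0_norm ?powR_ge0.
move=> /(_ erefl) null.
have [x Bx [/(_ Bx) wx /(_ Bx)/= [rx]]] := exists_in_cball r0 (filterI pos null).
by have := powR_gt0 (- (zeta - 1)^-1) wx; rewrite -/(rdual x) rx ltxx.
Qed.

(** Hölder's inequality for [g * w ^ (1 / zeta)] and [w ^ (- 1 / zeta)]. The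
    dual integral is finite because the weight has positive mass, and its
    finiteness makes the weight positive almost everywhere, which is needed to
    cancel the two powers. *)
Lemma muckenhoupt_gt1_bounds : muckenhoupt zeta w ->
  ~ (\forall x \ae mu, w x = 0) -> weight_bounds zeta.
Proof.
rewrite /muckenhoupt => -[C HC] wn0.
have {}HC r : 0 < r ->
    ((I r * ((m r)^-1)%:E) * (J r * ((m r)^-1)%:E) `^ (zeta - 1) <= C%:E)%E.
  by move=> r0; have := HC (0, 0 : R) r r0; rewrite gt_eqF// !average_ball0.
have m0 r : 0 < r -> 0 < (m r)^-1 by move=> r0; rewrite invr_gt0 cball_vol_gt0.
have I_lty r : 0 < r -> (I r < +oo)%E.
  move=> r0; rewrite ltNge leye_eq; apply/negP => /eqP Ioo.
  have := HC r r0; rewrite Ioo gt0_mulye ?lte_fin ?m0// gt0_mulye//.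
  by rewrite poweR_gt0// mule_gt0 ?J_gt0 ?lte_fin ?m0.
have J_lty r : 0 < r -> (0 < I r)%E -> (J r < +oo)%E.
  move=> r0 Ir; rewrite ltNge leye_eq; apply/negP => /eqP Joo.
  have := HC r r0; rewrite Joo gt0_mulye ?lte_fin ?m0// poweRyr ?gt_eqF//.
  by rewrite gt0_muley// mule_gt0 ?lte_fin ?m0.
have spr : spread.
  move=> r s r0 rs Ir0; have s0 := lt_le_trans r0 rs.
  apply/eqP; rewrite eq_le weight_integral_ge0 andbT leNgt; apply/negP => Is0.
  have [x Bx [h1 /(_ Bx) h2]] := exists_in_cball r0
    (filterI (J_lty_pos (J_lty s s0 Is0)) (weight_integral0_ae Ir0)).
  by have := h1 (cball0_subset rs Bx); rewrite h2 ltxx.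
have I_gt0 := weight_integral_gt0 wn0 spr.
have J_fin r : 0 < r -> J r = (fine (J r))%:E.
  by move=> r0; rewrite fineK// ge0_fin_numE ?J_ge0// J_lty// I_gt0.
have I_fin r : 0 < r -> I r = (fine (I r))%:E.
  by move=> r0; rewrite fineK// ge0_fin_numE ?weight_integral_ge0// I_lty.
have pos r : 0 < r -> \forall x \ae mu, B r x -> 0 < w x.
  by move=> r0; exact: J_lty_pos (J_lty r r0 (I_gt0 r r0)).
split.
- by move=> r r0; rewrite I_gt0//= I_lty.
- by apply: ae_cballP => k; exact: pos.
have HCr r : 0 < r -> (fine (I r) / m r) * (fine (J r) / m r) `^ (zeta - 1) <= C.
  move=> r0; have := HC r r0.
  by rewrite I_fin// J_fin// -!EFinM poweR_EFin -EFinM lee_fin.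
exists (C `^ zeta^-1); first exact: powR_ge0.
move=> r A g r0 A0 mg g0 gw.
have z0 : 0 < zeta by rewrite (lt_trans _ zeta1).
have th1 : zeta^-1 + (1 - zeta^-1) = 1 by rewrite addrCA subrr addr0.
have eta0 : 0 <= 1 - zeta^-1 by rewrite subr_ge0 invf_le1// ltW.
have KJ : (\int[mu]_(x in B r) (rdual x)%:E <= (fine (J r))%:E)%E.
  rewrite -J_fin//; apply: le_integral_ae => [x _|x _|]; rewrite ?lee_fin ?powR_ge0//.
  by apply/aeW => x _; exact: rdual_le.
have zi0 : 0 <= zeta^-1 by rewrite invr_ge0 ltW.
have := hoelder_le (measurable_heis_cball0 r) _ mrdual _ (fun x => powR_ge0 _ _) zi0 eta0 th1 gw KJ.
move=> H; apply: le_trans (le_trans (H _ _) _).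
- rewrite le_eqVlt; apply/orP; left; apply/eqP.
  apply: eq_integral_ae; apply: filterS (pos r r0) => x /[apply] wx.
  rewrite powRM ?powR_ge0// -powRrM mulfV ?gt_eqF// powRr1//.
  rewrite /rdual -powRrM -mulrA -powRD; last by rewrite (gt_eqF wx) implybT.
  rewrite (_ : _ + _ = 0) ?powRr0 ?mulr1//.
  by field; rewrite !gt_eqF.
- by apply: measurable_funM => //; exact: measurable_powR_fun.
- by move=> x; rewrite mulr_ge0 ?powR_ge0.
have I0 : 0 < fine (I r) by rewrite fine_gt0// I_gt0//= I_lty.
have J0 : 0 < fine (J r) by rewrite fine_gt0// J_gt0//= J_lty// I_gt0.
have mr := cball_vol_gt0 r0.
rewrite lee_fin (powRM _ A0 (ltW I0)) -mulrA [leLHS]mulrC.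
rewrite ler_wpM2r ?powR_ge0//.
have C0 : 0 <= C.
  by apply: le_trans (HCr r r0); rewrite mulr_ge0 ?powR_ge0 ?divr_ge0 ?ltW.
rewrite (_ : 1 - zeta^-1 = (zeta - 1) / zeta); last by field; rewrite gt_eqF.
have mE : m r = (m r `^ zeta) `^ zeta^-1 by rewrite -powRrM mulfV ?gt_eqF// powRr1// ltW.
rewrite [X in _ <= _ * X]mE -powRM ?powR_ge0//.
rewrite (powRrM (fine (J r))) -(powRM _ (ltW I0) (powR_ge0 _ _)).
apply: ge0_ler_powR => //; rewrite ?nnegrE ?mulr_ge0 ?powR_ge0 ?(ltW I0)//.
have mi : (m r)^-1 * (m r)^-1 `^ (zeta - 1) = (m r `^ zeta)^-1.
  rewrite -(powR_inv1 (ltW mr)) -powRrM mulN1r -powRD; last by rewrite (gt_eqF mr) implybT.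
  by rewrite (_ : -1 + - (zeta - 1) = - zeta) ?powRN//; ring.
have := HCr r r0; rewrite (powRM _ (ltW J0) (ltW (m0 r r0))) mulrACA mi.
by rewrite ler_pdivrMr// powR_gt0.
Qed.

End exponent_gt1.

Variables (zeta rw : R).
Hypothesis zeta1 : 1 <= zeta.
Hypothesis w_A : muckenhoupt zeta w.
Hypothesis rwE : critical_index w = rw%:E.

Lemma muckenhoupt_bounds : weight_bounds zeta.
Proof.
have wn0 := critical_index_ae0 rwE.
move: zeta1 w_A; rewrite le_eqVlt => /predU1P[<- wA|z1 wA]; first exact: muckenhoupt1_bounds.
exact: muckenhoupt_gt1_bounds.
Qed.

Definition weight_mass r : R := fine (\int[mu]_(x in B r) (w x)%:E)%E.
Local Notation W := weight_mass.

Lemma weight_massE r : 0 < r -> wmeasure w (B r) = (W r)%:E.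
Proof.
move=> r0; have [/(_ r r0)/andP[I0 Ioo] _ _] := muckenhoupt_bounds.
by rewrite fineK// ge0_fin_numE// ltW.
Qed.

Lemma weight_mass_gt0 r : 0 < r -> 0 < W r.
Proof. by move=> r0; have [/(_ r r0) h _ _] := muckenhoupt_bounds; exact: fine_gt0. Qed.

Lemma weight_gt0_ae : \forall x \ae mu, 0 < w x.
Proof. by have [] := muckenhoupt_bounds. Qed.

Lemma muckenhoupt_le : exists2 C, 0 <= C & forall r A (g : H -> R), 0 < r -> 0 <= A ->
      measurable_fun setT g -> (forall x, 0 <= g x) ->
      (\int[mu]_(x in B r) (g x `^ zeta * w x)%:E <= (A * W r)%:E)%E ->
      (\int[mu]_(x in B r) (g x)%:E <= (C * m r * A `^ zeta^-1)%:E)%E.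
Proof. by have [_ _] := muckenhoupt_bounds. Qed.

(** The supremum defining the critical index provides an admissible exponent [p
    > s], and Hölder's inequality lowers [p] to [s]. *)
Lemma reverse_hoelder_le s : 1 < s -> s < rw ->
  exists2 C, 0 <= C & forall r, 0 < r ->
    (\int[mu]_(x in B r) (w x `^ s)%:E <= (m r * (C * (W r / m r)) `^ s)%:E)%E.
Proof.
move=> s1 srw.
have [p [p1 [C HC]] sp] : exists2 p, 1 < p /\ reverse_hoelder p w & s < p.
  have : (s%:E < critical_index w)%E by rewrite rwE lte_fin.
  by move=> /ereal_sup_gt[_ [p [p1 rp] <-]]; rewrite lte_fin => sp; exists p.
have s0 : 0 < s by rewrite (lt_trans _ s1).
have p0 : 0 < p by rewrite (lt_trans _ p1).
have intE r : 0 < r -> (\int[mu]_(x in B r) (w x `^ p)%:E <= (m r * (C * (W r / m r)) `^ p)%:E)%E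
    /\ 0 <= C * (W r / m r).
  move=> r0; have := HC (0, 0 : R) r r0; cbv zeta; rewrite !average_ball0//.
  rewrite -/(wmeasure w (B r)) weight_massE// -!EFinM.
  set X := integral _ _ _ => h.
  have X0 : (0 <= X)%E by apply: integral_ge0 => x _; rewrite lee_fin powR_ge0.
  have mr := cball_vol_gt0 r0; have mir : 0 < (m r)^-1 by rewrite invr_gt0.
  have CW : 0 <= C * (W r / m r) by rewrite -lee_fin; apply: le_trans h; exact: poweR_ge0.
  split => //.
  have Xoo : (X < +oo)%E.
    rewrite ltNge leye_eq; apply/negP => /eqP Xoo; move: h.
    by rewrite Xoo gt0_mulye ?lte_fin// poweRyr ?invr_neq0 ?gt_eqF// leye_eq.
  move: h; rewrite -(@fineK _ X) ?ge0_fin_numE// -EFinM poweR_EFin !lee_fin => h.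
  rewrite -ler_pdivrMl// mulrC.
  have X1 : 0 <= fine X / m r by rewrite mulr_ge0 ?fine_ge0// ltW.
  rewrite -[leLHS](powRr1 X1) -(@mulVf _ p) ?gt_eqF// powRrM.
  by apply: ge0_ler_powR; rewrite ?nnegrE ?powR_ge0// ltW.
have C0 : 0 <= C.
  have [_] := intE 1 ltr01; rewrite pmulr_lge0// divr_gt0 ?weight_mass_gt0 ?cball_vol_gt0//.
exists C => // r r0; have [Xle CW] := intE r r0.
have mr := cball_vol_gt0 r0.
have int1 : (\int[mu]_(x in B r) (1%R)%:E <= (m r)%:E)%E.
  by rewrite integral_cball_one.
have := hoelder_le (th := s / p) (eta := 1 - s / p) (measurable_heis_cball0 r)
  (measurable_powR_fun p mw) _ (fun x => powR_ge0 _ _) _ _ _ _ Xle int1.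
move=> H; apply: le_trans (le_trans (H _ _ _ _ _) _).
- rewrite le_eqVlt; apply/orP; left; apply/eqP; apply: eq_integral => x _.
  by rewrite powR1 mulr1 -powRrM (mulrC p) divfK// gt_eqF.
- exact: measurable_cst.
- by move=> x.
- by rewrite divr_ge0 ?ltW.
- by rewrite subr_ge0 ler_pdivrMr// mul1r ltW.
- by rewrite addrCA subrr addr0.
rewrite lee_fin (powRM _ (ltW mr) (powR_ge0 _ _)) mulrAC -powRD; last by rewrite (gt_eqF mr) implybT.
by rewrite addrCA subrr addr0 powRr1 ?(ltW mr)// -powRrM (mulrC p) divfK// gt_eqF.
Qed.

Lemma cball_vol_ratio r s : 0 < r -> 0 < s -> m r = (r / s) ^+ Q * m s.
Proof.
move=> r0 s0; rewrite /m expr_div_n; field.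
by rewrite expf_eq0 gt_eqF// andbF.
Qed.

(** Hölder's inequality on the small ball, with exponents [s] and its conjugate,
    followed by the reverse Hölder inequality on the large one. *)
Lemma weight_mass_decay s : 1 < s -> s < rw ->
  exists2 C, 0 < C & forall r t, 0 < r -> r <= t ->
    W r <= C * (r / t) `^ (Q%:R * (s - 1) / s) * W t.
Proof.
move=> s1 srw; have [C C0 HC] := reverse_hoelder_le s1 srw.
exists (C + 1) => [|r t r0 rt]; first by rewrite ltr_wpDl.
have t0 := lt_le_trans r0 rt.
have s0 : 0 < s by rewrite (lt_trans _ s1).
have mr := cball_vol_gt0 r0; have mt := cball_vol_gt0 t0.
have Wt := weight_mass_gt0 t0.
have intS : (\int[mu]_(x in B r) (w x `^ s)%:E <= (m t * (C * (W t / m t)) `^ s)%:E)%E.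
  apply: le_trans (HC t t0); apply: ge0_subset_integral; [exact: measurable_heis_cball0..| | |exact: cball0_subset].
    exact/measurable_funTS/measurable_EFinP/measurable_powR_fun.
  by move=> x _; rewrite lee_fin powR_ge0.
have int1 : (\int[mu]_(x in B r) (1%R)%:E <= (m r)%:E)%E.
  by rewrite integral_cball_one.
have := hoelder_le (th := s^-1) (eta := 1 - s^-1) (measurable_heis_cball0 r)
  (measurable_powR_fun s mw) _ (fun x => powR_ge0 _ _) _ _ _ _ intS int1.
move=> H; rewrite -lee_fin -weight_massE//.
apply: le_trans (le_trans (H _ _ _ _ _) _).
- rewrite le_eqVlt; apply/orP; left; apply/eqP; apply: eq_integral => x _.
  by rewrite powR1 mulr1 -powRrM mulfV ?gt_eqF// powRr1.
- exact: measurable_cst.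
- by move=> x.
- by rewrite invr_ge0 ltW.
- by rewrite subr_ge0 invf_le1// ltW.
- by rewrite addrCA subrr addr0.
rewrite lee_fin (powRM _ (ltW mt) (powR_ge0 _ _)) -powRrM mulfV ?gt_eqF//.
have CW0 : 0 <= C * (W t / m t) by rewrite mulr_ge0// divr_ge0 ?ltW.
rewrite powRr1//.
have -> : m r `^ (1 - s^-1) = (r / t) `^ (Q%:R * (s - 1) / s) * m t `^ (1 - s^-1).
  have rt0 : 0 <= r / t by rewrite divr_ge0 ?ltW.
  rewrite (cball_vol_ratio r0 t0) powRM ?exprn_ge0 ?(ltW mt)//.
  rewrite -powR_mulrn// -powRrM; congr (_ `^ _ * _); field; rewrite gt_eqF//.
have -> : m t `^ s^-1 * (C * (W t / m t)) * ((r / t) `^ (Q%:R * (s - 1) / s) * m t `^ (1 - s^-1))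
   = C * (r / t) `^ (Q%:R * (s - 1) / s) * W t * ((m t `^ s^-1 * m t `^ (1 - s^-1)) / m t).
  by ring.
rewrite -powRD; last by rewrite (gt_eqF mt) implybT.
rewrite addrCA subrr addr0 powRr1 ?(ltW mt)// mulfV ?gt_eqF// mulr1.
by rewrite ler_pM2r// ler_wpM2r ?powR_ge0// lerDl.
Qed.

(** This is [muckenhoupt_le] on the large ball for the indicator of the small
    one. *)
Lemma weight_mass_growth :
  exists2 C, 0 < C & forall r t, 0 < r -> r <= t ->
    W t <= C * (t / r) `^ (Q%:R * zeta) * W r.
Proof.
have z0 : 0 < zeta by rewrite (lt_le_trans _ zeta1).
have [C C0 HC] := muckenhoupt_le.
exists ((C + 1) `^ zeta) => [|r t r0 rt]; first by rewrite powR_gt0// ltr_wpDl.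
have t0 := lt_le_trans r0 rt.
have mr := cball_vol_gt0 r0; have mt := cball_vol_gt0 t0.
have Wt := weight_mass_gt0 t0; have Wr := weight_mass_gt0 r0.
have mB := @measurable_heis_cball0 R n.
have indE (f : H -> R) : (\int[mu]_(x in B t) (\1_(B r) x * f x)%:E = \int[mu]_(x in B r) (f x)%:E)%E.
  rewrite -{2}(setIidr (cball0_subset rt)) integral_mkcondr; apply: eq_integral => x _.
  by rewrite patchE indicE; case: ifP => _; rewrite ?mul1r ?mul0r.
have := HC t (W r / W t) (\1_(B r)) t0 _ _ _ _.
have -> : (\int[mu]_(x in B t) (\1_(B r) x)%:E = (m r)%:E)%E.
  under eq_integral do rewrite -[\1_(B r) _]mulr1.
  by rewrite (indE (fun=> 1)) integral_cball_one.
move=> H.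
have {}H : m r <= C * m t * (W r / W t) `^ zeta^-1.
  rewrite -lee_fin; apply: H => //.
  - by rewrite divr_ge0 ?ltW.
  - rewrite divfK ?gt_eqF// -weight_massE// /wmeasure -indE le_eqVlt; apply/orP; left; apply/eqP.
    apply: eq_integral => x _; rewrite indicE; case: (x \in _); rewrite ?powR1//.
    by rewrite powR0// gt_eqF.
have {}H : (r / t) ^+ Q <= C * (W r / W t) `^ zeta^-1.
  move: H; rewrite {1}(cball_vol_ratio r0 t0) mulrAC ler_pM2r//.
have {}H : ((r / t) ^+ Q) `^ zeta <= (C + 1) `^ zeta * (W r / W t).
  have h0 : 0 <= W r / W t by rewrite divr_ge0 ?ltW.
  have hE : W r / W t = ((W r / W t) `^ zeta^-1) `^ zeta by rewrite -powRrM mulVf ?gt_eqF// powRr1.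
  rewrite [in leRHS]hE -powRM ?powR_ge0 ?addr_ge0//.
  apply: ge0_ler_powR; first exact: ltW.
  - by rewrite nnegrE exprn_ge0// divr_ge0 ?ltW.
  - by rewrite nnegrE mulr_ge0 ?powR_ge0 ?addr_ge0.
  - by apply: (le_trans H); rewrite ler_wpM2r ?powR_ge0// lerDl.
have rt0 : 0 < r / t by rewrite divr_gt0.
move: H; rewrite -powR_mulrn ?(ltW rt0)// -powRrM => H.
have -> : t / r = (r / t)^-1 by rewrite invf_div.
rewrite -(powR_inv1 (ltW rt0)) -powRrM mulN1r powRN.
have p0 : 0 < (r / t) `^ (Q%:R * zeta) by exact: powR_gt0.
rewrite mulrAC ler_pdivlMr//.
by move: H; rewrite mulrA ler_pdivlMr// mulrC.
Qed.

Variables (delta lam : R).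
Hypotheses (delta_gt1 : 1 < delta) (delta_lt : delta < rw) (lam_lt0 : lam < 0).

Definition growth_factor (t : R) : R :=
  if t <= 1 then t `^ (- (Q%:R * lam * (delta - 1) / delta))
  else t `^ (- (Q%:R * zeta * lam)).

(** As [lam] is negative, what is needed is a lower bound for the mass of the
    dilated ball: [weight_mass_decay] provides it when the ball expands, that is
    for [t <= 1], and [weight_mass_growth] when it shrinks. *)
Lemma weight_mass_powR_dilation : exists2 C, 0 < C & forall r t, 0 < r -> 0 < t ->
  W (t^-1 * r) `^ lam <= C * growth_factor t * W r `^ lam.
Proof.
have key C a x y : 0 < C -> 0 < a -> 0 < x -> 0 < y -> y <= C * a * x ->
    x `^ lam <= C `^ (- lam) * a `^ (- lam) * y `^ lam.
  move=> C0 a0 x0 y0 yx.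
  rewrite -(powRM _ (ltW C0) (ltW a0)).
  have Ca : 0 < C * a by rewrite mulr_gt0.
  have h : (C * a * x) `^ lam <= y `^ lam.
    rewrite -[lam]opprK !(powRN _ (- lam)) lef_pV2 ?posrE ?powR_gt0 ?mulr_gt0//.
    apply: ge0_ler_powR => //; rewrite ?nnegrE ?oppr_ge0; first exact: ltW.
      exact: ltW.
    by rewrite ltW// mulr_gt0.
  by rewrite powRN mulrC ler_pdivlMr ?powR_gt0// mulrC -(powRM _ (ltW Ca) (ltW x0)).
have [C1 C10 H1] := weight_mass_decay delta_gt1 delta_lt.
have [C2 C20 H2] := weight_mass_growth.
exists (C1 `^ (- lam) + C2 `^ (- lam)).
  by rewrite addr_gt0 ?powR_gt0.
move=> r t r0 t0; rewrite /growth_factor.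
have tr0 : 0 < t^-1 * r by rewrite mulr_gt0 ?invr_gt0.
have Wr := weight_mass_gt0 r0; have Wtr := weight_mass_gt0 tr0.
have ratio : r / (t^-1 * r) = t by rewrite invfM invrK mulrC mulfVK// gt_eqF.
have ratio' : t^-1 * r / r = t^-1 by rewrite mulfK// gt_eqF.
case: ifPn => [t1|].
  have := H1 r (t^-1 * r) r0; rewrite ler_peMl ?(ltW r0) ?invf_ge1// => /(_ isT).
  rewrite ratio => /(key _ _ _ _ C10 (powR_gt0 _ t0) Wtr Wr) /le_trans; apply.
  rewrite -powRrM ler_wpM2r ?powR_ge0//.
  rewrite (_ : _ * - lam = - (Q%:R * lam * (delta - 1) / delta)); last by ring.
  by rewrite ler_wpM2r ?powR_ge0// lerDl powR_ge0.
rewrite -ltNge => t1.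
have := H2 (t^-1 * r) r tr0; rewrite ler_piMl ?(ltW r0) ?invf_le1 ?(ltW t1)// => /(_ isT).
rewrite ratio => /(key _ _ _ _ C20 (powR_gt0 _ t0) Wtr Wr) /le_trans; apply.
rewrite -powRrM ler_wpM2r ?powR_ge0//.
rewrite (_ : _ * - lam = - (Q%:R * zeta * lam)); last by ring.
by rewrite ler_wpM2r ?powR_ge0// lerDr powR_ge0.
Qed.

End muckenhoupt_weights.

(** * Complex-valued functions and their integrals *)

Local Notation normc := (@Normc.normc _).
Local Notation Re := (@complex.Re _).
Local Notation Im := (@complex.Im _).

Section complex_facts.
Context {R : realType}.
Implicit Types z c : R[i].

Lemma normc_ge0 z : 0 <= normc z.
Proof. by case: z => a b; exact: sqrtr_ge0. Qed.

Lemma normc_triangle z c : normc (z + c) <= normc z + normc c.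
Proof. exact: (@complex.le_normcD R z c). Qed.

Lemma normcB_triangle z1 z2 c : normc (z1 - z2) <= normc (z1 - c) + normc (c - z2).
Proof. by apply: le_trans (normc_triangle _ _); rewrite addrA subrK. Qed.

Lemma normc_opp z : normc (- z) = normc z.
Proof. exact: (@complex.normcN R z). Qed.

Lemma normc_distC z c : normc (z - c) = normc (c - z).
Proof. by rewrite -normc_opp opprB. Qed.

Lemma normc_sqrt z : normc z = Num.sqrt (Re z ^+ 2 + Im z ^+ 2).
Proof. by case: z. Qed.

Lemma Re_le_normc z : `|Re z| <= normc z.
Proof. by rewrite normc_sqrt -sqrtr_sqr ler_sqrt ?addr_ge0 ?sqr_ge0// lerDl sqr_ge0. Qed.

Lemma Im_le_normc z : `|Im z| <= normc z.
Proof. by rewrite normc_sqrt -sqrtr_sqr ler_sqrt ?addr_ge0 ?sqr_ge0// lerDr sqr_ge0. Qed.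

Lemma normc_le_ReIm z : normc z <= `|Re z| + `|Im z|.
Proof.
rewrite normc_sqrt -(@ler_pXn2r _ 2%N) ?nnegrE ?sqrtr_ge0 ?addr_ge0//.
rewrite sqr_sqrtr ?addr_ge0 ?sqr_ge0// sqrrD !real_normK ?num_real//.
by rewrite lerD2r lerDl mulrn_wge0// mulr_ge0.
Qed.

Lemma complex_ReB z c : Re (z - c) = Re z - Re c. Proof. by case: z c => ? ? [? ?]. Qed.
Lemma complex_ImB z c : Im (z - c) = Im z - Im c. Proof. by case: z c => ? ? [? ?]. Qed.
Lemma complex_ReM z c : Re (z * c) = Re z * Re c - Im z * Im c. Proof. by case: z c => ? ? [? ?]. Qed.
Lemma complex_ImM z c : Im (z * c) = Re z * Im c + Im z * Re c. Proof. by case: z c => ? ? [? ?]. Qed.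

End complex_facts.

Section complex_measurable.
Context d (T : measurableType d) (R : realType).
Implicit Types f g : T -> R[i].

Definition cborel_fun f := measurable_fun setT (Re \o f) /\ measurable_fun setT (Im \o f).

Lemma cborel_normc f : cborel_fun f -> measurable_fun setT (normc \o f).
Proof.
move=> [mr mi]; rewrite (_ : _ \o _ = fun x => (Re (f x) ^+ 2 + Im (f x) ^+ 2) `^ 2^-1).
  apply: measurable_powR_fun.
  by apply: measurable_funD; exact: measurable_funX.
by apply/funext => x /=; rewrite normc_sqrt powR12_sqrt// addr_ge0 ?sqr_ge0.
Qed.

Lemma cborelB f g : cborel_fun f -> cborel_fun g -> cborel_fun (fun x => f x - g x).
Proof.
move=> [fr fi] [gr gi]; split.
  rewrite (_ : _ \o _ = (Re \o f) \- (Re \o g)); first exact: measurable_funB.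
  by apply/funext => x /=; rewrite complex_ReB.
rewrite (_ : _ \o _ = (Im \o f) \- (Im \o g)); first exact: measurable_funB.
by apply/funext => x /=; rewrite complex_ImB.
Qed.

Lemma cborelM f g : cborel_fun f -> cborel_fun g -> cborel_fun (fun x => f x * g x).
Proof.
move=> [fr fi] [gr gi]; split.
  rewrite (_ : _ \o _ = (fun x => Re (f x) * Re (g x) - Im (f x) * Im (g x))).
    by apply: measurable_funB; exact: measurable_funM.
  by apply/funext => x /=; rewrite complex_ReM.
rewrite (_ : _ \o _ = (fun x => Re (f x) * Im (g x) + Im (f x) * Re (g x))).
  by apply: measurable_funD; exact: measurable_funM.
by apply/funext => x /=; rewrite complex_ImM.
Qed.

Lemma cborel_cst c : cborel_fun (fun=> c).
Proof. by split; exact: measurable_cst. Qed.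

Lemma cborel_real (f : T -> R) : measurable_fun setT f -> cborel_fun (fun x => (f x)%:C%C).
Proof. by move=> mf; split => //; exact: measurable_cst. Qed.

Lemma cborel_comp d' (T' : measurableType d') (h : T' -> T) f :
  cborel_fun f -> measurable_fun setT h ->
  measurable_fun setT (Re \o (f \o h)) /\ measurable_fun setT (Im \o (f \o h)).
Proof.
by move=> [fr fi] mh; split; [exact: (measurableT_comp fr mh)|exact: (measurableT_comp fi mh)].
Qed.

End complex_measurable.

Section cintegral_bounds.
Context d (T : measurableType d) (R : realType).
Variable mu : {measure set T -> \bar R}.
Implicit Types (f : T -> R[i]) (D : set T).

Lemma Rintegral_le_ge0 (g : T -> R) (h : T -> \bar R) D A :
  measurable D -> measurable_fun D g ->
  (forall x, D x -> `|g x|%:E <= h x)%E ->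
  (\int[mu]_(x in D) h x <= A%:E)%E -> `|\int[mu]_(x in D) g x| <= A.
Proof.
move=> mD mg gh hA.
have gA : (\int[mu]_(x in D) `|(g x)%:E| <= A%:E)%E.
  apply: le_trans hA; apply: le_integral_ae => [x _|x Dx|].
  - exact: abse_ge0.
  - by apply: le_trans (gh x Dx); rewrite lee_fin.
  - by apply/aeW => x Dx; exact: gh.
rewrite -lee_fin; apply: le_trans gA.
rewrite /Rintegral.
have mgE : measurable_fun D (EFin \o g) by exact/measurable_EFinP.
have h1 := le_abse_integral mu mD mgE.
apply: le_trans h1.
by case: integral => [r| |] //=; rewrite ?normr0 ?leey.
Qed.

(** The factor 2 comes from bounding the real and imaginary parts separately.
    The majorant [h] has extended values so that it may itself be an integral. *)
Lemma normc_cintegral_le f (h : T -> \bar R) D A : measurable D ->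
  measurable_fun D (Re \o f) -> measurable_fun D (Im \o f) ->
  (forall x, D x -> (normc (f x))%:E <= h x)%E ->
  (\int[mu]_(x in D) h x <= A%:E)%E ->
  normc (cintegral mu D f) <= 2 * A.
Proof.
move=> mD mr mi fh hA; apply: (le_trans (normc_le_ReIm _)) => /=.
rewrite mulr_natl mulr2n lerD//; apply: Rintegral_le_ge0 hA => // x Dx;
  apply: le_trans (fh x Dx); rewrite lee_fin; [exact: Re_le_normc|exact: Im_le_normc].
Qed.

Lemma cintegral_ae f g D : (\forall x \ae mu, D x -> f x = g x) ->
  cintegral mu D f = cintegral mu D g.
Proof.
move=> fg; rewrite /cintegral /Rintegral; congr (Complex (fine _) (fine _));
  by apply: eq_integral_ae; apply: filterS fg => x /[apply] ->.
Qed.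

End cintegral_bounds.

(** * The commutator at a fixed dilation parameter *)

Lemma tonelli_strip d1 d2 (T1 : measurableType d1) (T2 : measurableType d2) (R : realType)
    (m1 : {sigma_finite_measure set T1 -> \bar R})
    (m2 : {sigma_finite_measure set T2 -> \bar R}) (D : set T1)
    (F : T1 * T2 -> \bar R) : measurable D -> measurable_fun setT F ->
  (forall z, 0 <= F z)%E ->
  (\int[(m1 \x m2)%E]_(z in D `*` setT) F z = \int[m1]_(x in D) \int[m2]_y F (x, y))%E.
Proof.
move=> mD mF F0; rewrite integral_mkcond fubini_tonelli1; first last.
- by move=> z; rewrite erestrict_ge0.
- by apply/(measurable_restrictT _ _).1; [exact: measurableX|exact: measurable_funTS].
rewrite [RHS]integral_mkcond; apply: eq_integral => x _.
rewrite /fubini_F patchE; case: ifPn => xD.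
  apply: eq_integral => y _; rewrite patchE.
  by rewrite mem_set//; split => //; exact: set_mem.
rewrite (eq_integral (cst 0%E)) ?integral0// => y _; rewrite patchE memNset//.
by move=> [/= /mem_set]; rewrite (negbTE xD).
Qed.

Lemma powR_sum3_le (R : realType) (x y z p : R) : 0 <= x -> 0 <= y -> 0 <= z -> 0 <= p ->
  (x + y + z) `^ p <= 3 `^ p * (x `^ p + y `^ p + z `^ p).
Proof.
move=> x0 y0 z0 p0; pose M := Num.max x (Num.max y z).
have [xM yM zM] : [/\ x <= M, y <= M & z <= M] by rewrite /M !le_max !lexx !orbT.
have M0 : 0 <= M by exact: le_trans xM.
apply: (@le_trans _ _ ((3 * M) `^ p)).
  apply: ge0_ler_powR; rewrite ?nnegrE ?addr_ge0 ?mulr_ge0//.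
  by rewrite (_ : 3 * M = M + M + M); [rewrite !lerD|ring].
rewrite powRM// ler_wpM2l ?powR_ge0// /M.
by case: (leP x) => _; [case: (leP y) => _|]; rewrite ?lerDr ?lerDl ?addr_ge0 ?powR_ge0//
  -?addrA ?lerDl ?addr_ge0 ?powR_ge0// addrCA lerDl addr_ge0 ?powR_ge0.
Qed.

Section core.
Context {R : realType} {n : nat}.
Local Notation H := (heisenberg R n).
Local Notation mu := (@heis_measure R n).
Local Notation Q := (heis_Q n).
Local Notation B := (@heis_cball0 R n).
Local Notation m := (@cball_vol R n).
Variable sigma : {finite_measure set H -> \bar R}.
Hypothesis sigma_sphere : is_sphere_measure sigma.
Local Notation sS := (fine (sigma setT)).

Let sS_gt0 : 0 < sS. Proof. exact: fine_sphere_measure_gt0. Qed.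
Let mB r : measurable (B r). Proof. exact: measurable_heis_cball0. Qed.

Definition dilate_to (t : R) (z : H * H) : H := heis_dil (t^-1 * heis_norm z.1) z.2.

Lemma measurable_dilate_to t : measurable_fun setT (dilate_to t).
Proof.
pose g (z : H * H) : measurableTypeR R * H := (t^-1 * heis_norm z.1, z.2).
suff mg : measurable_fun setT g by exact: (measurableT_comp measurable_heis_dil mg).
apply/measurable_fun_pairP; split; last exact: measurable_snd.
apply: measurable_funM => //.
exact: (measurableT_comp measurable_heis_norm measurable_fst).
Qed.

(** When [y] has norm 1, the point [dilate_to t (x, y)] lies in [B (t^-1 * r)]
    exactly when [x] lies in [B r]. *)
Lemma dilation_average_cball t r (G : H -> \bar R) : 0 < t ->
  measurable_fun setT G -> (forall x, 0 <= G x)%E ->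
  (\int[mu]_(x in B r) \int[sigma]_y G (dilate_to t (x, y)) =
   (sS * t ^+ Q)%:E * \int[mu]_(z in B (t^-1 * r)) G z)%E.
Proof.
move=> t0 mG G0; have t10 : 0 < t^-1 by rewrite invr_gt0.
have mG' : measurable_fun setT (G \_ (B (t^-1 * r))).
  by apply/(measurable_restrictT _ _).1; [exact: mB|exact: measurable_funTS].
have G'0 x : (0 <= (G \_ (B (t^-1 * r))) x)%E by rewrite erestrict_ge0.
have := dilation_average sigma_sphere t10 mG' G'0.
rewrite -integral_mkcond invrK (sphere_measure_fineK sigma) -EFinM => <-.
rewrite integral_mkcond; apply: eq_integral => x _; rewrite patchE.
have BE y : heis_norm y = 1 ->
    (dilate_to t (x, y) \in B (t^-1 * r)) = (x \in B r).
  move=> y1; apply/idP/idP; rewrite !inE /heis_cball0/= /dilate_to/=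
    heis_norm_dil ?mulr_ge0 ?(ltW t10) ?heis_norm_ge0// y1 mulr1 ler_pM2l//.
case: ifPn => xB; last first.
  rewrite (eq_integral_ae (g := cst 0%E)) ?integral0//.
  apply: filterS (sphere_ae_norm sigma_sphere) => y y1 _.
  by rewrite patchE (BE y y1) (negbTE xB).
apply: eq_integral_ae; apply: filterS (sphere_ae_norm sigma_sphere) => y y1 _.
by rewrite patchE (BE y y1) xB.
Qed.

Lemma cball_vol_dil t r : 0 < t -> t ^+ Q * m (t^-1 * r) = m r.
Proof.
move=> t0; have tQ : t ^+ Q != 0 by rewrite expf_neq0// gt_eqF.
by rewrite /cball_vol exprMn exprVn mulrCA (mulrA (t ^+ Q)) mulfV// mul1r.
Qed.

(** The factor [t ^+ Q] is the ratio of the volumes of [B r] and [B (t^-1 * r)],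
    so that bounds on means are carried over with the mass of the sphere as only
    loss. *)
Lemma dilation_cball_le t r (G : H -> R) A : 0 < t ->
  measurable_fun setT G -> (forall x, 0 <= G x) ->
  (\int[mu]_(z in B (t^-1 * r)) (G z)%:E <= (m (t^-1 * r) * A)%:E)%E ->
  (\int[mu]_(x in B r) \int[sigma]_y (G (dilate_to t (x, y)))%:E <=
   (m r * (sS * A))%:E)%E.
Proof.
move=> t0 mG G0 h.
rewrite (@dilation_average_cball t r (EFin \o G))//; last first.
  exact/measurable_EFinP.
apply: (@le_trans _ _ ((sS * t ^+ Q)%:E * (m (t^-1 * r) * A)%:E)%E).
  apply: lee_wpmul2l => //; rewrite lee_fin mulr_ge0 ?(ltW sS_gt0)//.
  by rewrite exprn_ge0// ltW.
by rewrite -EFinM lee_fin -(cball_vol_dil r t0) le_eqVlt; apply/orP; left; apply/eqP; ring.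
Qed.

Lemma sphere_cst_le r (G : H -> R) A : (forall x, 0 <= G x) -> measurable_fun setT G ->
  (\int[mu]_(x in B r) (G x)%:E <= (m r * A)%:E)%E ->
  (\int[mu]_(x in B r) \int[sigma]_y (G x)%:E <= (m r * (sS * A))%:E)%E.
Proof.
move=> G0 mG h.
rewrite (eq_integral (fun x => sS%:E * (G x)%:E)%E); last first.
  move=> x _; rewrite -(sphere_measure_fineK sigma) muleC.
  exact: (integral_cst sigma measurableT (G x)%:E).
rewrite ge0_integralZl; [|exact: mB| |by move=> x _; rewrite lee_fin|by rewrite lee_fin ltW].
  rewrite mulrCA EFinM; apply: lee_wpmul2l => //; rewrite lee_fin ltW//.
by apply/measurable_funTS/measurable_EFinP.
Qed.

Variable w : H -> R.
Hypothesis mw : measurable_fun setT w.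
Hypothesis w0 : forall x, 0 <= w x.
Variables (zeta rw : R).
Hypothesis zeta1 : 1 <= zeta.
Hypothesis w_A : muckenhoupt zeta w.
Hypothesis rwE : critical_index w = rw%:E.
Local Notation W := (weight_mass w).
Let W_gt0 r : 0 < r -> 0 < W r.
Proof. exact: (weight_mass_gt0 sigma_sphere mw w0 zeta1 w_A rwE). Qed.
Let m_gt0 r : 0 < r -> 0 < m r.
Proof. exact: (cball_vol_gt0 sigma_sphere). Qed.
Let z0 : 0 < zeta. Proof. by rewrite (lt_le_trans _ zeta1). Qed.

Variables (q q1 r1 : R).
Hypotheses (q_ge1 : 1 <= q) (q1_ge1 : 1 <= q1) (r1_ge1 : 1 <= r1).
Hypothesis rw1 : 1 < rw.
Hypothesis q_index : 1 / q > (1 / q1 + 1 / r1) * zeta * (rw / (rw - 1)).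
Let q0 : 0 < q. Proof. by rewrite (lt_le_trans _ q_ge1). Qed.
Let q10 : 0 < q1. Proof. by rewrite (lt_le_trans _ q1_ge1). Qed.
Let r10 : 0 < r1. Proof. by rewrite (lt_le_trans _ r1_ge1). Qed.

(** Hölder's inequality with the three exponents [th], [eta] and [ka]. The
    hypothesis on [q] says precisely that [ka > rw^-1]: the power [ka^-1] of the
    weight lies below the critical index and its mean is controlled by the
    reverse Hölder inequality. *)
Lemma mixed_hoelder : exists2 C, 0 <= C & forall r (u v : H * H -> R) a b,
  0 < r -> 0 <= a -> 0 <= b ->
  measurable_fun setT u -> measurable_fun setT v ->
  (forall z, 0 <= u z) -> (forall z, 0 <= v z) ->
  (\int[mu]_(x in B r) \int[sigma]_y (u (x, y) `^ (r1 / zeta))%:E <=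
     (m r * a `^ (r1 / zeta))%:E)%E ->
  (\int[mu]_(x in B r) \int[sigma]_y (v (x, y) `^ (q1 / zeta))%:E <=
     (m r * b `^ (q1 / zeta))%:E)%E ->
  (\int[mu]_(x in B r) \int[sigma]_y (u (x, y) `^ q * v (x, y) `^ q * w x)%:E <=
     (C * (a * b) `^ q * W r)%:E)%E.
Proof.
pose th := q / (r1 / zeta); pose eta := q / (q1 / zeta).
have th0 : 0 < th by rewrite !divr_gt0.
have eta0 : 0 < eta by rewrite !divr_gt0.
pose ka := 1 - th - eta; pose s := ka^-1.
have rwi : rw / (rw - 1) > 0 by rewrite divr_gt0 ?subr_gt0// (lt_trans _ rw1).
have rw0 : 0 < rw by rewrite (lt_trans _ rw1).
have kaE : rw^-1 < ka.
  rewrite /ka -addrA -opprD ltrBrDl -ltrBrDr.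
  have -> : th + eta = q * ((1 / q1 + 1 / r1) * zeta).
    by rewrite /th /eta; field; rewrite !gt_eqF.
  have -> : 1 - rw^-1 = (rw / (rw - 1))^-1 by field; rewrite !gt_eqF ?subr_gt0.
  move: q_index; rewrite -ltr_pdivlMr// => h.
  by rewrite -ltr_pdivlMl//; apply: (lt_le_trans h); rewrite div1r.
have ka0 : 0 < ka by apply: lt_trans kaE; rewrite invr_gt0.
have s1 : 1 < s by rewrite /s invf_gt1// /ka -addrA -opprD gtrBl addr_gt0.
have srw : s < rw by rewrite /s -[ltRHS]invrK ltf_pV2 ?posrE// invr_gt0.
have s0 : 0 < s by rewrite (lt_trans _ s1).
have sumE : th + eta + ka = 1 by rewrite /ka; ring.
have [C C0 HC] := reverse_hoelder_le sigma_sphere mw w0 zeta1 w_A rwE s1 srw.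
exists (sS `^ ka * C); first by rewrite mulr_ge0 ?powR_ge0.
move=> r u v a b r0 a0 b0 mu_ mv u0 v0 ua vb.
have mr := m_gt0 r0; have Wr := W_gt0 r0.
have mD : measurable (B r `*` [set: H]) by exact: measurableX.
have mwf : measurable_fun setT (fun z : H * H => w z.1).
  exact: (measurableT_comp mw measurable_fst).
have tonE (F : H * H -> R) : measurable_fun setT F -> (forall z, 0 <= F z) ->
    (\int[(mu \x sigma)%E]_(z in B r `*` setT) (F z)%:E =
     \int[mu]_(x in B r) \int[sigma]_y (F (x, y))%:E)%E.
  move=> mF F0; apply: (@tonelli_strip _ _ _ _ _ mu sigma (B r) (EFin \o F)) => //.
  exact/measurable_EFinP.
have ws : (\int[mu]_(x in B r) \int[sigma]_y (w x `^ s)%:E <=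
    (m r * (sS * (C * (W r / m r)) `^ s))%:E)%E.
  apply: (@sphere_cst_le r (fun x => w x `^ s)) => [x||]; first exact: powR_ge0.
    exact: measurable_powR_fun.
  exact: HC.
rewrite -(tonE (fun z => u z `^ (r1 / zeta))) in ua; [|exact: measurable_powR_fun|by move=> z; exact: powR_ge0].
rewrite -(tonE (fun z => v z `^ (q1 / zeta))) in vb; [|exact: measurable_powR_fun|by move=> z; exact: powR_ge0].
rewrite -(tonE (fun z => w z.1 `^ s)) in ws; [|exact: measurable_powR_fun|by move=> z; exact: powR_ge0].
rewrite -(tonE (fun z => u z `^ q * v z `^ q * w z.1)); first last.
- by move=> z; rewrite !mulr_ge0 ?powR_ge0.
- by apply: measurable_funM => //; apply: measurable_funM; exact: measurable_powR_fun.
have := hoelder3_le mD (measurable_powR_fun (r1 / zeta) mu_) (measurable_powR_fun (q1 / zeta) mv)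
  (measurable_powR_fun s mwf) (fun z => powR_ge0 _ _) (fun z => powR_ge0 _ _) (fun z => powR_ge0 _ _)
  (ltW th0) eta0 (ltW ka0) sumE ua vb ws.
have powE x c : 0 < c -> (x `^ c) `^ (q / c) = x `^ q.
  by move=> c0; rewrite -powRrM mulrCA mulfV ?mulr1// gt_eqF.
have powsE x : 0 <= x -> (x `^ s) `^ ka = x.
  by move=> x0; rewrite -powRrM mulVf ?gt_eqF// powRr1.
rewrite (eq_integral (fun z => (u z `^ q * v z `^ q * w z.1)%:E)); last first.
  by move=> z _; rewrite !powE ?divr_gt0// powsE.
move=> /le_trans; apply; rewrite lee_fin.
have CW0 : 0 <= C * (W r / m r) by rewrite mulr_ge0// divr_ge0 ?ltW.
rewrite !(powRM _ (ltW mr)) ?mulr_ge0 ?powR_ge0 ?(ltW sS_gt0)//.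
rewrite (powRM _ (ltW sS_gt0)) ?powR_ge0// !powE ?divr_gt0// powsE// (powRM _ a0 b0).
have mE : m r `^ th * m r `^ eta * m r `^ ka = m r.
  rewrite -!powRD ?(gt_eqF mr) ?implybT// sumE powRr1 ?ltW//.
rewrite [leLHS](_ : _ = (m r `^ th * m r `^ eta * m r `^ ka / m r) *
    (sS `^ ka * C * (a `^ q * b `^ q) * W r)); last by rewrite /th /eta; ring.
by rewrite mE mulfV ?gt_eqF// mul1r.
Qed.

Lemma muckenhoupt_powR_le p : 0 < p -> exists2 K, 0 <= K & forall r A (g : H -> R),
  0 < r -> 0 <= A -> measurable_fun setT g -> (forall x, 0 <= g x) ->
  (\int[mu]_(x in B r) (g x `^ p * w x)%:E <= (A `^ p * W r)%:E)%E ->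
  (\int[mu]_(x in B r) (g x `^ (p / zeta))%:E <= (m r * (K * A) `^ (p / zeta))%:E)%E.
Proof.
move=> p0; have [C C0 HC] := muckenhoupt_le sigma_sphere mw w0 zeta1 w_A rwE.
exists (C `^ (zeta / p)); first exact: powR_ge0.
move=> r A g r0 A0 mg g0 h.
have := HC r (A `^ p) (fun x => g x `^ (p / zeta)) r0 (powR_ge0 _ _)
  (measurable_powR_fun _ mg) (fun x => powR_ge0 _ _).
rewrite (eq_integral (fun x => (g x `^ p * w x)%:E)); last first.
  by move=> x _; rewrite -powRrM divfK// gt_eqF.
move=> /(_ h) /le_trans; apply; rewrite lee_fin powRM ?powR_ge0//.
rewrite -!powRrM (_ : zeta / p * (p / zeta) = 1); last by field; rewrite !gt_eqF.
by rewrite powRr1// mulrAC mulrC mulrA.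
Qed.

Variables (delta lam : R).
Hypotheses (delta_gt1 : 1 < delta) (delta_lt : delta < rw) (lam_lt0 : lam < 0).
Local Notation rho0 := (growth_factor (n := n) zeta delta lam).

Lemma growth_factor_gt0 t : 0 < t -> 0 < rho0 t.
Proof. by move=> t0; rewrite /growth_factor; case: ifP => _; exact: powR_gt0. Qed.

Definition morrey_bound (g : H -> R) (F : R) := forall r, 0 < r ->
  (\int[mu]_(x in B r) (g x `^ q1 * w x)%:E <= (F `^ q1 * W r `^ (1 + lam * q1))%:E)%E.

(** The points [dilate_to t (x, y)] fill the ball [B (t^-1 * r)], where the
    Morrey bound gives a mean of size [F * W (t^-1 * r) ^ lam]; the growth
    factor brings it back to the ball [B r]. *)
Lemma morrey_dilation_le : exists2 K, 0 <= K & forall r t F (g : H -> R),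
  0 < r -> 0 < t -> 0 <= F -> measurable_fun setT g -> (forall x, 0 <= g x) ->
  morrey_bound g F ->
  (\int[mu]_(x in B r) \int[sigma]_y (g (dilate_to t (x, y)) `^ (q1 / zeta))%:E <=
   (m r * (K * (F * rho0 t * W r `^ lam)) `^ (q1 / zeta))%:E)%E.
Proof.
have [K K0 HK] := muckenhoupt_powR_le q10.
have [C C0 HC] := weight_mass_powR_dilation sigma_sphere mw w0 zeta1 w_A rwE delta_gt1 delta_lt lam_lt0.
have b0 : 0 < q1 / zeta by rewrite divr_gt0.
exists (sS `^ (zeta / q1) * K * C).
  by rewrite !mulr_ge0 ?powR_ge0// ltW.
move=> r t F g r0 t0 F0 mg g0 gF.
have tr0 : 0 < t^-1 * r by rewrite mulr_gt0 ?invr_gt0.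
have Wtr := W_gt0 tr0; have Wr := W_gt0 r0.
have FW0 : 0 <= F * W (t^-1 * r) `^ lam by rewrite mulr_ge0 ?powR_ge0.
have := HK _ _ g tr0 FW0 mg g0.
have -> : (F * W (t^-1 * r) `^ lam) `^ q1 * W (t^-1 * r) = F `^ q1 * W (t^-1 * r) `^ (1 + lam * q1).
  rewrite (powRM _ F0 (powR_ge0 _ _)) -powRrM -mulrA; congr (_ * _).
  by rewrite -[X in _ * X](powRr1 (ltW Wtr)) -powRD ?(gt_eqF Wtr) ?implybT// addrC.
move=> /(_ (gF _ tr0)) h.
have := dilation_cball_le (r := r) t0 (measurable_powR_fun _ mg) (fun x => powR_ge0 _ _) h.
move=> /le_trans; apply; rewrite lee_fin ler_pM2l ?m_gt0//.
have sE : sS = (sS `^ (zeta / q1)) `^ (q1 / zeta).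
  rewrite -powRrM (_ : zeta / q1 * (q1 / zeta) = 1) ?powRr1// ?ltW//.
  by field; rewrite !gt_eqF.
rewrite [X in X * _ <= _]sE -powRM ?powR_ge0 ?mulr_ge0 ?powR_ge0//.
apply: ge0_ler_powR; first exact: ltW.
- by rewrite nnegrE !mulr_ge0 ?powR_ge0.
- by rewrite nnegrE !mulr_ge0 ?powR_ge0// ltW// growth_factor_gt0.
rewrite -!mulrA ler_wpM2l ?powR_ge0// ler_wpM2l//.
rewrite mulrCA ler_wpM2l//.
by rewrite mulrA; exact: HC.
Qed.

Hypothesis zeta_le : zeta <= r1.
Variable b : H -> R[i].
Hypothesis mb : cborel_fun b.
Variable M : R.
Hypothesis M0 : 0 <= M.
Local Notation bm := (cball0_mean b).
Hypothesis b_osc : forall r, 0 < r ->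
  (\int[mu]_(x in B r) (normc (b x - bm r) `^ r1 * w x)%:E <= (M `^ r1 * W r)%:E)%E.

Let mb_normc c : measurable_fun setT (fun x => normc (b x - c)).
Proof. exact: (cborel_normc (cborelB mb (cborel_cst _ c))). Qed.

Lemma cball0_mean_sub r c A : 0 < r ->
  (\int[mu]_(x in B r) (normc (b x - c))%:E <= A%:E)%E ->
  normc (bm r - c) <= (m r)^-1 * (2 * A).
Proof.
move=> r0 hA; have mr := m_gt0 r0.
have volE : mu (B r) = (m r)%:E by exact: (cball_volE sigma_sphere).
have [mRe mIm] := cborelB mb (cborel_cst _ c).
have int_cst (k : R) : mu.-integrable (B r) (EFin \o cst k).
  have volfin : (mu (B r) < +oo)%E by rewrite volE ltry.
  by apply: (measurable_bounded_integrable (mB r) volfin) => //; exact: bounded_cst.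
have part (P : R[i] -> R) : (forall z1 z2, P (z1 - z2) = P z1 - P z2) ->
    measurable_fun setT (P \o b) -> (forall z, `|P z| <= normc z) ->
    (m r)^-1 * (\int[mu]_(x in B r) P (b x)) - P c =
    (m r)^-1 * (\int[mu]_(x in B r) P (b x - c)).
  move=> PB mP Ple.
  have mPc : measurable_fun setT (fun x => P (b x - c)).
    rewrite (_ : (fun _ => _) = (P \o b) \- cst (P c)); last by apply/funext => x /=; rewrite PB.
    exact: measurable_funB.
  have ic : mu.-integrable (B r) (EFin \o (fun x => P (b x - c))).
    apply/integrableP; split; first exact/measurable_funTS/measurable_EFinP.
    apply: le_lt_trans (ltry A); apply: le_trans hA; apply: le_integral_ae => [x _|x _|].
    - exact: abse_ge0.
    - by rewrite lee_fin normc_ge0.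
    - by apply/aeW => x _ /=; rewrite lee_fin Ple.
  have ib : mu.-integrable (B r) (EFin \o (P \o b)).
    have := integrableD (mB r) ic (int_cst (P c)).
    apply: eq_integrable => // x _ /=.
    by rewrite -EFinD PB subrK.
  rewrite [in RHS](eq_Rintegral _ (g := (P \o b) \- cst (P c))); last first.
    by move=> x _ /=; rewrite PB.
  rewrite (RintegralB (mB r) ib (int_cst _)).
  have -> : \int[mu]_(x in B r) cst (P c) x = P c * m r.
    by rewrite Rintegral_cst//; congr (_ * _); rewrite -[RHS]/(fine (m r)%:E) -volE.
  by rewrite mulrBr mulrCA mulVf ?mulr1// gt_eqF.
have bmE : bm r - c = ((m r)^-1)%:C%C * cintegral mu (B r) (fun x => b x - c).
  rewrite /cball0_mean volE -[fine _]/(m r).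
  apply/eqP; rewrite eq_complex; apply/andP; split; apply/eqP.
    rewrite complex_ReB !complex_ReM /= !mul0r !subr0; apply: part => //; [exact: complex_ReB|by case: mb|exact: Re_le_normc].
  rewrite complex_ImB !complex_ImM /= !mul0r !addr0; apply: part => //; [exact: complex_ImB|by case: mb|exact: Im_le_normc].
rewrite bmE Normc.normcM.
have -> : normc ((m r)^-1)%:C%C = (m r)^-1.
  by rewrite /= expr0n/= addr0 sqrtr_sqr ger0_norm// invr_ge0 ltW.
rewrite ler_wpM2l ?invr_ge0 ?(ltW mr)//.
by apply: (normc_cintegral_le (mB r) _ _ (fun x _ => lexx _) hA); exact: measurable_funTS.
Qed.

Let al := r1 / zeta.
Let al1 : 1 <= al. Proof. by rewrite ler_pdivlMr// mul1r. Qed.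
Let al0 : 0 < al. Proof. exact: lt_le_trans al1. Qed.

(** The Muckenhoupt condition trades the weighted exponent [r1] for the
    unweighted exponent [al = r1 / zeta]. *)
Lemma oscillation_le : exists2 k, 0 <= k & forall r, 0 < r ->
  (\int[mu]_(x in B r) (normc (b x - bm r) `^ al)%:E <= (m r * k `^ al)%:E)%E.
Proof.
have [K K0 HK] := muckenhoupt_powR_le r10.
exists (K * M); first exact: mulr_ge0.
move=> r r0; apply: (HK r M (fun x => normc (b x - bm r)) r0 M0) => //.
  by move=> x; exact: normc_ge0.
exact: b_osc.
Qed.

(** Both means are compared on the smaller ball, at the cost of the ratio of the
    volumes. *)
Lemma mean_oscillation_le k : 0 <= k -> (forall r, 0 < r ->
  (\int[mu]_(x in B r) (normc (b x - bm r) `^ al)%:E <= (m r * k `^ al)%:E)%E) ->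
  forall r s, 0 < r -> r <= s -> normc (bm r - bm s) <= 2 * (s / r) ^+ Q * k.
Proof.
move=> k0 Hk r s r0 rs; have s0 := lt_le_trans r0 rs.
have mr := m_gt0 r0; have ms := m_gt0 s0.
have ints : (\int[mu]_(x in B s) (normc (b x - bm s))%:E <= (m s * k)%:E)%E.
  have th1 : al^-1 + (1 - al^-1) = 1 by rewrite addrCA subrr addr0.
  have ai0 : 0 <= al^-1 by rewrite invr_ge0 ltW.
  have e0 : 0 <= 1 - al^-1 by rewrite subr_ge0 invf_le1.
  have m1 : measurable_fun setT (fun _ : H => 1 : R) by exact: measurable_cst.
  have one : (\int[mu]_(x in B s) (1%R)%:E <= (m s)%:E)%E.
    by rewrite (integral_cball_one sigma_sphere).
  have := hoelder_le (mB s) (measurable_powR_fun al (mb_normc (bm s)))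
    m1 (fun x => powR_ge0 _ _) (fun=> ler01) ai0 e0 th1 (Hk s s0) one.
  rewrite (eq_integral (fun x => (normc (b x - bm s))%:E)); last first.
    by move=> x _; rewrite powR1 mulr1 -powRrM mulfV ?gt_eqF// powRr1// normc_ge0.
  move=> /le_trans; apply; rewrite lee_fin powRM ?powR_ge0 ?(ltW ms)//.
  rewrite -powRrM mulfV ?gt_eqF// powRr1// mulrAC -powRD ?(gt_eqF ms) ?implybT//.
  by rewrite th1 powRr1 ?lexx ?(ltW ms).
have intr : (\int[mu]_(x in B r) (normc (b x - bm s))%:E <= (m s * k)%:E)%E.
  apply: le_trans ints; apply: ge0_subset_integral; [exact: mB|exact: mB| | |exact: cball0_subset].
    exact/measurable_funTS/measurable_EFinP.
  by move=> x _; rewrite lee_fin normc_ge0.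
apply: (le_trans (cball0_mean_sub r0 intr)).
rewrite (cball_vol_ratio s0 r0) le_eqVlt; apply/orP; left; apply/eqP.
by field; rewrite !gt_eqF.
Qed.

Lemma PsiE t : 0 < t -> @Psi R n t = if t <= 1 then t ^- Q else t ^+ Q.
Proof.
move=> t0; rewrite /Psi !indicE.
have -> : (t \in (`]0, 1]%classic : set R)) = (t <= 1).
  by apply/idP/idP; rewrite inE/= in_itv/= t0.
have -> : (t \in (`]1, +oo[%classic : set R)) = ~~ (t <= 1).
  by rewrite -ltNge; apply/idP/idP; rewrite inE/= in_itv/= andbT.
by case: ifP => _; rewrite !(mulr0, mulr1, addr0, add0r).
Qed.

Lemma Psi_ge0 t : 0 < t -> 0 <= @Psi R n t.
Proof. by move=> t0; rewrite PsiE//; case: ifP => _; rewrite ?invr_ge0 exprn_ge0// ltW. Qed.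

(** [Psi t] is the ratio of the volumes of the larger and of the smaller of the
    balls [B r] and [B (t^-1 * r)]. *)
Lemma mean_dilation_le k : 0 <= k -> (forall r, 0 < r ->
  (\int[mu]_(x in B r) (normc (b x - bm r) `^ al)%:E <= (m r * k `^ al)%:E)%E) ->
  forall r t, 0 < r -> 0 < t -> normc (bm r - bm (t^-1 * r)) <= 2 * @Psi R n t * k.
Proof.
move=> k0 Hk r t r0 t0; have tr0 : 0 < t^-1 * r by rewrite mulr_gt0 ?invr_gt0.
have md := mean_oscillation_le k0 Hk.
rewrite PsiE//; case: ifPn => [t1|].
  have := md r (t^-1 * r) r0; rewrite mulfK ?gt_eqF// exprVn; apply.
  by rewrite ler_peMl ?(ltW r0)// invf_ge1.
rewrite -ltNge => t1; rewrite normc_distC.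
have ratio : r / (t^-1 * r) = t by rewrite invfM invrK mulrC mulfVK// gt_eqF.
have := md (t^-1 * r) r tr0; rewrite ratio; apply.
by rewrite ler_piMl ?(ltW r0)// invf_le1// ltW.
Qed.

Let F_meas (F : H -> R[i]) t : cborel_fun F -> cborel_fun (fun z : H * H => F (dilate_to t z)).
Proof. by move=> mF; exact: cborel_comp mF (measurable_dilate_to t). Qed.

Lemma measurable_normc_diff t : measurable_fun setT
  (fun z : H * H => normc (b z.1 - b (dilate_to t z))).
Proof.
apply: (cborel_normc (cborelB _ (F_meas t mb))).
exact: cborel_comp mb measurable_fst.
Qed.

(** The difference of the values of [b] is split at the means of [b] over [B r],
    where [x] lies, and over [B (t^-1 * r)], where the dilated point lies: two
    oscillations, whence the summand 2, and a difference of means, whence [Psi]. *)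
Lemma difference_dilation_le : exists2 K, 0 <= K & forall r t, 0 < r -> 0 < t ->
  (\int[mu]_(x in B r) \int[sigma]_y (normc (b x - b (dilate_to t (x, y))) `^ al)%:E <=
   (m r * (K * (2 + @Psi R n t)) `^ al)%:E)%E.
Proof.
have [k k0 Hk] := oscillation_le.
(* 3 ^ al from [powR_sum3_le], 3 for the three integrals over the sphere *)
exists ((3 `^ al * sS * 3) `^ al^-1 * (2 * k)); first by rewrite !mulr_ge0 ?powR_ge0.
move=> r t r0 t0; have tr0 : 0 < t^-1 * r by rewrite mulr_gt0 ?invr_gt0.
have P0 := Psi_ge0 t0; have mr := m_gt0 r0.
pose X (z : H * H) := normc (b z.1 - bm r) `^ al.
pose Y := normc (bm r - bm (t^-1 * r)) `^ al.
pose Z (z : H * H) := normc (b (dilate_to t z) - bm (t^-1 * r)) `^ al.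
have mX : measurable_fun setT X.
  apply: measurable_powR_fun; exact: (measurableT_comp (mb_normc (bm r)) measurable_fst).
have mZ : measurable_fun setT Z.
  by apply: measurable_powR_fun; apply: (measurableT_comp (mb_normc _)); exact: measurable_dilate_to.
have tonE (F : H * H -> R) : measurable_fun setT F -> (forall z, 0 <= F z) ->
    (\int[(mu \x sigma)%E]_(z in B r `*` setT) (F z)%:E =
     \int[mu]_(x in B r) \int[sigma]_y (F (x, y))%:E)%E.
  move=> mF F0; apply: (@tonelli_strip _ _ _ _ _ mu sigma (B r) (EFin \o F)) => //.
  exact/measurable_EFinP.
have mD : measurable (B r `*` [set: H]) by exact: measurableX.
have Xle : (\int[(mu \x sigma)%E]_(z in B r `*` setT) (X z)%:E <= (m r * (sS * k `^ al))%:E)%E.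
  rewrite tonE//; last by move=> z; exact: powR_ge0.
  apply: (@sphere_cst_le r (fun x => normc (b x - bm r) `^ al)); [|exact: measurable_powR_fun|exact: Hk].
  by move=> x; exact: powR_ge0.
have Yle : (\int[(mu \x sigma)%E]_(z in B r `*` setT) Y%:E <= (m r * (sS * Y))%:E)%E.
  rewrite (tonE (fun=> Y))//; last by move=> z; exact: powR_ge0.
  apply: (@sphere_cst_le r (fun=> Y)) => //; first by move=> x; exact: powR_ge0.
  have -> : (\int[mu]_(x in B r) Y%:E = Y%:E * mu (B r))%E by exact: integral_cst.
  by rewrite (cball_volE sigma_sphere r0) -EFinM mulrC.
have Zle : (\int[(mu \x sigma)%E]_(z in B r `*` setT) (Z z)%:E <= (m r * (sS * k `^ al))%:E)%E.
  rewrite tonE//; last by move=> z; exact: powR_ge0.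
  apply: (@dilation_cball_le t r (fun x => normc (b x - bm (t^-1 * r)) `^ al)).
  - exact: t0.
  - exact: measurable_powR_fun.
  - by move=> x; exact: powR_ge0.
  - exact: Hk.
have mU := measurable_powR_fun al (measurable_normc_diff t).
rewrite -(tonE (fun z => normc (b z.1 - b (dilate_to t z)) `^ al))//; last first.
  by move=> z; exact: powR_ge0.
apply: (@le_trans _ _ (\int[(mu \x sigma)%E]_(z in B r `*` setT)
    ((3 `^ al)%:E * ((X z)%:E + Y%:E + (Z z)%:E)))%E).
  apply: le_integral_ae.
  - by move=> z _; rewrite lee_fin powR_ge0.
  - by move=> z _; rewrite -!EFinD -EFinM lee_fin mulr_ge0 ?addr_ge0 ?powR_ge0.
  apply/aeW => z _; rewrite -!EFinD -EFinM lee_fin.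
  apply: le_trans (powR_sum3_le _ _ _ (ltW al0)); try exact: normc_ge0.
  apply: ge0_ler_powR; rewrite ?nnegrE ?addr_ge0 ?normc_ge0 ?(ltW al0)//.
  apply: (le_trans (normcB_triangle _ _ (bm r))); rewrite -addrA lerD2l.
  apply: (le_trans (normcB_triangle _ _ (bm (t^-1 * r)))); rewrite lerD2l.
  by rewrite normc_distC.
have mXE : measurable_fun (B r `*` [set: H]) (EFin \o X).
  apply: measurable_funTS; apply/measurable_EFinP; exact: mX.
have mZE : measurable_fun (B r `*` [set: H]) (EFin \o Z).
  apply: measurable_funTS; apply/measurable_EFinP; exact: mZ.
have X0 z : (0 <= (X z)%:E)%E by rewrite lee_fin powR_ge0.
have Z0 z : (0 <= (Z z)%:E)%E by rewrite lee_fin powR_ge0.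
have Y0 : (0 <= Y%:E)%E by rewrite lee_fin powR_ge0.
have mYE : measurable_fun (B r `*` [set: H]) (fun=> Y%:E) by exact: measurable_cst.
have XY0 z : (0 <= (X z)%:E + Y%:E)%E by exact: adde_ge0.
have mXYE := emeasurable_funD mXE mYE.
have XYZ0 z : (B r `*` [set: H]) z -> (0 <= (X z)%:E + Y%:E + (Z z)%:E)%E.
  by move=> _; apply: adde_ge0; [exact: XY0|exact: Z0].
have c0 : (0 <= (3 `^ al)%:E)%E by rewrite lee_fin powR_ge0.
rewrite (ge0_integralZl (mu \x sigma)%E mD (emeasurable_funD mXYE mZE) XYZ0 c0).
rewrite ge0_integralD; [|exact: mD|by move=> z _; exact: XY0|exact: mXYE|
  by move=> z _; exact: Z0|exact: mZE].
rewrite ge0_integralD; [|exact: mD|by move=> z _; exact: X0|exact: mXE|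
  by move=> z _; exact: Y0|exact: mYE].
apply: (@le_trans _ _ ((3 `^ al)%:E * ((m r * (sS * k `^ al))%:E + (m r * (sS * Y))%:E + (m r * (sS * k `^ al))%:E))%E).
  by apply: lee_wpmul2l; [exact: c0|exact: (leeD (leeD Xle Yle) Zle)].
rewrite -!EFinD -EFinM lee_fin.
pose J := (2 * k * (2 + @Psi R n t)) `^ al.
have J0 : 0 <= J by exact: powR_ge0.
have P20 : 0 <= 2 + @Psi R n t by rewrite addr_ge0.
have k20 : 0 <= 2 * k by rewrite mulr_ge0.
have big0 : 0 <= 2 * k * (2 + @Psi R n t) by rewrite mulr_ge0.
have kJ : k `^ al <= J.
  apply: ge0_ler_powR; rewrite ?nnegrE ?(ltW al0)//.
  have kP : 0 <= k * @Psi R n t by exact: mulr_ge0.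
  by rewrite (_ : 2 * k * _ = k + (3 * k + 2 * (k * @Psi R n t))); [rewrite lerDl addr_ge0 ?mulr_ge0|ring].
have YJ : Y <= J.
  apply: ge0_ler_powR; rewrite ?nnegrE ?normc_ge0 ?(ltW al0)//.
  apply: (le_trans (mean_dilation_le k0 Hk r0 t0)).
  by rewrite mulrAC ler_wpM2l ?mulr_ge0// lerDr.
have -> : ((3 `^ al * sS * 3) `^ al^-1 * (2 * k) * (2 + @Psi R n t)) `^ al = 3 `^ al * sS * 3 * J.
  have S0 : 0 <= 3 `^ al * sS * 3 by rewrite !mulr_ge0 ?powR_ge0// ltW.
  rewrite -mulrA (powRM _ (powR_ge0 _ _) big0).
  by rewrite -powRrM mulVf ?gt_eqF// powRr1.
have -> : 3 `^ al * sS * 3 * J = 3 `^ al * (sS * (J + J + J)) by ring.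
apply: (@le_trans _ _ (m r * (3 `^ al * (sS * (k `^ al + Y + k `^ al))))).
  by rewrite le_eqVlt; apply/orP; left; apply/eqP; ring.
apply: ler_wpM2l; first exact: ltW.
apply: ler_wpM2l; first exact: powR_ge0.
apply: ler_wpM2l; first exact: ltW.
by rewrite !lerD.
Qed.

(** The weighted [L^q] size on [B r] of the integrand of the commutator at a
    fixed [t]. Its dependence on [t] is the one that [C9] integrates. *)
Lemma commutator_slice_le : exists2 C, 0 <= C & forall r t F (g : H -> R),
  0 < r -> 0 < t -> 0 <= F -> measurable_fun setT g -> (forall x, 0 <= g x) ->
  morrey_bound g F ->
  (\int[mu]_(x in B r) \int[sigma]_y
     (normc (b x - b (dilate_to t (x, y))) `^ q * g (dilate_to t (x, y)) `^ q * w x)%:E <=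
   (C * (F * (rho0 t * (2 + @Psi R n t))) `^ q * W r `^ (1 + lam * q))%:E)%E.
Proof.
have [C C0 HC] := mixed_hoelder; have [K K0 HK] := morrey_dilation_le.
have [L L0 HL] := difference_dilation_le.
exists (C * (L * K) `^ q); first by rewrite mulr_ge0 ?powR_ge0.
move=> r t F g r0 t0 F0 mg g0 gF.
have Wr := W_gt0 r0; have P0 := Psi_ge0 t0; have rt := growth_factor_gt0 t0.
have P20 : 0 <= 2 + @Psi R n t by rewrite addr_ge0.
have a0 : 0 <= L * (2 + @Psi R n t) by rewrite mulr_ge0.
have LK0 : 0 <= L * K by rewrite mulr_ge0.
have FP0 : 0 <= F * (rho0 t * (2 + @Psi R n t)) by apply: mulr_ge0 => //; apply: mulr_ge0 => //; exact: ltW.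
have b0 : 0 <= K * (F * rho0 t * W r `^ lam) by rewrite !mulr_ge0 ?powR_ge0// ltW.
have := HC r (fun z => normc (b z.1 - b (dilate_to t z))) (fun z => g (dilate_to t z)) _ _ r0 a0 b0
  (measurable_normc_diff t) (measurableT_comp mg (measurable_dilate_to t))
  (fun z => normc_ge0 _) (fun z => g0 _) (HL r t r0 t0) (HK r t F g r0 t0 F0 mg g0 gF).
move=> /le_trans; apply; rewrite lee_fin.
rewrite (_ : L * _ * _ = (L * K) * (F * (rho0 t * (2 + @Psi R n t))) * W r `^ lam); last by ring.
rewrite (powRM _ (mulr_ge0 LK0 FP0) (powR_ge0 _ _)) (powRM _ LK0 FP0).
rewrite -(powRrM (W r)) -!mulrA !ler_wpM2l ?powR_ge0//.
by rewrite -[X in _ * X <= _](powRr1 (ltW Wr)) -powRD ?(gt_eqF Wr) ?implybT// addrC.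
Qed.

End core.

(** * Integration over the dilation parameter *)

Lemma tonelli_dom d1 d2 (T1 : measurableType d1) (T2 : measurableType d2) (R : realType)
    (m1 : {sigma_finite_measure set T1 -> \bar R})
    (m2 : {sigma_finite_measure set T2 -> \bar R}) (D : set T1) (E : set T2)
    (F : T1 * T2 -> \bar R) : measurable D -> measurable E -> measurable_fun setT F ->
  (forall z, 0 <= F z)%E ->
  (\int[m1]_(x in D) \int[m2]_(y in E) F (x, y) =
   \int[m2]_(y in E) \int[m1]_(x in D) F (x, y))%E.
Proof.
move=> mD mE mF F0.
pose G := F \_ (D `*` E).
have mG : measurable_fun setT G.
  by apply/(measurable_restrictT _ _).1; [exact: measurableX|exact: measurable_funTS].
have G0 z : (0 <= G z)%E by rewrite erestrict_ge0.
have GE x y : G (x, y) = if (x \in D) && (y \in E) then F (x, y) else 0%E.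
  rewrite /G patchE (_ : _ \in _ = (x \in D) && (y \in E))//.
  by apply/idP/andP; rewrite !inE => -[].
transitivity (\int[m1]_x \int[m2]_y G (x, y))%E.
  rewrite integral_mkcond; apply: eq_integral => x _; rewrite patchE.
  case: ifPn => xD; last first.
    by rewrite (eq_integral (cst 0%E)) ?integral0// => y _; rewrite GE (negbTE xD).
  by rewrite integral_mkcond; apply: eq_integral => y _; rewrite patchE GE xD.
rewrite fubini_tonelli; [|exact: mG|exact: G0].
rewrite [RHS]integral_mkcond; apply: eq_integral => y _; rewrite patchE.
case: ifPn => yE; last first.
  by rewrite (eq_integral (cst 0%E)) ?integral0// => x _; rewrite GE (negbTE yE) andbF.
by rewrite [RHS]integral_mkcond; apply: eq_integral => x _; rewrite patchE GE yE andbT.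
Qed.

Lemma measurable_invr (R : realType) :
  measurable_fun [set: measurableTypeR R] (fun t : R => t^-1).
Proof.
rewrite (_ : (fun _ => _) = fun t : measurableTypeR R => t * ((t ^+ 2) `^ (-1))).
  by apply: measurable_funM => //; apply: measurable_powR_fun; exact: exprn_measurable.
apply/funext => t /=; rewrite powR_inv1 ?sqr_ge0//.
have [->|t0] := eqVneq t 0; first by rewrite invr0 mul0r.
by rewrite expr2 invfM mulrA mulfV// mul1r.
Qed.

Section operator.
Context {R : realType} {n : nat}.
Local Notation H := (heisenberg R n).
Local Notation mu := (@heis_measure R n).
Local Notation Q := (heis_Q n).
Local Notation B := (@heis_cball0 R n).
Variable sigma : {finite_measure set H -> \bar R}.
Hypothesis sigma_sphere : is_sphere_measure sigma.
Local Notation leb := (@lebesgue_measure R).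
Local Notation Rpos := (`]0%R, +oo[%classic : set (measurableTypeR R)).

Variable w : H -> R.
Hypothesis mw : measurable_fun setT w.
Hypothesis w0 : forall x, 0 <= w x.
Variables (zeta rw : R).
Hypothesis zeta1 : 1 <= zeta.
Hypothesis w_A : muckenhoupt zeta w.
Hypothesis rwE : critical_index w = rw%:E.
Local Notation W := (weight_mass w).
Variables (q delta lam : R).
Hypothesis q_ge1 : 1 <= q.
Variable b : H -> R[i].
Hypothesis mb : cborel_fun b.

Variable phi : R -> R.
Hypothesis mphi : measurable_fun [set: measurableTypeR R] phi.
Hypothesis phi0 : forall t, 0 <= phi t.

Definition dilation_gain (t : R) : R :=
  growth_factor (n := n) zeta delta lam t * (2 + @Psi R n t).
Local Notation rho := dilation_gain.

Let q0 : 0 < q. Proof. by rewrite (lt_le_trans _ q_ge1). Qed.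

Lemma dilation_gain_gt0 t : 0 < t -> 0 < rho t.
Proof.
move=> t0; apply: mulr_gt0; first exact: growth_factor_gt0.
by apply: ltr_wpDr => //; exact: Psi_ge0.
Qed.

Lemma measurable_dilation_gain : measurable_fun [set: measurableTypeR R] rho.
Proof.
apply: measurable_funM.
  rewrite /growth_factor; apply: measurable_fun_ifT.
  - by apply: measurable_fun_ler.
  - exact: measurable_powR_fun.
  - exact: measurable_powR_fun.
rewrite /Psi; apply: measurable_funD => //; apply: measurable_funD; apply: measurable_funM.
- by apply: (measurableT_comp (@measurable_invr R)); exact: exprn_measurable.
- exact: measurable_indic.
- exact: exprn_measurable.
- exact: measurable_indic.
Qed.

Lemma dilation_gain_ge0 t : 0 <= rho t.
Proof.
apply: mulr_ge0; first by rewrite /growth_factor; case: ifP => _; exact: powR_ge0.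
apply: addr_ge0 => //; have [t0|t0] := ltP 0 t; first exact: Psi_ge0.
rewrite /Psi !indicE !memNset ?mulr0 ?addr0//.
  by rewrite /= in_itv/= andbT; apply/negP; rewrite -leNgt (le_trans t0).
by rewrite /= in_itv/=; apply/negP; rewrite ltNge t0.
Qed.

(** The density whose integral is [C9]. Dividing by [`|t|], which is [t] in the
    range of integration, keeps it nonnegative on the whole line. *)
Definition kernel_mass (t : R) : R := phi t / `|t| * rho t.
(** The weight in front of the [q]-th powers when Hölder's inequality is applied
    with respect to [kernel_mass]. *)
Definition kernel_jensen (t : R) : R := phi t / `|t| * rho t `^ (1 - q).

Lemma kernel_mass_ge0 t : 0 <= kernel_mass t.
Proof. by apply: mulr_ge0; [rewrite mulr_ge0 ?invr_ge0|exact: dilation_gain_ge0]. Qed.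

Lemma kernel_jensen_ge0 t : 0 <= kernel_jensen t.
Proof. by apply: mulr_ge0; [rewrite mulr_ge0 ?invr_ge0|exact: powR_ge0]. Qed.

Let mphit : measurable_fun [set: measurableTypeR R] (fun t : R => phi t / `|t|).
Proof.
apply: measurable_funM => //; apply: (measurableT_comp (@measurable_invr R)).
exact: normr_measurable.
Qed.

Lemma measurable_kernel_mass : measurable_fun [set: measurableTypeR R] kernel_mass.
Proof. by apply: measurable_funM => //; exact: measurable_dilation_gain. Qed.

Lemma measurable_kernel_jensen : measurable_fun [set: measurableTypeR R] kernel_jensen.
Proof. by apply: measurable_funM => //; apply: measurable_powR_fun; exact: measurable_dilation_gain. Qed.

Definition dilate_point (z : (H * measurableTypeR R) * H) : H :=
  heis_dil (z.1.2^-1 * heis_norm z.1.1) z.2.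

Lemma measurable_dilate_point : measurable_fun setT dilate_point.
Proof.
pose h (z : (H * measurableTypeR R) * H) : measurableTypeR R * H :=
  (z.1.2^-1 * heis_norm z.1.1, z.2).
suff mh : measurable_fun setT h by exact: (measurableT_comp measurable_heis_dil mh).
apply/measurable_fun_pairP; split; last exact: measurable_snd.
apply: measurable_funM.
  exact: (measurableT_comp (@measurable_invr R) (measurableT_comp measurable_snd measurable_fst)).
exact: (measurableT_comp measurable_heis_norm (measurableT_comp measurable_fst measurable_fst)).
Qed.

Variable g : H -> R.
Hypothesis mg : measurable_fun setT g.
Hypothesis g0 : forall x, 0 <= g x.

Definition diff_at (z : (H * measurableTypeR R) * H) : R :=
  normc (b z.1.1 - b (dilate_point z)).

Lemma measurable_diff_at : measurable_fun setT diff_at.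
Proof.
apply: (cborel_normc (cborelB _ _)).
  exact: (cborel_comp mb (measurableT_comp measurable_fst measurable_fst)).
exact: (cborel_comp mb measurable_dilate_point).
Qed.

Let mgd : measurable_fun setT (g \o dilate_point).
Proof. exact: (measurableT_comp mg measurable_dilate_point). Qed.

Definition jensen_integral (x : H) : \bar R :=
  (\int[leb]_(t in Rpos) \int[sigma]_y
    (kernel_jensen t * (diff_at (x, t, y) `^ q * g (dilate_point (x, t, y)) `^ q))%:E)%E.

Let jensen_integrand (z : (H * measurableTypeR R) * H) : R :=
  kernel_jensen z.1.2 * (diff_at z `^ q * g (dilate_point z) `^ q).

Let mjensen : measurable_fun setT jensen_integrand.
Proof.
apply: measurable_funM.
  exact: (measurableT_comp measurable_kernel_jensen (measurableT_comp measurable_snd measurable_fst)).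
by apply: measurable_funM; [apply: measurable_powR_fun; exact: measurable_diff_at|exact: measurable_powR_fun mgd].
Qed.

Let jensen_ge0 z : 0 <= jensen_integrand z.
Proof. by apply: mulr_ge0; [exact: kernel_jensen_ge0|rewrite mulr_ge0 ?powR_ge0]. Qed.

Let jensen_slice_ge0 x t : (0 <= \int[sigma]_y (jensen_integrand (x, t, y))%:E)%E.
Proof. by apply: integral_ge0 => y _; rewrite lee_fin; exact: (jensen_ge0 (x, t, y)). Qed.

Let measurable_jensen_slice x : measurable_fun [set: measurableTypeR R]
  (fun t => \int[sigma]_y (jensen_integrand (x, t, y))%:E)%E.
Proof.
have mjE : measurable_fun setT (EFin \o jensen_integrand) by exact/measurable_EFinP.
have jE0 z : (0 <= (EFin \o jensen_integrand) z)%E by rewrite /= lee_fin.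
have mI := @measurable_fun_fubini_tonelli_F _ _ (H * measurableTypeR R)%type H R sigma _ mjE jE0.
exact: (measurableT_comp mI (pair1_measurable x)).
Qed.

Lemma jensen_integral_ge0 x : (0 <= jensen_integral x)%E.
Proof. by apply: integral_ge0 => t _; apply: integral_ge0 => y _; rewrite lee_fin; exact: (jensen_ge0 (x, t, y)). Qed.

Variable C1 : R.
Hypothesis C1_ge0 : 0 <= C1.
Variable F : R.
Hypothesis F0 : 0 <= F.
Hypothesis slice_le : forall r t, 0 < r -> 0 < t ->
  (\int[mu]_(x in B r) \int[sigma]_y
     (normc (b x - b (dilate_to t (x, y))) `^ q * g (dilate_to t (x, y)) `^ q * w x)%:E <=
   (C1 * (F * rho t) `^ q * W r `^ (1 + lam * q))%:E)%E.
Variable Mk : R.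
Hypothesis kernel_fin : (\int[leb]_(t in Rpos) (kernel_mass t)%:E <= Mk%:E)%E.

(** After exchanging the integrals, the estimate for fixed [t] contributes [rho
    t ^ q], and [rho t ^ q * rho t ^ (1 - q) = rho t] leaves the kernel of
    finite mass. *)
Lemma jensen_integral_le r : 0 < r ->
  (\int[mu]_(x in B r) (jensen_integral x * (w x)%:E) <=
   (C1 * F `^ q * W r `^ (1 + lam * q) * Mk)%:E)%E.
Proof.
move=> r0.
have mB : measurable (B r) by exact: measurable_heis_cball0.
have mRpos : measurable Rpos by exact: measurable_itv.
pose J (z : H * measurableTypeR R) : \bar R :=
  (\int[sigma]_y (jensen_integrand (z, y) * w z.1)%:E)%E.
have mJw : measurable_fun setT (fun z : (H * measurableTypeR R) * H => (jensen_integrand z * w z.1.1)%:E).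
  apply/measurable_EFinP/measurable_funM => //.
  exact: (measurableT_comp mw (measurableT_comp measurable_fst measurable_fst)).
have Jw0 z : (0 <= (jensen_integrand z * w z.1.1)%:E)%E by rewrite lee_fin mulr_ge0.
have mJ : measurable_fun setT J.
  exact: (@measurable_fun_fubini_tonelli_F _ _ (H * measurableTypeR R)%type H R sigma _ mJw Jw0).
have J0 z : (0 <= J z)%E by apply: integral_ge0 => y _; exact: Jw0.
have IE x : (jensen_integral x * (w x)%:E = \int[leb]_(t in Rpos) J (x, t))%E.
  rewrite /jensen_integral -ge0_integralZr; [|exact: mRpos| | |by rewrite lee_fin].
  - apply: eq_integral => t _; rewrite -ge0_integralZr; [|exact: measurableT| | |by rewrite lee_fin].
    + by apply: eq_integral => y _; rewrite -EFinM.
    + by apply/measurable_EFinP; exact: (measurableT_comp mjensen (pair1_measurable (x, t))).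
    + by move=> y _; rewrite lee_fin; exact: (jensen_ge0 (x, t, y)).
  - exact: measurable_funTS (measurable_jensen_slice x).
  - by move=> t _; apply: integral_ge0 => y _; rewrite lee_fin; exact: (jensen_ge0 (x, t, y)).
rewrite (eq_integral (fun x => \int[leb]_(t in Rpos) J (x, t))%E); last by move=> x _; exact: IE.
rewrite (@tonelli_dom _ _ _ _ _ mu leb _ _ J mB mRpos mJ J0).
pose c := C1 * F `^ q * W r `^ (1 + lam * q).
have c0 : 0 <= c by rewrite !mulr_ge0 ?powR_ge0.
apply: (@le_trans _ _ (\int[leb]_(t in Rpos) (c%:E * (kernel_mass t)%:E))%E).
  apply: le_integral_ae.
  - by move=> t _; apply: integral_ge0 => x _; exact: J0.
  - by move=> t _; rewrite -EFinM lee_fin mulr_ge0 ?kernel_mass_ge0.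
  apply/aeW => t /=; rewrite in_itv/= andbT => t0.
  have := slice_le r0 t0.
  rewrite (eq_integral (fun x => \int[sigma]_y
     ((diff_at (x, t, y) `^ q * g (dilate_point (x, t, y)) `^ q) * w x)%:E)%E)//.
  move=> sl.
  have -> : (\int[mu]_(x in B r) J (x, t) = (kernel_jensen t)%:E *
     \int[mu]_(x in B r) \int[sigma]_y
     ((diff_at (x, t, y) `^ q * g (dilate_point (x, t, y)) `^ q) * w x)%:E)%E.
    pose S (x : H) := (\int[sigma]_y
      ((diff_at (x, t, y) `^ q * g (dilate_point (x, t, y)) `^ q) * w x)%:E)%E.
    pose sl_fun (z : H * H) := diff_at (z.1, t, z.2) `^ q * g (dilate_point (z.1, t, z.2)) `^ q * w z.1.
    have m3 : measurable_fun setT (fun z : H * H => ((z.1, t : measurableTypeR R), z.2)).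
      apply/measurable_fun_pairP; split; last exact: measurable_snd.
      by apply/measurable_fun_pairP; split; [exact: measurable_fst|exact: measurable_cst].
    have msl : measurable_fun setT sl_fun.
      apply: measurable_funM; last exact: (measurableT_comp mw measurable_fst).
      by apply: measurable_funM; apply: measurable_powR_fun;
        [exact: (measurableT_comp measurable_diff_at m3)|exact: (measurableT_comp mgd m3)].
    have sl0 z : 0 <= sl_fun z by rewrite mulr_ge0 ?mulr_ge0 ?powR_ge0.
    have mslE : measurable_fun setT (EFin \o sl_fun) by exact/measurable_EFinP.
    have slE0 z : (0 <= (EFin \o sl_fun) z)%E by rewrite /= lee_fin.
    have mS : measurable_fun setT S.
      exact: (@measurable_fun_fubini_tonelli_F _ _ H H R sigma _ mslE slE0).
    have S0 x : (0 <= S x)%E by apply: integral_ge0 => y _; exact: (slE0 (x, y)).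
    rewrite -/S -ge0_integralZl; [|exact: mB|exact: measurable_funTS mS|by move=> x _; exact: S0|
      by rewrite lee_fin kernel_jensen_ge0].
    apply: eq_integral => x _; rewrite /J /S -ge0_integralZl; [|exact: measurableT| |
      by move=> y _; exact: (slE0 (x, y))|by rewrite lee_fin kernel_jensen_ge0].
      by apply: eq_integral => y _; rewrite -EFinM /jensen_integrand /= !mulrA.
    exact: (measurableT_comp mslE (pair1_measurable x)).
  apply: (@le_trans _ _ ((kernel_jensen t)%:E * (C1 * (F * rho t) `^ q * W r `^ (1 + lam * q))%:E)%E).
    by apply: lee_wpmul2l => //; rewrite lee_fin kernel_jensen_ge0.
  rewrite -!EFinM lee_fin /kernel_jensen /kernel_mass /c (powRM _ F0 (dilation_gain_ge0 t)).
  have rt := dilation_gain_gt0 t0.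
  rewrite le_eqVlt; apply/orP; left; apply/eqP.
  have e : rho t `^ (1 - q) * rho t `^ q = rho t.
    by rewrite -powRD ?(gt_eqF rt) ?implybT// subrK powRr1// ltW.
  transitivity ((rho t `^ (1 - q) * rho t `^ q) *
    (C1 * F `^ q * W r `^ (1 + lam * q) * (phi t / `|t|))); first by ring.
  by rewrite e; ring.
rewrite ge0_integralZl; [|exact: mRpos| | |by rewrite lee_fin].
- by rewrite [leRHS]EFinM; apply: lee_wpmul2l => //; rewrite lee_fin.
- by apply: measurable_funTS; apply/measurable_EFinP; exact: measurable_kernel_mass.
- by move=> t _; rewrite lee_fin kernel_mass_ge0.
Qed.

Variable om : H -> R.
Hypothesis mom : measurable_fun setT om.
Hypothesis om0 : forall y, 0 <= om y.
Variable L : R.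
Hypothesis L0 : 0 <= L.
Hypothesis om_fin : if q == 1 then \forall y \ae sigma, om y <= L
  else (\int[sigma]_y (om y `^ (1 - q^-1)^-1)%:E <= L%:E)%E.

Definition majorant (x : H) : \bar R :=
  (\int[leb]_(t in Rpos) \int[sigma]_y
    (phi t / t * om y * diff_at (x, t, y) * g (dilate_point (x, t, y)))%:E)%E.

(** A pointwise substitute for Minkowski's integral inequality. For [q > 1],
    Hölder's inequality on the half-line times the sphere is applied to the
    integrand of [jensen_integral] and to [kernel_mass t * om y ^ q'], with [q']
    conjugate to [q], the powers of [rho t] cancelling; for [q = 1], [om] is
    bounded and comes out of the integral. The sum of two constants serves both
    cases. *)
Lemma majorant_le x A : 0 <= A -> (jensen_integral x <= A%:E)%E ->
  (majorant x <= (((Mk * L) `^ (1 - q^-1) + L) * A `^ q^-1)%:E)%E.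
Proof.
move=> A0 IA.
have mRpos : measurable Rpos by exact: measurable_itv.
have Mk0 : 0 <= Mk.
  rewrite -lee_fin; apply: le_trans kernel_fin; apply: integral_ge0 => t _.
  by rewrite lee_fin kernel_mass_ge0.
have [q1E|qn1] := eqVneq q 1.
  move: om_fin; rewrite q1E eqxx => omL.
  rewrite invr1 powRr1//.
  apply: (@le_trans _ _ (L%:E * jensen_integral x)%E); last first.
    apply: (@le_trans _ _ (L%:E * A%:E)%E); first by apply: lee_wpmul2l.
    by rewrite -EFinM lee_fin ler_wpM2r// lerDr powR_ge0.
  rewrite /jensen_integral -ge0_integralZl; [|exact: mRpos|exact: measurable_funTS (measurable_jensen_slice x)|
    by move=> t _; exact: jensen_slice_ge0|by rewrite lee_fin].
  apply: le_integral_ae.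
  - move=> t; rewrite /= in_itv/= andbT => t0; apply: integral_ge0 => y _.
    by rewrite lee_fin !mulr_ge0 ?invr_ge0 ?(ltW t0)//; exact: normc_ge0.
  - by move=> t _; apply: mule_ge0; [rewrite lee_fin|exact: jensen_slice_ge0].
  apply/aeW => t; rewrite /= in_itv/= andbT => t0.
  rewrite -ge0_integralZl; [|exact: measurableT| |
    by move=> y _; rewrite lee_fin; exact: (jensen_ge0 (x, t, y))|by rewrite lee_fin].
    apply: le_integral_ae.
    - move=> y _.
      by rewrite lee_fin !mulr_ge0 ?invr_ge0 ?(ltW t0)//; exact: normc_ge0.
    - by move=> y _; rewrite -EFinM lee_fin; apply: mulr_ge0 => //; exact: (jensen_ge0 (x, t, y)).
    apply: filterS omL => y omy _; rewrite -EFinM lee_fin.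
    rewrite /kernel_jensen q1E subrr powRr0 mulr1 !powRr1 ?normc_ge0// gtr0_norm//.
    have p0 : 0 <= phi t / t by rewrite mulr_ge0 ?invr_ge0 ?(ltW t0).
    have d0 : 0 <= diff_at (x, t, y) by exact: normc_ge0.
    rewrite [leRHS](_ : _ = phi t / t * L * diff_at (x, t, y) * g (dilate_point (x, t, y))); last by ring.
    by do 2 (apply: ler_wpM2r => //); apply: ler_wpM2l.
  by apply/measurable_EFinP; exact: (measurableT_comp mjensen (pair1_measurable (x, t))).
move: om_fin; rewrite (negbTE qn1) => omL.
have qgt1 : 1 < q by rewrite lt_neqAle eq_sym qn1.
pose th := q^-1; pose eta := 1 - q^-1.
have th0 : 0 <= th by rewrite invr_ge0 ltW.
have eta0 : 0 < eta by rewrite subr_gt0 invf_lt1.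
have the : th + eta = 1 by rewrite addrCA subrr addr0.
pose Fj (z : measurableTypeR R * H) := jensen_integrand (x, z.1, z.2).
pose G (z : measurableTypeR R * H) := kernel_mass z.1 * om z.2 `^ eta^-1.
have m3 : measurable_fun setT (fun z : measurableTypeR R * H => ((x, z.1), z.2)).
  apply/measurable_fun_pairP; split; last exact: measurable_snd.
  by apply/measurable_fun_pairP; split; [exact: measurable_cst|exact: measurable_fst].
have mFj : measurable_fun setT Fj by exact: (measurableT_comp mjensen m3).
have Fj0 z : 0 <= Fj z by exact: jensen_ge0.
have mG : measurable_fun setT G.
  apply: measurable_funM; first exact: (measurableT_comp measurable_kernel_mass measurable_fst).
  by apply: measurable_powR_fun; exact: (measurableT_comp mom measurable_snd).
have G0 z : 0 <= G z by apply: mulr_ge0; [exact: kernel_mass_ge0|exact: powR_ge0].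
have mD : measurable (Rpos `*` [set: H]) by exact: measurableX.
have tonE (K : measurableTypeR R * H -> R) : measurable_fun setT K -> (forall z, 0 <= K z) ->
    (\int[(leb \x sigma)%E]_(z in Rpos `*` setT) (K z)%:E =
     \int[leb]_(t in Rpos) \int[sigma]_y (K (t, y))%:E)%E.
  move=> mK K0; apply: (@tonelli_strip _ _ _ _ _ leb sigma Rpos (EFin \o K)).
  - exact: mRpos.
  - exact/measurable_EFinP.
  - by move=> z; rewrite /= lee_fin.
have FA : (\int[(leb \x sigma)%E]_(z in Rpos `*` setT) (Fj z)%:E <= A%:E)%E by rewrite tonE.
have GL : (\int[(leb \x sigma)%E]_(z in Rpos `*` setT) (G z)%:E <= (Mk * L)%:E)%E.
  rewrite tonE//.
  apply: (@le_trans _ _ (\int[leb]_(t in Rpos) (L%:E * (kernel_mass t)%:E))%E).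
    apply: le_integral_ae.
    - by move=> t _; apply: integral_ge0 => y _; rewrite lee_fin.
    - by move=> t _; rewrite -EFinM lee_fin mulr_ge0 ?kernel_mass_ge0.
    apply/aeW => t _; rewrite /G /=.
    rewrite (eq_integral (fun y => (kernel_mass t)%:E * (om y `^ eta^-1)%:E)%E); last first.
      by move=> y _; rewrite EFinM.
    rewrite ge0_integralZl; [|exact: measurableT| |by move=> y _; rewrite lee_fin powR_ge0|
      by rewrite lee_fin kernel_mass_ge0].
      by rewrite muleC; apply: lee_wpmul2r => //; rewrite lee_fin kernel_mass_ge0.
    by apply/measurable_EFinP/measurable_powR_fun.
  rewrite ge0_integralZl; [|exact: mRpos| |by move=> y _; rewrite lee_fin kernel_mass_ge0|by rewrite lee_fin].
    by rewrite (mulrC Mk) EFinM; apply: lee_wpmul2l; rewrite ?lee_fin.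
  by apply: measurable_funTS; apply/measurable_EFinP; exact: measurable_kernel_mass.
have := hoelder_le mD mFj mG Fj0 G0 th0 (ltW eta0) the FA GL.
rewrite tonE; first last.
- by move=> z; rewrite mulr_ge0 ?powR_ge0.
- by apply: measurable_funM; exact: measurable_powR_fun.
move=> h.
have {}h : (majorant x <= (A `^ th * (Mk * L) `^ eta)%:E)%E.
  apply: le_trans h; rewrite le_eqVlt; apply/orP; left; apply/eqP.
  apply: eq_integral => t; rewrite inE/= in_itv/= andbT => t0.
  apply: eq_integral => y _; congr (_%:E).
  rewrite /Fj /G /jensen_integrand /=.
  have d0 : 0 <= diff_at (x, t, y) by exact: normc_ge0.
  have rt := dilation_gain_gt0 t0.
  have p0 : 0 <= phi t / t by rewrite mulr_ge0 ?invr_ge0 ?(ltW t0).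
  rewrite (powRM _ (kernel_jensen_ge0 t)) ?mulr_ge0 ?powR_ge0//.
  rewrite (powRM th) ?powR_ge0// -!powRrM mulfV ?gt_eqF// !powRr1//.
  rewrite (powRM _ (kernel_mass_ge0 t) (powR_ge0 _ _)) -(powRrM (om y)) mulVf ?gt_eqF// powRr1//.
  rewrite /kernel_jensen /kernel_mass gtr0_norm// (powRM _ p0 (powR_ge0 _ _)) (powRM _ p0 (ltW rt)).
  rewrite -(powRrM (rho t)).
  have e : rho t `^ ((1 - q) * th) * rho t `^ eta = 1.
    rewrite -powRD ?(gt_eqF rt) ?implybT// (_ : _ + _ = 0) ?powRr0//.
    by rewrite /th /eta; field; rewrite gt_eqF.
  have e' : (phi t / t) `^ th * (phi t / t) `^ eta = phi t / t.
    by rewrite -powRD ?the ?oner_eq0// powRr1.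
  transitivity (((phi t / t) `^ th * (phi t / t) `^ eta) *
    (rho t `^ ((1 - q) * th) * rho t `^ eta) * om y * diff_at (x, t, y) * g (dilate_point (x, t, y))).
    by rewrite e e' mulr1.
  by ring.
apply: (le_trans h); rewrite lee_fin mulrC ler_wpM2r ?powR_ge0//.
by rewrite lerDl.
Qed.

Lemma measurable_jensen_integral : measurable_fun setT jensen_integral.
Proof.
pose K (z : (H * measurableTypeR R) * H) := jensen_integrand z * \1_Rpos z.1.2.
have mI : measurable_fun setT (\1_Rpos : measurableTypeR R -> R).
  by apply: measurable_indic; exact: measurable_itv.
have mK : measurable_fun setT K.
  apply: measurable_funM => //.
  exact: (measurableT_comp mI (measurableT_comp measurable_snd measurable_fst)).
have mKE : measurable_fun setT (EFin \o K) by exact/measurable_EFinP.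
have KE0 z : (0 <= (EFin \o K) z)%E by rewrite /= lee_fin mulr_ge0.
have mKy := @measurable_fun_fubini_tonelli_F _ _ (H * measurableTypeR R)%type H R sigma _ mKE KE0.
have Ky0 z : (0 <= fubini_F sigma (EFin \o K) z)%E.
  by apply: integral_ge0 => y _; exact: (KE0 (z, y)).
have mF := @measurable_fun_fubini_tonelli_F _ _ H (measurableTypeR R) R leb _ mKy Ky0.
suff <- : fubini_F leb (fubini_F sigma (EFin \o K)) = jensen_integral by exact: mF.
apply/funext => x; rewrite /jensen_integral [RHS]integral_mkcond; apply: eq_integral => t _.
rewrite patchE; case: ifPn => tp.
  by apply: eq_integral => y _; rewrite /K /= indicE tp mulr1.
rewrite /fubini_F (eq_integral (cst 0%E)) ?integral0// => y _.
by rewrite /K /= indicE (negbTE tp) mulr0.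
Qed.

(** Its product with the weight is integrable on every ball, and the weight is
    positive almost everywhere. *)
Lemma jensen_integral_lty_ae : \forall x \ae mu, (jensen_integral x < +oo)%E.
Proof.
have mB r : measurable (B r) by exact: measurable_heis_cball0.
have mIw r : measurable_fun (B r) (fun x => jensen_integral x * (w x)%:E)%E.
  apply: measurable_funTS; apply: emeasurable_funM; first exact: measurable_jensen_integral.
  exact/measurable_EFinP.
have Iw0 x : (0 <= jensen_integral x * (w x)%:E)%E.
  by rewrite mule_ge0 ?jensen_integral_ge0// lee_fin.
have fin_ae (k : nat) : \forall x \ae mu, B k.+1%:R x ->
    (jensen_integral x * (w x)%:E)%E \is a fin_num.
  apply: integrable_ae; first exact: mB.
  apply/integrableP; split; first exact: mIw.
  rewrite (eq_integral (fun x => jensen_integral x * (w x)%:E)%E); last first.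
    by move=> x _; rewrite gee0_abs.
  by apply: le_lt_trans (jensen_integral_le _) (ltry _).
have wp := weight_gt0_ae sigma_sphere mw w0 zeta1 w_A rwE.
apply: filterS2 wp (ae_cballP fin_ae) => x wx Ifin.
rewrite ltNge leye_eq; apply/negP => /eqP Ioo.
by move: Ifin; rewrite Ioo gt0_mulye ?lte_fin.
Qed.

(** Meant for [h] the modulus of the commutator, the factor 4 being that of
    [commutator_majorant]. *)
Lemma majorized_le (h : H -> R) r : 0 < r -> (forall x, 0 <= h x) ->
  (forall x A, 0 <= A -> (majorant x <= A%:E)%E -> h x <= 4 * A) ->
  (\int[mu]_(x in B r) (h x `^ q * w x)%:E <=
   ((4 * ((Mk * L) `^ (1 - q^-1) + L)) `^ q * (C1 * F `^ q * W r `^ (1 + lam * q) * Mk))%:E)%E.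
Proof.
move=> r0 h0 hA.
set c := (Mk * L) `^ (1 - q^-1) + L.
have c0 : 0 <= c by rewrite addr_ge0 ?powR_ge0.
have C0 : 0 <= (4 * c) `^ q by exact: powR_ge0.
apply: (@le_trans _ _ (\int[mu]_(x in B r) (((4 * c) `^ q)%:E * (jensen_integral x * (w x)%:E)))%E).
  apply: le_integral_ae.
  - by move=> x _; rewrite lee_fin mulr_ge0 ?powR_ge0.
  - by move=> x _; rewrite mule_ge0 ?lee_fin// mule_ge0 ?jensen_integral_ge0 ?lee_fin.
  apply: filterS jensen_integral_lty_ae => x Ix _.
  have I0 := jensen_integral_ge0 x.
  have IE : jensen_integral x = (fine (jensen_integral x))%:E by rewrite fineK// ge0_fin_numE.
  set A := fine (jensen_integral x) in IE.
  have A0 : 0 <= A by rewrite fine_ge0.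
  rewrite IE -!EFinM lee_fin mulrA ler_wpM2r//.
  have mA : (majorant x <= (c * A `^ q^-1)%:E)%E by apply: majorant_le => //; rewrite IE.
  have := hA x _ (mulr_ge0 c0 (powR_ge0 _ _)) mA; rewrite mulrA => hx.
  apply: (@le_trans _ _ ((4 * c * A `^ q^-1) `^ q)).
    by apply: ge0_ler_powR; rewrite ?nnegrE ?mulr_ge0 ?powR_ge0 ?(ltW q0).
  by rewrite powRM ?powR_ge0 ?mulr_ge0// -powRrM mulVf ?gt_eqF// powRr1.
rewrite ge0_integralZl; [|exact: measurable_heis_cball0| | |by rewrite lee_fin].
- by rewrite [leRHS]EFinM; apply: lee_wpmul2l; [rewrite lee_fin|exact: jensen_integral_le].
- apply: measurable_funTS; apply: emeasurable_funM; first exact: measurable_jensen_integral.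
  exact/measurable_EFinP.
- by move=> x _; rewrite mule_ge0 ?jensen_integral_ge0 ?lee_fin.
Qed.

Lemma majorant_lty_ae : \forall x \ae mu, (majorant x < +oo)%E.
Proof.
apply: filterS jensen_integral_lty_ae => x Ix.
have I0 := jensen_integral_ge0 x.
have IE : jensen_integral x = (fine (jensen_integral x))%:E by rewrite fineK// ge0_fin_numE.
have A0 : 0 <= fine (jensen_integral x) by rewrite fine_ge0.
by apply: le_lt_trans (majorant_le A0 _) (ltry _); rewrite -IE.
Qed.

End operator.

(** * Borel representatives of the data *)

Lemma ge0_integral_eq0_ae d (T : measurableType d) (R : realType)
    (mu : {measure set T -> \bar R}) (D : set T) (f : T -> \bar R) :
  measurable D -> measurable_fun D f -> (forall x, 0 <= f x)%E ->
  (\int[mu]_(x in D) f x = 0)%E -> \forall x \ae mu, D x -> f x = 0%E.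
Proof.
move=> mD mf f0 int0; apply: (ae_eq_integral_abs mu mD mf).1.
by rewrite -[RHS]int0; apply: eq_integral => x _; rewrite gee0_abs.
Qed.

Section borel_versions.
Context d (T : measurableType d) (R : realType).
Variable mu : {measure set T -> \bar R}.

Lemma borel_version (f : T -> R) : completed_measurable_fun mu f ->
  exists g, [/\ measurable_fun setT g, \forall x \ae mu, f x = g x &
    (forall x, 0 <= f x) -> forall x, 0 <= g x].
Proof.
move=> /completed_measurableP[N [mN N0 mf]].
exists (patch (fun=> 0) (~` N) f); split => //.
  exists N; split => // x /=; rewrite /patch; case: ifPn => // /negP/[!inE].
  by move=> nNx _; apply: contrapT.
by move=> f0 x; rewrite /patch; case: ifP.
Qed.

Lemma cborel_version (f : T -> R[i]) : cmeasurable_fun mu f ->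
  exists2 g, cborel_fun g & \forall x \ae mu, f x = g x.
Proof.
move=> [/borel_version[u [mu_ fu _]] /borel_version[v [mv fv _]]].
exists (fun x => Complex (u x) (v x)); first by split.
by apply: filterS2 fu fv => x ux vx; rewrite -ux -vx; case: (f x).
Qed.

Lemma cmeasurable_fun_ae (f g : T -> R[i]) : cborel_fun g ->
  (\forall x \ae mu, f x = g x) -> cmeasurable_fun mu f.
Proof.
move=> [gr gi] fg; split; [apply: completed_measurable_fun_ae gr _|apply: completed_measurable_fun_ae gi _];
  by apply: filterS fg => x ->.
Qed.

End borel_versions.

Section measurable_parameter.
Context d1 d2 (T1 : measurableType d1) (T2 : measurableType d2) (R : realType).
Variable m2 : {sigma_finite_measure set T2 -> \bar R}.

Lemma measurable_Rintegral_param (F : T1 * T2 -> R) (D : set T2) :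
  measurable D -> measurable_fun setT F ->
  measurable_fun setT (fun x => \int[m2]_(y in D) F (x, y)).
Proof.
move=> mD mF.
pose K z : \bar R := (F z * \1_D z.2)%:E.
have mK : measurable_fun setT K.
  apply/measurable_EFinP/measurable_funM => //.
  exact: (measurableT_comp (measurable_indic mD) measurable_snd).
have mp := @measurable_fun_fubini_tonelli_F _ _ T1 T2 R m2 _ (measurable_funepos mK) (funepos_ge0 K).
have mn := @measurable_fun_fubini_tonelli_F _ _ T1 T2 R m2 _ (measurable_funeneg mK) (funeneg_ge0 K).
have -> : (fun x => \int[m2]_(y in D) F (x, y)) =
    fine \o (fun x => fubini_F m2 K^\+ x - fubini_F m2 K^\- x)%E.
  apply/funext => x; rewrite /= /Rintegral; congr fine.
  rewrite integral_mkcond.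
  rewrite (eq_integral (fun y => K (x, y))); last first.
    move=> y _; rewrite patchE /K indicE /=; case: ifP => _; rewrite ?mulr1 ?mulr0//.
  rewrite integralE; congr (_ - _)%E; apply: eq_integral => y _.
    by rewrite !funeposE.
  by rewrite !funenegE.
by apply: (measurableT_comp (@fine_measurable R setT measurableT)) => //; exact: emeasurable_funB.
Qed.

Lemma cborel_cintegral_param (F : T1 * T2 -> R[i]) (D : set T2) :
  measurable D -> cborel_fun F -> cborel_fun (fun x => cintegral m2 D (fun y => F (x, y))).
Proof.
move=> mD [mr mi]; split.
  exact: (measurable_Rintegral_param mD mr).
exact: (measurable_Rintegral_param mD mi).
Qed.

End measurable_parameter.

Section transfer.
Context {R : realType} {n : nat}.
Local Notation H := (heisenberg R n).
Local Notation mu := (@heis_measure R n).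
Local Notation Q := (heis_Q n).
Local Notation B := (@heis_cball0 R n).
Variable sigma : {finite_measure set H -> \bar R}.
Hypothesis sigma_sphere : is_sphere_measure sigma.
Local Notation leb := (@lebesgue_measure R).
Local Notation Rpos := (`]0%R, +oo[%classic : set (measurableTypeR R)).
Local Notation sS := (fine (sigma setT)).

Let mRpos : measurable Rpos. Proof. exact: measurable_itv. Qed.

(** For each [t], [dilation_average] makes the set of pairs [(x, y)] that are
    sent into a given null set negligible. Exchanging the integrals puts the
    quantifier on [x] first, as in the operator. *)
Lemma dilate_ae (P : H -> Prop) : (\forall x \ae mu, P x) ->
  \forall x \ae mu, \forall t \ae leb, Rpos t ->
    \forall y \ae sigma, P (dilate_point (x, t, y)).
Proof.
move=> [N [mN N0 PN]].
pose K (z : (H * measurableTypeR R) * H) : \bar R := (\1_N (dilate_point z))%:E.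
have mI : measurable_fun setT (\1_N : H -> R) by exact: measurable_indic.
have mK : measurable_fun setT K.
  by apply/measurable_EFinP; exact: (measurableT_comp mI measurable_dilate_point).
have K0 z : (0 <= K z)%E by rewrite lee_fin.
pose J (z : H * measurableTypeR R) := (\int[sigma]_y K (z, y))%E.
have mJ : measurable_fun setT J.
  exact: (@measurable_fun_fubini_tonelli_F _ _ (H * measurableTypeR R)%type H R sigma _ mK K0).
have J0 z : (0 <= J z)%E by apply: integral_ge0 => y _; exact: K0.
have intJ : (\int[mu]_(x in setT) \int[leb]_(t in Rpos) J (x, t) = 0)%E.
  rewrite (@tonelli_dom _ _ _ _ _ mu leb _ _ J measurableT mRpos mJ J0).
  rewrite (eq_integral (cst 0%E)) ?integral0// => t; rewrite inE/= in_itv/= andbT => t0.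
  have t10 : 0 < t^-1 by rewrite invr_gt0.
  have mIE : measurable_fun setT (EFin \o (\1_N : H -> R)) by exact/measurable_EFinP.
  have IE0 x : (0 <= (EFin \o (\1_N : H -> R)) x)%E by rewrite /= lee_fin.
  have := dilation_average sigma_sphere t10 mIE IE0.
  rewrite (_ : (\int[mu]_x (EFin \o \1_N) x)%E = 0%E); last first.
    by rewrite integral_indic// setIT.
  by rewrite mule0; apply.
have JR0 x : (0 <= \int[leb]_(t in Rpos) J (x, t))%E by exact: integral_ge0.
have mJR : measurable_fun setT (fun x => \int[leb]_(t in Rpos) J (x, t))%E.
  have mJp : measurable_fun setT (fun z : H * measurableTypeR R => J z * (\1_Rpos z.2)%:E)%E.
    apply: emeasurable_funM => //; apply/measurable_EFinP.
    exact: (measurableT_comp (measurable_indic mRpos) measurable_snd).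
  have Jp0 (z : H * measurableTypeR R) : (0 <= J z * (\1_Rpos z.2)%:E)%E by rewrite mule_ge0 ?lee_fin.
  have mF := @measurable_fun_fubini_tonelli_F _ _ H (measurableTypeR R) R leb _ mJp Jp0.
  rewrite (_ : (fun x => _) = fubini_F leb (fun z => J z * (\1_Rpos z.2)%:E)%E); first exact: mF.
  apply/funext => x; rewrite [LHS]integral_mkcond /fubini_F; apply: eq_integral => s _.
  by rewrite patchE indicE /=; case: ifP => _; rewrite ?mule1 ?mule0.
have := ge0_integral_eq0_ae measurableT mJR JR0 intJ.
apply: filterS => x /(_ I) Jx0.
have := ge0_integral_eq0_ae mRpos _ (fun t => J0 (x, t)) Jx0.
move=> /(_ (measurable_funTS (measurableT_comp mJ (pair1_measurable x)))).
apply: filterS => t /[apply] Jxt0.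
have mKx : measurable_fun setT (fun y => K (x, t, y)).
  exact: (measurableT_comp mK (pair1_measurable (x, t))).
have := ge0_integral_eq0_ae measurableT mKx (fun y => K0 (x, t, y)) Jxt0.
apply: filterS => y /(_ I)/= -[]; rewrite indicE => Ny.
apply: contrapT => nP; have : N (dilate_point (x, t, y)) by apply: PN.
by move=> /mem_set; move: Ny; case: (_ \in _) => // /eqP; rewrite oner_eq0.
Qed.

Lemma heis_norm_vertical (t : R) : 0 <= t -> heis_norm ((0%R, t ^+ 2) : H) = t.
Proof.
move=> t0; apply/eqP; rewrite -(@eqrXn2 _ 4%N) ?heis_norm_ge0// heis_norm4 /heis_gauge4 /=.
by rewrite big1 ?expr0n/= ?add0r -?exprM// => i _; rewrite mxE expr0n.
Qed.

(** A Borel version of [Phi] may differ from it all along the vertical axis,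
    where [radial_value] reads its values. The mean of the version over almost
    every sphere is nevertheless the right value, because [Phi] is constant on
    spheres and the exceptional set meets almost every sphere in a null set. *)
Lemma radial_borel_version (Phi : H -> R) :
  completed_measurable_fun mu Phi -> (forall x, 0 <= Phi x) -> is_radial Phi ->
  exists phi : R -> R, [/\ measurable_fun [set: measurableTypeR R] phi,
    forall t, 0 <= phi t & \forall t \ae leb, Rpos t -> radial_value Phi t = phi t].
Proof.
move=> mPhi Phi0 rad.
have [Psi0 [mP [N [mN N0 PN]] /(_ Phi0) P0]] := borel_version mPhi.
have mPE : measurable_fun setT (EFin \o Psi0) by exact/measurable_EFinP.
pose phi (t : R) := fine (\int[sigma]_y (Psi0 (heis_dil t y))%:E) / sS.
have sS0 := fine_sphere_measure_gt0 sigma_sphere.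
exists phi; split.
- apply: measurable_funM => //.
  apply: (measurableT_comp (@fine_measurable R setT measurableT)) => //.
  by apply: (@measurable_sphere_integral _ _ sigma (EFin \o Psi0)) => // x; rewrite /= lee_fin.
- move=> t; rewrite divr_ge0 ?(ltW sS0)// fine_ge0// integral_ge0// => y _.
  by rewrite lee_fin.
pose J (t : R) := (\int[sigma]_y (\1_N (heis_dil t y))%:E)%E.
have mI : measurable_fun setT (EFin \o (\1_N : H -> R)).
  exact/measurable_EFinP/measurable_indic.
have mJ : measurable_fun [set: measurableTypeR R] J.
  by apply: (@measurable_sphere_integral _ _ sigma (EFin \o \1_N)) => // x; rewrite /= lee_fin.
have J0 t : (0 <= J t)%E by apply: integral_ge0 => y _; rewrite lee_fin.
have intJ : (\int[leb]_(t in Rpos) (J t * (`|t| ^+ Q.-1)%:E) = 0)%E.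
  transitivity (\int[mu]_x (\1_N x)%:E)%E; last by rewrite integral_indic// setIT.
  rewrite (polar_integral sigma_sphere mI); last by move=> x; rewrite /= lee_fin.
  apply: eq_integral => t; rewrite inE/= in_itv/= andbT => t0.
  rewrite gtr0_norm// /J -ge0_integralZr//.
    exact: (measurableT_comp mI (measurableT_comp measurable_heis_dil (pair1_measurable _))).
  by rewrite lee_fin exprn_ge0// ltW.
have mJQ : measurable_fun Rpos (fun t => J t * (`|t| ^+ Q.-1)%:E)%E.
  apply: measurable_funTS; apply: emeasurable_funM => //.
  apply/measurable_EFinP/measurable_funX; exact: normr_measurable.
have JQ0 t : (0 <= J t * (`|t| ^+ Q.-1)%:E)%E by rewrite mule_ge0// lee_fin exprn_ge0.
apply: filterS (ge0_integral_eq0_ae mRpos mJQ JQ0 intJ) => t h tp.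
have t0 : 0 < t by move: tp; rewrite /= in_itv/= andbT.
have Jt0 : J t = 0%E.
  have /eqP := h tp; rewrite mule_eq0 => /orP[/eqP//|].
  by rewrite eqe expf_eq0 normr_eq0 gt_eqF// andbF.
have mIt : measurable_fun setT (fun y => (\1_N (heis_dil t y))%:E : \bar R).
  exact: (measurableT_comp mI (measurableT_comp measurable_heis_dil (pair1_measurable _))).
have It0 y : (0 <= (\1_N (heis_dil t y))%:E :> \bar R)%E by rewrite lee_fin.
have ae0 := ge0_integral_eq0_ae measurableT mIt It0 Jt0.
rewrite /phi (eq_integral_ae (g := cst (radial_value Phi t)%:E)).
  rewrite integral_cst//.
  have -> : ((radial_value Phi t)%:E * sigma setT = (radial_value Phi t * sS)%:E)%E.
    by rewrite EFinM -(sphere_measure_fineK sigma).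
  by rewrite /= mulfK// gt_eqF.
apply: filterS2 ae0 (sphere_ae_norm sigma_sphere) => y /(_ I) -[Ny] y1 _ /=.
congr (_%:E); rewrite /radial_value.
have -> : Phi (0, t ^+ 2) = Phi (heis_dil t y).
  by apply: rad; rewrite heis_norm_vertical ?ltW// heis_norm_dil ?ltW// y1 mulr1.
apply: esym; apply: contrapT => ne; have : N (heis_dil t y) by exact: PN ne.
by move=> /mem_set; move: Ny; rewrite indicE; case: (_ \in _) => // /eqP; rewrite oner_eq0.
Qed.

Variables (Phi : H -> R) (Omega b : H -> R[i]).
Variables (phi : R -> R) (om0 b0 : H -> R[i]).
Hypothesis mphi : measurable_fun [set: measurableTypeR R] phi.
Hypothesis phi0 : forall t, 0 <= phi t.
Hypothesis phiE : \forall t \ae leb, Rpos t -> radial_value Phi t = phi t.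
Hypothesis mom0 : cborel_fun om0.
Hypothesis omE : \forall y \ae sigma, Omega y = om0 y.
Hypothesis mb0 : cborel_fun b0.
Hypothesis bE : \forall x \ae mu, b x = b0 x.

Definition borel_integrand (f0 : H -> R[i]) (z : (H * measurableTypeR R) * H) : R[i] :=
  (phi z.1.2 / z.1.2)%:C%C * om0 z.2 * (b0 z.1.1 - b0 (dilate_point z)) * f0 (dilate_point z).

Definition borel_commutator (f0 : H -> R[i]) (x : H) : R[i] :=
  cintegral leb Rpos (fun t => cintegral sigma setT (fun y => borel_integrand f0 (x, t, y))).

Lemma cborel_integrand f0 : cborel_fun f0 -> cborel_fun (borel_integrand f0).
Proof.
move=> mf0; have m11 : measurable_fun setT (fun z : (H * measurableTypeR R) * H => z.1.1).
  exact: (measurableT_comp measurable_fst measurable_fst).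
have m12 : measurable_fun setT (fun z : (H * measurableTypeR R) * H => z.1.2).
  exact: (measurableT_comp measurable_snd measurable_fst).
apply: cborelM; last exact: (cborel_comp mf0 measurable_dilate_point).
apply: cborelM.
  apply: cborelM; last exact: (cborel_comp mom0 measurable_snd).
  apply: cborel_real; apply: measurable_funM; first exact: (measurableT_comp mphi m12).
  exact: (measurableT_comp (@measurable_invr R) m12).
apply: cborelB; first exact: (cborel_comp mb0 m11).
exact: (cborel_comp mb0 measurable_dilate_point).
Qed.

Lemma cborel_commutator f0 : cborel_fun f0 -> cborel_fun (borel_commutator f0).
Proof.
move=> mf0; apply: (@cborel_cintegral_param _ _ H (measurableTypeR R) R leb
  (fun z => cintegral sigma setT (fun y => borel_integrand f0 (z, y))) Rpos mRpos).
exact: (@cborel_cintegral_param _ _ (H * measurableTypeR R)%type H R sigma _ setT measurableT (cborel_integrand mf0)).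
Qed.

Lemma normc_integrand f0 x t y : 0 < t ->
  normc (borel_integrand f0 (x, t, y)) =
  phi t / t * normc (om0 y) * diff_at b0 (x, t, y) * normc (f0 (dilate_point (x, t, y))).
Proof.
move=> t0; rewrite /borel_integrand !Normc.normcM /diff_at /=; congr (_ * _ * _ * _).
by rewrite expr0n/= addr0 sqrtr_sqr ger0_norm// mulr_ge0// invr_ge0 ltW.
Qed.

(** The commutator is an iterated integral, and each integration costs the
    factor 2 of [normc_cintegral_le]. *)
Lemma commutator_majorant f0 x A : cborel_fun f0 -> 0 <= A ->
  (majorant sigma b0 phi (fun z => normc (f0 z)) (fun y => normc (om0 y)) x <= A%:E)%E ->
  normc (borel_commutator f0 x) <= 4 * A.
Proof.
move=> mf0 A0 hA.
have [mr mi] := cborel_integrand mf0.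
have [cr ci] := @cborel_cintegral_param _ _ (H * measurableTypeR R)%type H R sigma _ setT measurableT (cborel_integrand mf0).
pose N (z : (H * measurableTypeR R) * H) : \bar R := (normc (borel_integrand f0 z))%:E.
have mN : measurable_fun setT N.
  by apply/measurable_EFinP; exact: (cborel_normc (cborel_integrand mf0)).
have N0 z : (0 <= N z)%E by rewrite lee_fin; exact: normc_ge0.
have mS : measurable_fun setT (fun z : H * measurableTypeR R => \int[sigma]_y N (z, y))%E.
  exact: (@measurable_fun_fubini_tonelli_F _ _ (H * measurableTypeR R)%type H R sigma _ mN N0).
have S0 t : (0 <= \int[sigma]_y N (x, t, y))%E by apply: integral_ge0 => y _; exact: N0.
rewrite (_ : 4 * A = 2 * (2 * A)); last by ring.
apply: (@normc_cintegral_le _ _ _ leb _ (fun t => 2%:E * \int[sigma]_y N (x, t, y))%E).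
- exact: mRpos.
- by apply: measurable_funTS; exact: (measurableT_comp cr (pair1_measurable x)).
- by apply: measurable_funTS; exact: (measurableT_comp ci (pair1_measurable x)).
- move=> t _; have {S0} := S0 t; set S := (\int[sigma]_y _)%E => S0.
  have [Soo|Sfin] := eqVneq S +oo%E; first by rewrite Soo gt0_muley// leey.
  have SE : S = (fine S)%:E by rewrite fineK// ge0_fin_numE// ltey.
  rewrite SE -EFinM lee_fin.
  apply: (@normc_cintegral_le _ _ _ sigma _ (fun y => N (x, t, y))).
  + exact: measurableT.
  + exact: (measurableT_comp mr (pair1_measurable (x, t))).
  + exact: (measurableT_comp mi (pair1_measurable (x, t))).
  + by move=> y _.
  + by rewrite -SE.
rewrite ge0_integralZl; [|exact: mRpos| | |by rewrite lee_fin].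
- rewrite EFinM; apply: lee_wpmul2l; first by rewrite lee_fin.
  apply: le_trans hA; rewrite le_eqVlt; apply/orP; left; apply/eqP.
  apply: eq_integral => t; rewrite inE/= in_itv/= andbT => t0.
  by apply: eq_integral => y _; rewrite /N normc_integrand.
- by apply: measurable_funTS; exact: (measurableT_comp mS (pair1_measurable x)).
- by move=> t _; exact: S0.
Qed.

Lemma commutator_ae f f0 : (\forall x \ae mu, f x = f0 x) ->
  \forall x \ae mu,
    hausdorff_commutator sigma Phi Omega b f x = borel_commutator f0 x /\
    ((majorant sigma b0 phi (fun z => normc (f0 z)) (fun y => normc (om0 y)) x < +oo)%E ->
     hausdorff_converges sigma Phi Omega b f x).
Proof.
move=> fE.
have bfE : \forall x \ae mu, b x = b0 x /\ f x = f0 x by exact: filterI bE fE.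
apply: filterS2 bE (dilate_ae bfE) => x bx hx.
have inner : \forall t \ae leb, Rpos t -> \forall y \ae sigma,
    hausdorff_integrand Phi Omega b f x t y = borel_integrand f0 (x, t, y).
  apply: filterS2 phiE hx => t pt hxt tp.
  apply: filterS2 omE (hxt tp) => y oy [b_ f_].
  rewrite /hausdorff_integrand /borel_integrand /= (pt tp) oy bx.
  by rewrite [b _]b_ [f _]f_.
split.
  rewrite /hausdorff_commutator /borel_commutator.
  apply: cintegral_ae; apply: filterS inner => t /[apply] h.
  rewrite /cintegral /Rintegral !(sphere_integralE sigma_sphere).
  by congr (Complex (fine _) (fine _)); apply: eq_integral_ae; apply: filterS h => y ->.
move=> Tfin; rewrite /hausdorff_converges; apply: le_lt_trans Tfin.
rewrite le_eqVlt; apply/orP; left; apply/eqP.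
apply: eq_integral_ae; apply: filterS inner => t h tp.
rewrite (sphere_integralE sigma_sphere); apply: eq_integral_ae.
apply: filterS (h tp) => y -> _; rewrite normc_integrand//.
by move: tp; rewrite /= in_itv/= andbT.
Qed.

End transfer.

(** * Weights, norms and constants *)

Section weight_transfer.
Context {R : realType} {n : nat}.
Local Notation H := (heisenberg R n).
Local Notation mu := (@heis_measure R n).
Variables w w' : H -> R.
Hypothesis ww' : \forall x \ae mu, w x = w' x.

Lemma average_comp_ae B (u : R -> \bar R) :
  average B (fun x => u (w x)) = average B (fun x => u (w' x)).
Proof.
by rewrite /average; congr (_ / _)%E; apply: eq_integral_ae; apply: filterS ww' => x ->.
Qed.

Lemma muckenhoupt_ae p : muckenhoupt p w -> muckenhoupt p w'.
Proof.
move=> [C HC]; exists C => x r r0; have := HC x r r0; cbv zeta.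
rewrite /comp (average_comp_ae _ EFin) (average_comp_ae _ (fun u => (u%:E^-1 `^ (p - 1)^-1)%E)).
rewrite /ess_inf_on (@eq_ess_inf _ _ _ mu (patch (fun=> +oo%E) (heis_ball x r) (fun y => (w y)%:E))
  (patch (fun=> +oo%E) (heis_ball x r) (fun y => (w' y)%:E)))//.
by apply: filterS ww' => y; rewrite /patch => ->.
Qed.

Lemma reverse_hoelder_ae r : reverse_hoelder r w -> reverse_hoelder r w'.
Proof.
move=> [C HC]; exists C => x s s0; have := HC x s s0; cbv zeta.
by rewrite /comp (average_comp_ae _ EFin) (average_comp_ae _ (fun u => (u `^ r)%:E)).
Qed.

Lemma wmeasure_ae K : wmeasure w K = wmeasure w' K.
Proof. by apply: eq_integral_ae; apply: filterS ww' => x ->. Qed.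

End weight_transfer.

Lemma critical_index_ae (R : realType) (n : nat) (w w' : heisenberg R n -> R) :
  (\forall x \ae heis_measure, w x = w' x) -> critical_index w = critical_index w'.
Proof.
move=> ww'; have w'w : \forall x \ae heis_measure, w' x = w x.
  by apply: filterS ww' => x ->.
congr ereal_sup; apply/seteqP; split => _ [r [r1 rh] <-]; exists r => //; split => //;
  [exact: reverse_hoelder_ae ww' _ rh|exact: reverse_hoelder_ae w'w _ rh].
Qed.

Lemma normalized_leP (R : realType) (I : \bar R) (V q F : R) :
  0 < V -> 1 <= q -> 0 <= F -> (0 <= I)%E ->
  ((I / V%:E) `^ q^-1 <= F%:E)%E <-> (I <= (F `^ q * V)%:E)%E.
Proof.
move=> V0 q1 F0; have q0 : 0 < q by exact: lt_le_trans q1.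
rewrite inver gt_eqF//; case: I => [I| |]// I0; last first.
  rewrite gt0_mulye ?lte_fin ?invr_gt0// poweRyr ?invr_neq0 ?gt_eqF//.
rewrite -EFinM poweR_EFin !lee_fin -ler_pdivrMr//.
have IV : 0 <= I / V by rewrite divr_ge0// ltW.
have IVE : I / V = ((I / V) `^ q^-1) `^ q by rewrite -powRrM mulVf ?gt_eqF// powRr1.
have FE : F = (F `^ q) `^ q^-1 by rewrite -powRrM mulfV ?gt_eqF// powRr1.
have iq : 0 <= q^-1 by rewrite invr_ge0 ltW.
split=> h; first by rewrite IVE; apply: ge0_ler_powR; rewrite ?nnegrE ?powR_ge0// ltW.
by rewrite FE; apply: ge0_ler_powR; rewrite ?nnegrE ?powR_ge0.
Qed.

(** The norms of the theorem are suprema of normalized integrals; a bound on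
    such a norm is the family of integral bounds that the estimates use and
    produce. *)
Lemma sup_powR_leP (R : realType) (I : R -> \bar R) (V : R -> R) (J : R -> \bar R) (q F : R) :
  (forall r, 0 < r -> J r = (V r)%:E) -> (forall r, 0 < r -> 0 < V r) -> 1 <= q ->
  0 <= F -> (forall r, 0 <= I r)%E ->
  (ereal_sup [set (I r / J r) `^ q^-1 | r in [set r : R | (0 < r)%R]] <= F%:E)%E <->
  (forall r, 0 < r -> (I r <= (F `^ q * V r)%:E)%E).
Proof.
move=> JE V0 q1 F0 I0; split=> [h r r0|h].
  apply/(normalized_leP (V0 r r0) q1 F0 (I0 r)); apply: le_trans h.
  by rewrite -JE//; apply: ereal_sup_ubound; exists r.
apply: ge_ereal_sup => _ [r r0 <-]; rewrite JE//.
by apply/(normalized_leP (V0 r r0) q1 F0 (I0 r)); exact: h.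
Qed.

Lemma sup_powR_ge0 (R : realType) (I J : R -> \bar R) (q : R) :
  (0 <= ereal_sup [set (I r / J r) `^ q^-1 | r in [set r : R | (0 < r)%R]])%E.
Proof.
apply: (le_trans (poweR_ge0 (I 1%R / J 1%R)%E q^-1)).
by apply: ereal_sup_ubound; exists 1%R => //=.
Qed.

Lemma hoelder_conjugate_bound d (T : measurableType d) (R : realType)
    (mu : {measure set T -> \bar R}) (q : R) (f : T -> R) :
  (0 < mu setT)%E -> 1 <= q -> (forall x, 0 <= f x) ->
  (Lnorm mu (hoelder_conjugate q%:E) (EFin \o f) < +oo)%E ->
  exists2 L : R, 0 <= L &
    if q == 1 then \forall x \ae mu, f x <= L
    else (\int[mu]_x (f x `^ (1 - q^-1)^-1)%:E <= L%:E)%E.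
Proof.
move=> mu0 q_ge1 f0; have [->|q1] := eqVneq q 1.
  rewrite hoelder_conjugate1 unlock /= mu0 => supoo.
  have := ess_sup_ge mu (abse \o (EFin \o f)).
  move: supoo; set s := ess_sup mu _ => soo fs; exists (Num.max 0 (fine s)).
    by rewrite le_max lexx.
  apply: filterS fs => x; rewrite /= ger0_norm ?f0//.
  by case: s soo => [s| |]//= _; rewrite lee_fin le_max => ->; rewrite orbT.
have q_gt1 : 1 < q by rewrite lt_neqAle eq_sym q1.
have q0 : 0 < q by exact: lt_trans q_gt1.
have i1 : 0 < 1 - q^-1 by rewrite subr_gt0 invf_lt1.
have -> : hoelder_conjugate q%:E = ((1 - q^-1)^-1)%:E.
  rewrite /hoelder_conjugate /= eqe gt_eqF//= -EFinB inver subr_eq0 (negbTE q1) -EFinM.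
  congr (_%:E); have : q - 1 != 0 by rewrite subr_eq0.
  by move=> q1'; field; rewrite gt_eqF//.
rewrite unlock /= => /lty_poweRy; rewrite invrK gt_eqF// => /(_ isT).
set J := (\int[mu]_x _)%E => Joo.
have J0 : (0 <= J)%E by apply: integral_ge0 => x _; rewrite lee_fin powR_ge0.
exists (fine J); first exact: fine_ge0.
rewrite fineK ?ge0_fin_numE// le_eqVlt; apply/orP; left; apply/eqP.
by apply: eq_integral => x _; rewrite ger0_norm.
Qed.

(** The two integrals of [C9] are the two branches of [growth_factor], the
    factor [t^-1] of the operator being part of the power of [t]. *)
Lemma kernel_mass_integral (R : realType) (n : nat) (Phi : heisenberg R n -> R)
    (phi : R -> R) (zeta delta lam : R) :
  measurable_fun [set: measurableTypeR R] phi -> (forall t, 0 <= phi t) ->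
  (\forall t \ae lebesgue_measure, (`]0%R, +oo[%classic : set (measurableTypeR R)) t -> radial_value Phi t = phi t) ->
  (\int[lebesgue_measure]_(t in (`]0%R, +oo[%classic : set (measurableTypeR R)))
     (kernel_mass (n := n) zeta delta lam phi t)%:E = C9 Phi zeta lam delta)%E.
Proof.
move=> mphi phi0 phiE.
have powR1D (t a : R) : 0 < t -> t `^ (1 + a) = t * t `^ a.
  by move=> t0; rewrite powRD ?powRr1 ?(ltW t0)// (gt_eqF t0) implybT.
have massE (t a : R) : 0 < t -> radial_value Phi t = phi t ->
    radial_value Phi t / t `^ (1 + a) * (2 + @Psi R n t) =
    phi t / `|t| * (t `^ (- a) * (2 + @Psi R n t)).
  by move=> t0 ->; rewrite powR1D// invfM -powRN gtr0_norm// !mulrA.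
have -> : (`]0%R, +oo[%classic : set (measurableTypeR R)) = `]0%R, 1%R] `|` `]1%R, +oo[.
  apply/seteqP; split => t /=; rewrite !in_itv /= !andbT.
    by move=> t0; have [t1|t1] := leP t 1; [left; rewrite t0|right].
  by case=> [/andP[]//|]; exact: lt_trans.
rewrite ge0_integral_setU.
- rewrite /C9; congr (_ + _)%E; apply: eq_integral_ae; apply: filterS phiE => t pt;
    rewrite /= in_itv /= ?andbT => tI; congr (_%:E); rewrite /kernel_mass /dilation_gain /growth_factor.
    case/andP: tI => t0 t1; rewrite t1 massE//.
    by apply: pt; rewrite /= in_itv /= t0.
  have t0 : 0 < t by exact: lt_trans tI.
  rewrite leNgt tI /= massE//.
  by apply: pt; rewrite /= in_itv /= t0.
- exact: measurable_itv.
- exact: measurable_itv.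
- apply: measurable_funTS; apply/measurable_EFinP; apply: measurable_kernel_mass => //.
- by move=> t _; rewrite lee_fin; apply: kernel_mass_ge0.
- apply/disj_setPLR => t /=; rewrite !in_itv /= andbT => /andP[_ t1] t1'.
  by move: (lt_le_trans t1' t1); rewrite ltxx.
Qed.

Lemma compact_heis_cball0 (R : realType) (n : nat) (K : set (heisenberg R n)) :
  compact K -> exists2 r, 0 < r & K `<=` heis_cball0 r.
Proof.
move=> cK.
have cg : continuous (heis_gauge4 : heisenberg R n -> R).
  move=> x; apply: cvgD.
    apply: (@continuous_comp _ _ _ (fun x : heisenberg R n => \sum_(i < n + n) x.1 ord0 i ^+ 2) (fun u => u ^+ 2)).
      apply: cvg_big => [|i _]; first exact: add_continuous.
      apply: (@continuous_comp _ _ _ (fun x : heisenberg R n => x.1 ord0 i) (fun u => u ^+ 2)); last exact: exprn_continuous.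
      apply: (@continuous_comp _ _ _ (fun x : heisenberg R n => x.1) (fun u : 'rV[R]_(n + n) => u ord0 i)).
        exact: cvg_fst.
      exact: coord_continuous.
    exact: exprn_continuous.
  apply: (@continuous_comp _ _ _ (fun x : heisenberg R n => x.2) (fun u => u ^+ 2)); last exact: exprn_continuous.
  exact: cvg_snd.
have /compact_bounded[M [Mr HM]] : compact (heis_gauge4 @` K).
  by apply: continuous_compact => //; exact: continuous_subspaceT.
exists (Num.max 1 (M + 1)) => [|x Kx]; first by rewrite lt_max ltr01.
have r1 : 1 <= Num.max 1 (M + 1) by rewrite le_max lexx.
rewrite /heis_cball0 /= heis_norm_le ?(le_trans ler01)//.
apply: (@le_trans _ _ (Num.max 1 (M + 1))); last by rewrite exprS ler_peMr ?exprn_ege1 ?(le_trans ler01).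
apply: le_trans (ler_norm _) _; apply: HM; last by exists x.
by rewrite lt_max ltrDl ltr01 orbT.
Qed.

(** * Boundedness of the commutator *)

(** A synonym of [mu] to which the structure of a finite measure can be
    attached, the finiteness of the sphere measure being a theorem and not a
    part of its type. *)
Definition finite_copy d (T : measurableType d) (R : realType)
  (mu : {measure set T -> \bar R}) (fin : fin_num_fun mu) : set T -> \bar R := mu.

HB.instance Definition _ d (T : measurableType d) (R : realType)
    (mu : {measure set T -> \bar R}) (fin : fin_num_fun mu) :=
  Measure.copy (finite_copy fin) mu.
HB.instance Definition _ d (T : measurableType d) (R : realType)
    (mu : {measure set T -> \bar R}) (fin : fin_num_fun mu) :=
  @Measure_isFinite.Build d T R (finite_copy fin) fin.

(** All data are replaced by Borel representatives, for which the integral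
    estimates hold; the statements about the commutator itself follow because it
    agrees almost everywhere with its Borel counterpart. *)
Lemma finite_sphere_commutator_bounded (R : realType) (n : nat)
    (sigma : {finite_measure set (heisenberg R n) -> \bar R})
    (sigma_sphere : is_sphere_measure sigma)
    (Phi : heisenberg R n -> R)
    (Phi_meas : completed_measurable_fun heis_measure Phi)
    (Phi_ge0 : forall x, 0 <= Phi x)
    (Phi_radial : is_radial Phi)
    (Omega : heisenberg R n -> R[i])
    (Omega_meas : cmeasurable_fun sigma Omega)
    (b : heisenberg R n -> R[i])
    (b_meas : cmeasurable_fun heis_measure b)
    (q q1 r1 zeta : R)
    (q_ge1 : 1 <= q) (q1_ge1 : 1 <= q1) (r1_ge1 : 1 <= r1)
    (zeta_ge1 : 1 <= zeta) (zeta_le : zeta <= r1)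
    (w : heisenberg R n -> R)
    (w_weight : is_weight w)
    (w_A : muckenhoupt zeta w)
    (rw : R)
    (rwE : critical_index w = rw%:E)
    (Omega_L : (Lnorm sigma (hoelder_conjugate q%:E)
                  (fun y => (normc (Omega y))%:E) < +oo)%E)
    (b_cmo : (cmo_norm r1 w b < +oo)%E)
    (q_index : 1 / q > (1 / q1 + 1 / r1) * zeta * (rw / (rw - 1)))
    (delta lam : R)
    (delta_gt1 : 1 < delta) (delta_lt : delta < rw)
    (lam_lt0 : lam < 0)
    (C9_fin : (C9 Phi zeta lam delta < +oo)%E) :
  hausdorff_bounded sigma Phi Omega b
    (morrey q1 lam w) (morrey_norm q1 lam w)
    (morrey q lam w) (morrey_norm q lam w).
Proof.
have [w' [mw' ww' /(_ w_weight.2) w'0]] := borel_version w_weight.1.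
have [phi [mphi phi0 phiE]] := radial_borel_version sigma_sphere Phi_meas Phi_ge0 Phi_radial.
have [om0 mom0 omE] := cborel_version Omega_meas.
have [b0 mb0 bE] := cborel_version b_meas.
have w'_A := muckenhoupt_ae ww' w_A.
have rw'E : critical_index w' = rw%:E by rewrite -(critical_index_ae ww').
have rw1 : 1 < rw by exact: lt_trans delta_lt.
pose W := weight_mass w'.
have WE r : 0 < r -> wmeasure w (heis_cball0 r) = (W r)%:E.
  by move=> r0; rewrite (wmeasure_ae ww') (weight_massE sigma_sphere mw' w'0 zeta_ge1 w'_A rw'E r0).
have W0 r : 0 < r -> 0 < W r.
  exact: (weight_mass_gt0 sigma_sphere mw' w'0 zeta_ge1 w'_A rw'E).
pose om y := normc (om0 y).
have [L L0 om_fin] : exists2 L, 0 <= L &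
    if q == 1 then \forall y \ae sigma, om y <= L
    else (\int[sigma]_y (om y `^ (1 - q^-1)^-1)%:E <= L%:E)%E.
  have [L L0 h] := hoelder_conjugate_bound (sphere_measure_gt0 sigma_sphere) q_ge1 (fun y => normc_ge0 (Omega y)) Omega_L.
  exists L; first exact: L0.
  move: h; case: (q == 1) => h.
    by apply: filterS2 omE h => y; rewrite /om => ->.
  apply: le_trans h; rewrite le_eqVlt; apply/orP; left; apply/eqP.
  by apply: eq_integral_ae; apply: filterS omE => y; rewrite /om => -> _.
pose Mk := fine (C9 Phi zeta lam delta).
have massE := kernel_mass_integral zeta delta lam mphi phi0 phiE.
have C90 : (0 <= C9 Phi zeta lam delta)%E.
  by rewrite -massE; apply: integral_ge0 => t _; rewrite lee_fin; apply: kernel_mass_ge0.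
have kernel_fin : (\int[lebesgue_measure]_(t in (`]0%R, +oo[%classic : set (measurableTypeR R)))
     (kernel_mass (n := n) zeta delta lam phi t)%:E <= Mk%:E)%E.
  by rewrite massE fineK// ge0_fin_numE.
have Mk0 : 0 <= Mk by exact: fine_ge0.
pose M := fine (cmo_norm r1 w b).
have M0 : 0 <= M by apply: fine_ge0; exact: sup_powR_ge0.
have b_osc r : 0 < r ->
    (\int[heis_measure]_(x in heis_cball0 r) (normc (b0 x - cball0_mean b0 r) `^ r1 * w' x)%:E
       <= (M `^ r1 * W r)%:E)%E.
  move=> r0.
  have bM : (cmo_norm r1 w b <= M%:E)%E by rewrite fineK// ge0_fin_numE//; exact: sup_powR_ge0.
  have meanE : cball0_mean b r = cball0_mean b0 r.
    by rewrite /cball0_mean; congr (_ * _); apply: cintegral_ae; apply: filterS bE.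
  have I0 s : (0 <= \int[heis_measure]_(x in heis_cball0 s)
      (normc (b x - cball0_mean b s) `^ r1 * w x)%:E)%E.
    by apply: integral_ge0 => x _; rewrite lee_fin mulr_ge0 ?powR_ge0//; exact: w_weight.2.
  apply: le_trans ((sup_powR_leP WE W0 r1_ge1 M0 I0).1 bM r r0).
  rewrite le_eqVlt; apply/orP; left; apply/eqP; apply: eq_integral_ae.
  by apply: filterS2 ww' bE => x -> -> _; rewrite meanE.
have [C1 C10 slice] := commutator_slice_le sigma_sphere mw' w'0 zeta_ge1 w'_A rw'E
  q_ge1 q1_ge1 r1_ge1 rw1 q_index delta_gt1 delta_lt lam_lt0 zeta_le mb0 M0 b_osc.
have q0 : 0 < q by exact: lt_le_trans q_ge1.
pose c := 4 * ((Mk * L) `^ (1 - q^-1) + L).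
have c0 : 0 <= c `^ q * C1 * Mk by rewrite !mulr_ge0 ?powR_ge0.
pose C := (c `^ q * C1 * Mk) `^ q^-1.
have CE : C `^ q = c `^ q * C1 * Mk by rewrite -powRrM mulVf ?gt_eqF// powRr1.
exists C => f [[f_meas _] f_fin].
have [f0 mf0 fE] := cborel_version f_meas.
pose g x := normc (f0 x).
have mg : measurable_fun setT g by exact: (cborel_normc mf0).
have g0 x : 0 <= g x by exact: normc_ge0.
have mom : measurable_fun setT om by exact: (cborel_normc mom0).
have om_ge0 y : 0 <= om y by exact: normc_ge0.
pose F := fine (morrey_norm q1 lam w f).
have norm0 : (0 <= morrey_norm q1 lam w f)%E by exact: sup_powR_ge0.
have FE : morrey_norm q1 lam w f = F%:E by rewrite fineK// ge0_fin_numE.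
have F0 : 0 <= F by exact: fine_ge0.
have WpE a r : 0 < r -> (wmeasure w (heis_cball0 r) `^ a = (W r `^ a)%:E)%E.
  by move=> r0; rewrite WE.
have Wp0 a r : 0 < r -> 0 < W r `^ a by move=> r0; apply: powR_gt0; exact: W0.
have I0 p (h : heisenberg R n -> R[i]) r :
    (0 <= \int[heis_measure]_(x in heis_cball0 r) (normc (h x) `^ p * w x)%:E)%E.
  by apply: integral_ge0 => x _; rewrite lee_fin mulr_ge0 ?powR_ge0//; exact: w_weight.2.
have gF : morrey_bound w' q1 lam g F.
  move=> r r0; have fF : (morrey_norm q1 lam w f <= F%:E)%E by rewrite FE.
  apply: le_trans ((sup_powR_leP (WpE (1 + lam * q1)) (Wp0 (1 + lam * q1)) q1_ge1 F0 (I0 q1 f)).1 fF r r0).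
  rewrite le_eqVlt; apply/orP; left; apply/eqP; apply: eq_integral_ae.
  by apply: filterS2 ww' fE => x -> ->.
have sliceF r t (r0 : 0 < r) (t0 : 0 < t) := slice r t F g r0 t0 F0 mg g0 gF.
have HfE := commutator_ae sigma_sphere phi0 phiE omE bE fE.
have maj_fin := majorant_lty_ae sigma_sphere mw' w'0 zeta_ge1 w'_A rw'E q_ge1 mb0 mphi phi0
  mg g0 C10 F0 sliceF kernel_fin mom om_ge0 L0 om_fin.
have Hf0_le r (r0 : 0 < r) := majorized_le sigma_sphere mw' w'0 zeta_ge1 w'_A rw'E q_ge1 mb0 mphi phi0
  mg g0 C10 F0 sliceF kernel_fin mom om_ge0 L0 om_fin r0
  (fun x => normc_ge0 (borel_commutator sigma phi om0 b0 f0 x))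
  (fun x A => @commutator_majorant _ _ sigma phi om0 b0 mphi phi0 mom0 mb0 f0 x A mf0).
set Tf := hausdorff_commutator sigma Phi Omega b f.
have Tf_le r : 0 < r -> (\int[heis_measure]_(x in heis_cball0 r) (normc (Tf x) `^ q * w x)%:E <=
    ((C * F) `^ q * W r `^ (1 + lam * q))%:E)%E.
  move=> r0; have -> : (C * F) `^ q * W r `^ (1 + lam * q) =
      c `^ q * (C1 * F `^ q * W r `^ (1 + lam * q) * Mk).
    by rewrite powRM ?powR_ge0// CE; ring.
  apply: le_trans (Hf0_le r r0); rewrite le_eqVlt; apply/orP; left; apply/eqP.
  by apply: eq_integral_ae; apply: filterS2 ww' HfE => x -> [Tfx _]; rewrite /Tf Tfx.
have norm_le : (morrey_norm q lam w Tf <= (C * F)%:E)%E.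
  have CF0 : 0 <= C * F by rewrite mulr_ge0// powR_ge0.
  exact: (sup_powR_leP (WpE (1 + lam * q)) (Wp0 (1 + lam * q)) q_ge1 CF0 (I0 q Tf)).2.
split.
- by apply: filterS2 maj_fin HfE => x xfin [_]; apply.
- split; last exact: le_lt_trans norm_le (ltry _).
  split.
    apply: (@cmeasurable_fun_ae _ _ _ _ Tf (borel_commutator sigma phi om0 b0 f0)).
      exact: (cborel_commutator sigma mphi mom0 mb0 mf0).
    by apply: filterS HfE => x [].
  move=> K /compact_heis_cball0[r r0 Kr] _.
  apply: le_lt_trans (le_lt_trans (Tf_le r r0) (ltry _)).
  have Tw0 x : (0 <= (normc (Tf x) `^ q * w x)%:E)%E.
    by rewrite lee_fin mulr_ge0 ?powR_ge0//; exact: w_weight.2.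
  rewrite integral_mkcond [leRHS]integral_mkcond; apply: le_integral_ae => [x _|x _|].
  + by rewrite patchE; case: ifP => // _; exact: Tw0.
  + by rewrite patchE; case: ifP => // _; exact: Tw0.
  apply/aeW => x _; rewrite !patchE; case: ifPn => xK.
    by rewrite mem_set//; apply: Kr; exact: set_mem.
  by case: ifP => // _; exact: Tw0.
- by rewrite FE -EFinM.
Qed.

Theorem theorem4p4 (R : realType) (n : nat)
    (sigma : {measure set (heisenberg R n) -> \bar R})
    (sigma_sphere : is_sphere_measure sigma)
    (Phi : heisenberg R n -> R)
    (Phi_meas : completed_measurable_fun heis_measure Phi)
    (Phi_ge0 : forall x, 0 <= Phi x)
    (Phi_radial : is_radial Phi)
    (Omega : heisenberg R n -> R[i])
    (Omega_meas : cmeasurable_fun sigma Omega)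
    (Omega_neq0 : \forall y \ae sigma, Omega y != 0)
    (b : heisenberg R n -> R[i])
    (b_loc : loc_integrable b)
    (q q1 r1 zeta : R)
    (q_ge1 : 1 <= q) (q1_ge1 : 1 <= q1) (r1_ge1 : 1 <= r1)
    (zeta_ge1 : 1 <= zeta) (zeta_le : zeta <= r1)
    (w : heisenberg R n -> R)
    (w_weight : is_weight w)
    (w_A : muckenhoupt zeta w)
    (rw : R)
    (rwE : critical_index w = rw%:E)
    (Omega_L : (Lnorm sigma (hoelder_conjugate q%:E)
                  (fun y => (Normc.normc (Omega y))%:E) < +oo)%E)
    (b_cmo : cmo r1 w b)
    (q_index : 1 / q > (1 / q1 + 1 / r1) * zeta * (rw / (rw - 1)))
    (delta lam : R)
    (delta_gt1 : 1 < delta) (delta_lt : delta < rw)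
    (lam_gt : - (1 / q1) < lam) (lam_lt0 : lam < 0)
    (C9_fin : (C9 Phi zeta lam delta < +oo)%E) :
  hausdorff_bounded sigma Phi Omega b
    (morrey q1 lam w) (morrey_norm q1 lam w)
    (morrey q lam w) (morrey_norm q lam w).
Proof.
have fs : fin_num_fun sigma := lty_fin_num_fun (sphere_measure_lty sigma_sphere).
have OL : (Lnorm (finite_copy fs) (hoelder_conjugate q%:E)
    (fun y => (normc (Omega y))%:E) < +oo)%E.
  by move: Omega_L; rewrite !unlock.
exact: (@finite_sphere_commutator_bounded R n (finite_copy fs) sigma_sphere Phi Phi_meas Phi_ge0
  Phi_radial Omega Omega_meas b b_loc.1 q q1 r1 zeta q_ge1 q1_ge1 r1_ge1 zeta_ge1 zeta_le w w_weight
  w_A rw rwE OL b_cmo.2 q_index delta lam delta_gt1 delta_lt lam_lt0 C9_fin).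
Qed.
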